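(* Let $\mu:[0,1]^2\to\mathbb{R}$ be Riemann-integrable with $\mu>0$. For $n\ge 1$ let $A_n=\begin{bmatrix}A_{x,n}&0\\0&A_{y,n}\end{bmatrix}$, $A_{x,n}=A_{y,n}$, be the velocity stiffness matrix of the Taylor–Hood $\mathbb{P}_2$-$\mathbb{P}_1$ discretization with viscosity $\mu$ on the uniform mesh $\Omega_n$ of $(0,1)^2$ (as defined in the context). Let $h_3(\theta_1,\theta_2)=\frac16(1+e^{i\theta_1})(1+e^{i\theta_2})$ and let $\hat G:[-\pi,\pi]^2\to\mathbb{C}^{8\times 8}$ be the Hermitian matrix-valued function $$\hat G(\theta_1,\theta_2)=\begin{bmatrix} \frac{16}{3} & 0 & -\frac43 & -\frac43 e^{i\theta_2} & 0 & 0 & -\frac43 e^{i\theta_1} & -\frac43 e^{i(\theta_1+\theta_2)}\\ 0 & \frac{16}{3} & -\frac43 & -\frac43 & 0 & 0 & -\frac43 e^{i\theta_1} & -\frac43 e^{i\theta_1}\\ -\frac43 & -\frac43 & 4 & 0 & -\frac43 & -\frac43 e^{i\theta_2} & 0 & 2h_3\\ -\frac43 e^{-i\theta_2} & -\frac43 & 0 & \frac{16}{3} & -\frac43 & -\frac43 & 0 & 0\\ 0 & 0 & -\frac43 & -\frac43 & \frac{16}{3} & 0 & -\frac43 & -\frac43\\ 0 & 0 & -\frac43 e^{-i\theta_2} & -\frac43 & 0 & \frac{16}{3} & -\frac43 e^{-i\theta_2} & -\frac43\\ -\frac43 e^{-i\theta_1} & -\frac43 e^{-i\theta_1} & 0 &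 0 & -\frac43 & -\frac43 e^{i\theta_2} & \frac{16}{3} & 0\\ -\frac43 e^{-i(\theta_1+\theta_2)} & -\frac43 e^{-i\theta_1} & 2\overline{h_3} & 0 & -\frac43 & -\frac43 & 0 & 4 \end{bmatrix}.$$ Set $f(x,y,\theta_1,\theta_2)=\mu(x,y)\,\hat G(\theta_1,\theta_2)$ and $F=\begin{bmatrix} f&0\\0&f\end{bmatrix}$ on $D=[0,1]^2\times[-\pi,\pi]^2$. Then $$\{A_{x,n}\}_n\sim_\lambda (f,D)\qquad\text{and}\qquad \{A_n\}_n\sim_\lambda (F,D).$$
   Context: Mesh: for each $n\ge1$, $\Omega_n$ is the triangulation of $(0,1)^2$ obtained by dividing the square into $n\times n$ equal square cells of side $1/n$ and cutting each cell by its two diagonals into four right isosceles triangles. Matrix $A_{x,n}$: let $\{\phi_i\}$ be the standard nodal (Lagrange) basis of continuous functions on $[0,1]^2$ that are polynomials of degree at most $2$ on each triangle of $\Omega_n$ and vanish on the boundary (nodes: interior vertices and interior edge midpoints; there are $8n^2-4n+1$ of them). Then $(A_{x,n})_{ij}=\sum_{K\in\Omega_n}\mu_K\int_K\nabla\phi_j\cdot\nabla\phi_i$, where $\mu_K$ is the value of $\mu$ at the midpoint (barycenter) of the triangle $K$. $A_{y,n}$ is the same matrix, for the second velocity component. This is the discretization of the diffusion operator $-\nabla\cdot(\mu\nabla u)$ in the Stokes problem $-\nabla\cdot(\mu\nabla u)+\nabla p=g$, $-\nabla\cdot u=0$ in $(0,1)^2$, $u=0$ on the boundary. Eigenvalue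 distribution: let $D\subset\mathbb{R}^q$ be measurable with $0<\mathrm{meas}(D)<\infty$, let $\kappa:D\to\mathbb{C}^{s\times s}$ be measurable with eigenvalues $\lambda_1(\kappa),\dots,\lambda_s(\kappa)$, and let $X_n$ be square matrices of size $d_n\to\infty$. One writes $\{X_n\}_n\sim_\lambda(\kappa,D)$ if for every continuous compactly supported function $\Phi$, $$\lim_{n\to\infty}\frac1{d_n}\sum_{j=1}^{d_n}\Phi(\lambda_j(X_n))=\frac1{\mathrm{meas}(D)}\int_D\frac1s\sum_{i=1}^s\Phi(\lambda_i(\kappa(t)))\,dt.$$ *)

(* Defs.v *)
From HB Require Import structures.
From mathcomp Require Import all_boot all_order all_algebra complex.
From mathcomp Require Import all_classical all_reals all_analysis.
From mathcomp Require Import measurable_realfun.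

Set Implicit Arguments.
Unset Strict Implicit.
Unset Printing Implicit Defensive.

Import Order.TTheory GRing.Theory Num.Theory.
Import numFieldNormedType.Exports.

Local Open Scope classical_set_scope.
Local Open Scope complex_scope.
Local Open Scope ring_scope.

Section Mesh.
Context {R : realFieldType}.

Definition pt : Type := (R * R)%type.
Definition tri : Type := (pt * pt * pt)%type.

Definition midpoint (p q : pt) : pt := ((p.1 + q.1) / 2, (p.2 + q.2) / 2).

Definition barycenter (K : tri) : pt :=
  let: (a, b, c) := K in ((a.1 + b.1 + c.1) / 3, (a.2 + b.2 + c.2) / 3).

Definition barypoint (K : tri) (u v w : R) : pt :=
  let: (a, b, c) := K in
  (u * a.1 + v * b.1 + w * c.1, u * a.2 + v * b.2 + w * c.2).

Definition closed_tri (K : tri) : set pt :=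
  [set p | exists u v w : R,
     [/\ 0 <= u, 0 <= v, 0 <= w, u + v + w = 1 & p = barypoint K u v w]].

Definition open_tri (K : tri) : set pt :=
  [set p | exists u v w : R,
     [/\ 0 < u, 0 < v, 0 < w, u + v + w = 1 & p = barypoint K u v w]].

(* The cell [i/n, (i+1)/n] x [j/n, (j+1)/n] cut by its two diagonals. *)
Definition cell_triangles (n i j : nat) : seq tri :=
  let a : pt := (i%:R / n%:R, j%:R / n%:R) in
  let b : pt := (i.+1%:R / n%:R, j%:R / n%:R) in
  let c : pt := (i.+1%:R / n%:R, j.+1%:R / n%:R) in
  let d : pt := (i%:R / n%:R, j.+1%:R / n%:R) in
  let m := midpoint a c in
  [:: (m, a, b); (m, b, c); (m, c, d); (m, d, a)].

Definition mesh (n : nat) : seq tri :=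
  flatten [seq cell_triangles n i j | i <- iota 0 n, j <- iota 0 n].

Definition tri_nodes (K : tri) : seq pt :=
  let: (a, b, c) := K in
  [:: a; b; c; midpoint a b; midpoint b c; midpoint c a].

Definition interior_pt (p : pt) : bool := (0 < p.1 < 1) && (0 < p.2 < 1).

(* The enumeration fixes an ordering of the unknowns; eigenvalues do not
   depend on it. *)
Definition interior_nodes (n : nat) : seq pt :=
  undup [seq p <- flatten [seq tri_nodes K | K <- mesh n] | interior_pt p].

(* phi agrees on A with a bivariate polynomial of total degree at most 2. *)
Definition quadratic_on (A : set pt) (phi : pt -> R) : Prop :=
  exists c00 c10 c01 c20 c11 c02 : R, forall p, A p ->
    phi p = c00 + c10 * p.1 + c01 * p.2
            + c20 * p.1 ^+ 2 + c11 * (p.1 * p.2) + c02 * p.2 ^+ 2.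

End Mesh.

Arguments pt : clear implicits.
Arguments tri : clear implicits.
Arguments mesh : clear implicits.
Arguments interior_nodes : clear implicits.

Definition dofs (R : realFieldType) (n : nat) : nat :=
  size (interior_nodes R n).

Section ProductSigmaFinite.
Local Open Scope ereal_scope.
Context d1 d2 (T1 : measurableType d1) (T2 : measurableType d2) (R : realType).
Variable m1 : {sigma_finite_measure set T1 -> \bar R}.
Variable m2 : {sigma_finite_measure set T2 -> \bar R}.

Lemma product_sigma_finite : sigma_finite setT (m1 \x m2).
Proof.
have /sigma_finiteP[F [TF ndF Foo]] := sigma_finiteT m1.
have /sigma_finiteP[G [TG ndG Goo]] := sigma_finiteT m2.
exists (fun n => F n `*` G n).
  rewrite -setXTT TF TG predeqE => -[x y]; split.
    move=> [/= [n _ Fnx] [k _ Gky]]; exists (maxn n k) => //; split.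
    - by move: x Fnx; exact/subsetPset/ndF/leq_maxl.
    - by move: y Gky; exact/subsetPset/ndG/leq_maxr.
  by move=> [n _ []/= ? ?]; split; exists n.
move=> k; have [? ?] := Foo k; have [? ?] := Goo k.
split; first exact: measurableX.
by rewrite product_measure1E// lte_mul_pinfty// ge0_fin_numE.
Qed.

End ProductSigmaFinite.

Section LebesguePlane.
Context {R : realType}.

(* Named so that it can carry a sigma-finiteness instance: on a bare product
   the canonical instance found is the one for subprobabilities. *)
Definition leb2 : set (measurableTypeR R * measurableTypeR R)%type -> \bar R :=
  (@lebesgue_measure R \x @lebesgue_measure R)%E.

HB.instance Definition _ := Measure.on leb2.

HB.instance Definition _ := Measure_isSigmaFinite.Build _ _ _ leb2
  (product_sigma_finite (@lebesgue_measure R) (@lebesgue_measure R)).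

(* R^4 is represented as (R * R) * (R * R). *)
Definition leb4 :
    set ((measurableTypeR R * measurableTypeR R) *
         (measurableTypeR R * measurableTypeR R))%type -> \bar R :=
  (leb2 \x leb2)%E.

HB.instance Definition _ := Measure.on leb4.

HB.instance Definition _ := Measure_isSigmaFinite.Build _ _ _ leb4
  (product_sigma_finite leb2 leb2).

End LebesguePlane.

Section Discretization.
Context {R : realType}.

Definition unit_square : set (R * R) := `[0, 1]%classic `*` `[0, 1]%classic.

Record P2_zero_boundary (n : nat) (phi : R * R -> R) : Prop := {
  P2_continuous : {within unit_square, continuous phi};
  P2_quadratic : forall K, K \in mesh R n -> quadratic_on (closed_tri K) phi;
  P2_boundary : forall p, unit_square p -> ~~ interior_pt p -> phi p = 0 }.

Definition nodal_basis (n : nat) (phi : 'I_(dofs R n) -> R * R -> R) : Prop :=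
  (forall i, P2_zero_boundary n (phi i)) /\
  (forall i j : 'I_(dofs R n), phi i (nth 0 (interior_nodes R n) j) = (i == j)%:R).

Definition grad_dot (f g : R * R -> R) (p : R * R) : R :=
  'D_(1, 0) f p * 'D_(1, 0) g p + 'D_(0, 1) f p * 'D_(0, 1) g p.

(* Integration is over the open triangle, since the gradient of a piecewise
   polynomial is in general undefined on the edges. *)
Definition stiffness (mu : R * R -> R) (n : nat)
    (phi : 'I_(dofs R n) -> R * R -> R) : 'M[R]_(dofs R n) :=
  \matrix_(i, j) \sum_(K <- mesh R n)
    mu (barycenter K) *
      (\int[leb2]_(p in open_tri K) grad_dot (phi j) (phi i) p).

End Discretization.

Section RiemannIntegrability.
Context {R : realType}.
Variable f : R * R -> R.

(* [s] stands for the partition whose points are 0 and the elements of s. *)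
Definition knot (s : seq R) (i : nat) : R := nth 1 (0 :: s) i.

Definition cell (s t : seq R) (i j : nat) : set (R * R) :=
  `[knot s i, knot s i.+1]%classic `*` `[knot t j, knot t j.+1]%classic.

Definition cell_area (s t : seq R) (i j : nat) : R :=
  (knot s i.+1 - knot s i) * (knot t j.+1 - knot t j).

Definition upper_sum (s t : seq R) : R :=
  \sum_(i < size s) \sum_(j < size t) cell_area s t i j * sup (f @` cell s t i j).

Definition lower_sum (s t : seq R) : R :=
  \sum_(i < size s) \sum_(j < size t) cell_area s t i j * inf (f @` cell s t i j).

Definition upper_integral : R :=
  inf [set I | exists s t, [/\ itv_partition 0 1 s, itv_partition 0 1 t
                             & I = upper_sum s t]].

Definition lower_integral : R :=
  sup [set I | exists s t, [/\ itv_partition 0 1 s, itv_partition 0 1 t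
                             & I = lower_sum s t]].

(* Darboux's definition. *)
Definition riemann_integrable : Prop :=
  (exists M, forall p, unit_square p -> `|f p| <= M) /\
  lower_integral = upper_integral.

End RiemannIntegrability.

Section EigenvalueDistribution.
Context {R : realType}.

(* Eigenvalues listed with their algebraic multiplicities. *)
Definition eigenvalues (m : nat) (M : 'M[R[i]]_m) : seq R[i] :=
  sval (closed_field_poly_normal (char_poly M)).

Definition spectral_mean (Phi : R[i] -> R[i]) (m : nat) (M : 'M[R[i]]_m) : R[i] :=
  m%:R^-1 * \sum_(z <- eigenvalues M) Phi z.

(* C_c(C): continuous functions whose support, as a closed set, is compact. *)
Definition continuous_compact_support (Phi : R[i] -> R[i]) : Prop :=
  continuous (Phi : R[i]^o -> R[i]^o) /\
  compact (closure [set z : R[i]^o | Phi z != 0]).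

Section OnMeasureSpace.
Context (d : measure_display) (T : measurableType d).
Variable m : {measure set T -> \bar R}.
Variable D : set T.

(* Measurability for the completion of m: the library's Lebesgue measure lives
   on the Borel sets, whereas a Riemann-integrable function need not be Borel. *)
Definition completion_measurable (g : T -> R) : Prop :=
  forall B : set R, measurable B -> completed_algebra_gen m (D `&` g @^-1` B).

Definition measurable_mx (s : nat) (kappa : T -> 'M[R[i]]_s) : Prop :=
  forall i j, completion_measurable (fun t => complex.Re (kappa t i j)) /\
              completion_measurable (fun t => complex.Im (kappa t i j)).

Definition complex_integral (g : T -> R[i]) : R[i] :=
  (\int[m]_(t in D) complex.Re (g t)) +i* (\int[m]_(t in D) complex.Im (g t)).

(* {X_n} ~_lambda (kappa, D), together with the standing assumptions under
   which the notation is meaningful. *)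
Record eig_distribution (dim : nat -> nat) (X : forall n, 'M[R[i]]_(dim n))
    (s : nat) (kappa : T -> 'M[R[i]]_s) : Prop := {
  eig_domain_measurable : measurable D;
  eig_domain_finite : (0 < m D < +oo)%E;
  eig_symbol_measurable : measurable_mx kappa;
  eig_dim : dim @ \oo --> \oo;
  eig_limit : forall Phi, continuous_compact_support Phi ->
    (fun n => spectral_mean Phi (X n) : R[i]^o) @ \oo -->
    ((fine (m D))^-1%:C * complex_integral (fun t => spectral_mean Phi (kappa t))
       : R[i]^o) }.

End OnMeasureSpace.
End EigenvalueDistribution.

Section Symbol.
Context {R : realType}.

Definition expi (t : R) : R[i] := cos t +i* sin t.

Definition h3 (t1 t2 : R) : R[i] := 6^-1 * (1 + expi t1) * (1 + expi t2).

Definition Ghat (t1 t2 : R) : 'M[R[i]]_8 :=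
  let a : R[i] := 16 / 3 in
  let b : R[i] := - (4 / 3) in
  let e1 := b * expi t1 in let e1' := b * expi (- t1) in
  let e2 := b * expi t2 in let e2' := b * expi (- t2) in
  let e12 := b * expi (t1 + t2) in let e12' := b * expi (- (t1 + t2)) in
  let h := 2 * h3 t1 t2 in let h' := 2 * (h3 t1 t2)^* in
  let rows : seq (seq R[i]) :=
    [:: [:: a   ; 0  ; b  ; e2; 0; 0 ; e1 ; e12];
        [:: 0   ; a  ; b  ; b ; 0; 0 ; e1 ; e1 ];
        [:: b   ; b  ; 4  ; 0 ; b; e2; 0  ; h  ];
        [:: e2' ; b  ; 0  ; a ; b; b ; 0  ; 0  ];
        [:: 0   ; 0  ; b  ; b ; a; 0 ; b  ; b  ];
        [:: 0   ; 0  ; e2'; b ; 0; a ; e2'; b  ];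
        [:: e1' ; e1'; 0  ; 0 ; b; e2; a  ; 0  ];
        [:: e12'; e1'; h' ; 0 ; b; b ; 0  ; 4  ]] in
  \matrix_(i, j) nth 0 (nth [::] rows i) j.

(* t = ((x, y), (theta1, theta2)) *)
Definition symbol_domain : set ((R * R) * (R * R)) :=
  unit_square `*` (`[- pi, pi]%classic `*` `[- pi, pi]%classic).

Definition symbol (mu : R * R -> R) (t : (R * R) * (R * R)) : 'M[R[i]]_8 :=
  (mu t.1)%:C *: Ghat t.2.1 t.2.2.

End Symbol.

(* Main.v *)
Require Import Defs.
From HB Require Import structures.
From mathcomp Require Import all_boot all_order all_algebra complex.
From mathcomp Require Import all_classical all_reals all_analysis.
From mathcomp Require Import measurable_realfun ring lra zify.

Set Implicit Arguments.
Unset Strict Implicit.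
Unset Printing Implicit Defensive.

Import Order.TTheory GRing.Theory Num.Theory.
Import numFieldNormedType.Exports.

Local Open Scope classical_set_scope.
Local Open Scope complex_scope.
Local Open Scope ring_scope.

(** The proof is by the method of moments.

    Trace moments.  Closing the mesh up to a torus turns the stiffness matrix into
    a compression [P B P^T] of a matrix [B] indexed by the 8 n^2 nodes of the torus
    ([stiffness_assemble]); the compression drops only O(n) nodes
    ([l1_node_incidence]).  Since [mu] is bounded and, by Lebesgue's criterion,
    continuous almost everywhere ([riemann_ae_continuous]), its values at the
    barycenter of a triangle and at the corners of the cells that own its nodes
    differ by o(1) on average.  So [B] is close to [D C], where [C] is the
    translation-invariant stiffness matrix for [mu = 1] and [D] is the diagonal of
    samples of [mu], and [D] nearly commutes with [C].  Closeness is measured in the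
    entrywise l1 norm modulo o(n^2) ([mx_approx]); it is stable under products of
    matrices with bounded row and column sums and controls normalised traces.  Hence
    tr (P B P^T)^k = tr (D^k C^k) + o(n^2).

    Bloch waves.  On the torus, plane waves block-diagonalise [C], and the blocks are
    the values of [Ghat] at equispaced frequencies ([flat_stiffness_bloch]).  The
    trace of D^k C^k therefore factors ([trace_diag_flat]) and equals, up to scaling,
    the sum of tr (symbol mu)^k over the product of the mesh and the frequency grid
    ([moment_cvg]).

    Test functions.  All spectra lie in one interval, because row sums are bounded.
    By the Weierstrass theorem ([weierstrass_approximation]) the comparison of
    moments extends to continuous test functions: the spectral mean of the stiffness
    matrix differs by o(1) from a Riemann sum of the spectral mean of the symbol
    ([spectral_gap_cvg0]).  The Riemann sums converge to the integral by dominated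
    convergence ([riemann_sum_cvg]), which also shows that the symbol is measurable,
    being off a null set a limit of step functions.  The statement for two velocity
    components follows because a block-diagonal matrix with two equal blocks has the
    same spectral means as one block. *)

(** * Entrywise l1 norm and asymptotic equivalence of matrix sequences *)

Section EntrywiseNorm.
Context {K : numDomainType}.

Definition l1 m n (X : 'M[K]_(m, n)) : K := \sum_i \sum_j `|X i j|.

Definition rowsum_le m n (M : K) (X : 'M[K]_(m, n)) : Prop :=
  forall i, \sum_j `|X i j| <= M.

Lemma l1_ge0 m n (X : 'M[K]_(m, n)) : 0 <= l1 X.
Proof. by apply: sumr_ge0 => i _; apply: sumr_ge0. Qed.

Lemma l1_tr m n (X : 'M[K]_(m, n)) : l1 X^T = l1 X.
Proof.
rewrite /l1 exchange_big; apply: eq_bigr => i _.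
by apply: eq_bigr => j _; rewrite mxE.
Qed.

Lemma l1N m n (X : 'M[K]_(m, n)) : l1 (- X) = l1 X.
Proof. by apply: eq_bigr => i _; apply: eq_bigr => j _; rewrite mxE normrN. Qed.

Lemma l1D m n (X Y : 'M[K]_(m, n)) : l1 (X + Y) <= l1 X + l1 Y.
Proof.
rewrite /l1 -big_split; apply: ler_sum => i _; rewrite -big_split.
by apply: ler_sum => j _; rewrite mxE ler_normD.
Qed.

Lemma l1_mulr m n p (M : K) (X : 'M[K]_(m, n)) (Y : 'M[K]_(n, p)) :
  rowsum_le M Y -> l1 (X *m Y) <= l1 X * M.
Proof.
move=> YM; rewrite /l1 mulr_suml; apply: ler_sum => i _.
apply: (@le_trans _ _ (\sum_j \sum_k `|X i k| * `|Y k j|)).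
  apply: ler_sum => j _; rewrite mxE (le_trans (ler_norm_sum _ _ _))//.
  by apply: ler_sum => k _; rewrite normrM.
rewrite exchange_big mulr_suml; apply: ler_sum => k _.
by rewrite -mulr_sumr ler_wpM2l.
Qed.

Lemma l1_mull m n p (M : K) (X : 'M[K]_(m, n)) (Y : 'M[K]_(n, p)) :
  rowsum_le M X^T -> l1 (X *m Y) <= l1 Y * M.
Proof. by move=> XM; rewrite -l1_tr trmx_mul -(l1_tr Y); apply: l1_mulr. Qed.

Lemma rowsum_le_mul m n p (M N : K) (X : 'M[K]_(m, n)) (Y : 'M[K]_(n, p)) :
  0 <= N -> rowsum_le M X -> rowsum_le N Y -> rowsum_le (M * N) (X *m Y).
Proof.
move=> N0 XM YN i.
apply: (@le_trans _ _ (\sum_j \sum_k `|X i k| * `|Y k j|)).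
  apply: ler_sum => j _; rewrite mxE (le_trans (ler_norm_sum _ _ _))//.
  by apply: ler_sum => k _; rewrite normrM.
rewrite exchange_big (@le_trans _ _ (\sum_k `|X i k| * N))//.
  by apply: ler_sum => k _; rewrite -mulr_sumr ler_wpM2l.
by rewrite -mulr_suml ler_wpM2r.
Qed.

Lemma norm_mxtrace n (X : 'M[K]_n) : `|\tr X| <= l1 X.
Proof.
rewrite (le_trans (ler_norm_sum _ _ _))//; apply: ler_sum => i _.
by rewrite (bigD1 i)//= lerDl sumr_ge0.
Qed.

End EntrywiseNorm.

Lemma cvg0_le {R : realType} (f u : R^nat) : (forall n, `|f n| <= u n) ->
  u @ \oo --> (0 : R) -> f @ \oo --> (0 : R).
Proof.
move=> fu u0; apply/norm_cvg0P.
apply: (@squeeze_cvgr _ \oo _ _ (fun=> 0) u) => //; last exact: cvg_cst.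
by near=> n; rewrite normr_ge0/= fu.
Unshelve. all: by end_near. Qed.

Lemma cvg0D {R : realType} (f g : R^nat) : f @ \oo --> (0 : R) ->
  g @ \oo --> (0 : R) -> (fun n => f n + g n) @ \oo --> (0 : R).
Proof. by move=> f0 g0; rewrite -(addr0 0); exact: (cvgD f0 g0). Qed.

Lemma cvg0Mr {R : realType} (f : R^nat) (c : R) : f @ \oo --> (0 : R) ->
  (fun n => f n * c) @ \oo --> (0 : R).
Proof. by move=> f0; rewrite -(mul0r c); exact: (cvgMr_tmp f0). Qed.

Lemma mxexp0 (K : nzRingType) n (X : 'M[K]_n) : X ^+ 0 = 1%:M.
Proof. by rewrite expr0. Qed.

Lemma mxexpS (K : nzRingType) n (X : 'M[K]_n) k : X ^+ k.+1 = X *m X ^+ k.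
Proof. by rewrite exprS. Qed.

Lemma mxexpSr (K : nzRingType) n (X : 'M[K]_n) k : X ^+ k.+1 = X ^+ k *m X.
Proof. by rewrite exprSr. Qed.

Section Asymptotics.
Context {R : realType} {N : nat -> nat}.
Implicit Types X Y Z : forall n, 'M[R]_(N n).

Definition mx_bounded X : Prop :=
  exists2 M, 0 <= M & forall n, rowsum_le M (X n) /\ rowsum_le M (X n)^T.

(** The number of unknowns grows like [n ^ 2], so a perturbation that is o(n^2) in
    the entrywise l1 norm does not change the limits of normalised traces.  This norm
    is additive over assembled elements, and only row and column sums of the other
    factor are needed to bound it on products. *)
Definition mx_approx X Y : Prop :=
  (fun n => n%:R ^- 2 * l1 (X n - Y n)) @ \oo --> (0 : R).

Lemma mx_approx_le (u : R^nat) X Y : u @ \oo --> (0 : R) ->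
  (forall n, n%:R ^- 2 * l1 (X n - Y n) <= u n) -> mx_approx X Y.
Proof.
move=> u0 Xu; apply: cvg0_le u0 => n.
by rewrite ger0_norm// mulr_ge0 ?l1_ge0// invr_ge0 exprn_ge0.
Qed.

Lemma mx_approx_eq X Y X' Y' : (forall n, X n = X' n) ->
  (forall n, Y n = Y' n) -> mx_approx X Y -> mx_approx X' Y'.
Proof. by move=> eX eY XY; apply: (mx_approx_le XY) => n; rewrite eX eY. Qed.

Lemma mx_approx_refl X : mx_approx X X.
Proof.
apply: (@mx_approx_le (fun=> 0)) => [|n]; first exact: cvg_cst.
by rewrite subrr /l1 !big1 ?mulr0// => i _; rewrite big1// => j _; rewrite mxE normr0.
Qed.

Lemma mx_approx_sym X Y : mx_approx X Y -> mx_approx Y X.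
Proof.
by move=> XY; apply: (mx_approx_le XY) => n; rewrite -(opprB (X n)) l1N.
Qed.

Lemma mx_approx_trans Y X Z : mx_approx X Y -> mx_approx Y Z -> mx_approx X Z.
Proof.
move=> XY YZ; apply: (mx_approx_le (cvg0D XY YZ)) => n /=.
have -> : X n - Z n = (X n - Y n) + (Y n - Z n) by rewrite addrA subrK.
by rewrite -mulrDr ler_wpM2l ?invr_ge0 ?exprn_ge0// l1D.
Qed.

Lemma mx_bounded_mul X Y : mx_bounded X -> mx_bounded Y ->
  mx_bounded (fun n => X n *m Y n).
Proof.
move=> [M M0 XM] [M' M'0 YM]; exists (M * M'); first exact: mulr_ge0.
move=> n; have [XM1 XM2] := XM n; have [YM1 YM2] := YM n; split.
  exact: rowsum_le_mul.
by rewrite trmx_mul mulrC; apply: rowsum_le_mul.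
Qed.

Lemma mx_bounded_exp X k : mx_bounded X -> mx_bounded (fun n => X n ^+ k).
Proof.
move=> bX; elim: k => [|k IHk].
  exists 1 => // n; rewrite mxexp0 trmx1.
  suff H : rowsum_le 1 (1%:M : 'M[R]_(N n)) by [].
  move=> i; rewrite (bigD1 i)//= big1 ?addr0 ?mxE ?eqxx ?normr1// => j ji.
  by rewrite mxE eq_sym (negbTE ji) normr0.
have [M M0 H] := mx_bounded_mul bX IHk.
by exists M => // n; rewrite mxexpS; apply: H.
Qed.

Lemma mx_approx_mul X X' Y Y' : mx_bounded X' -> mx_bounded Y ->
  mx_approx X X' -> mx_approx Y Y' ->
  mx_approx (fun n => X n *m Y n) (fun n => X' n *m Y' n).
Proof.
move=> [M M0 XM] [M' M'0 YM] XX' YY'.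
apply: (mx_approx_le (cvg0D (cvg0Mr M' XX') (cvg0Mr M YY'))) => n /=.
have -> : X n *m Y n - X' n *m Y' n =
    (X n - X' n) *m Y n + X' n *m (Y n - Y' n).
  by rewrite mulmxBl mulmxBr addrA subrK.
rewrite -!mulrA -mulrDr ler_wpM2l ?invr_ge0 ?exprn_ge0//.
rewrite (le_trans (l1D _ _))// lerD//; first by apply: l1_mulr; case: (YM n).
by apply: l1_mull; case: (XM n).
Qed.

Lemma mx_approx_exp X Y k : mx_bounded X -> mx_bounded Y ->
  mx_approx X Y -> mx_approx (fun n => X n ^+ k) (fun n => Y n ^+ k).
Proof.
move=> bX bY XY; elim: k => [|k IHk].
  by apply: mx_approx_eq (mx_approx_refl (fun n => 1%:M)) => n; rewrite mxexp0.
by apply: mx_approx_eq (mx_approx_mul bY (mx_bounded_exp k bX) XY IHk) => n;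
  rewrite mxexpS.
Qed.

(** When the factors commute asymptotically, the powers of a product separate:
    each exchange of two neighbouring factors costs o(n^2) in the l1 norm. *)
Lemma mx_approx_exp_mul X Y k : mx_bounded X -> mx_bounded Y ->
  mx_approx (fun n => X n *m Y n) (fun n => Y n *m X n) ->
  mx_approx (fun n => (X n *m Y n) ^+ k) (fun n => X n ^+ k *m Y n ^+ k).
Proof.
move=> bX bY XY.
have comm m : mx_approx (fun n => Y n *m X n ^+ m) (fun n => X n ^+ m *m Y n).
  elim: m => [|m IHm].
    by apply: mx_approx_eq (mx_approx_refl Y) => n; rewrite mxexp0 ?mul1mx ?mulmx1.
  have bXm := mx_bounded_exp m bX.
  apply: (@mx_approx_trans (fun n => X n *m (Y n *m X n ^+ m))).
    apply: mx_approx_eq (mx_approx_mul (mx_bounded_mul bX bY) bXm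
      (mx_approx_sym XY) (mx_approx_refl (fun n => X n ^+ m))) => n;
    by rewrite ?mxexpS !mulmxA.
  apply: mx_approx_eq (mx_approx_mul bX (mx_bounded_mul bY bXm)
    (mx_approx_refl X) IHm) => n //.
  by rewrite mxexpS !mulmxA.
have bXY := mx_bounded_mul bX bY.
elim: k => [|k IHk].
  by apply: mx_approx_eq (mx_approx_refl (fun n => 1%:M)) => n;
    rewrite !mxexp0 ?mulmx1.
have bXk := mx_bounded_exp k bX; have bYk := mx_bounded_exp k bY.
apply: (@mx_approx_trans (fun n => (X n *m Y n) *m (X n ^+ k *m Y n ^+ k))).
  apply: mx_approx_eq (mx_approx_mul bXY (mx_bounded_exp k bXY)
    (mx_approx_refl _) IHk) => n //.
  by rewrite mxexpS.
have := mx_approx_mul (mx_bounded_mul bXk bY) bYk (comm k)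
                      (mx_approx_refl (fun n => Y n ^+ k)).
move/(mx_approx_mul bX (mx_bounded_mul (mx_bounded_mul bY bXk) bYk)
                    (mx_approx_refl X)).
by apply: mx_approx_eq => n; rewrite ?mxexpS !mulmxA.
Qed.

Lemma mx_approx_trace X Y : mx_approx X Y ->
  (fun n => n%:R ^- 2 * (\tr (X n) - \tr (Y n))) @ \oo --> (0 : R).
Proof.
move=> XY; apply: (cvg0_le _ XY) => n; rewrite normrM ger0_norm ?invr_ge0 ?exprn_ge0//.
by rewrite ler_wpM2l ?invr_ge0 ?exprn_ge0// -raddfB norm_mxtrace.
Qed.

End Asymptotics.

(** * Polynomial approximation on a compact interval *)

Section Bernstein.
Context {R : realType}.
Implicit Types (phi psi : nat -> R) (t : R).

(** The Bernstein polynomial of the values [phi 0 .. phi m], defined by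
    conditioning on the first of [m] coin tosses: at [t] it is the mean of [phi]
    under the binomial law of parameter [t].  The recursive form turns every
    moment computation below into a one-line induction. *)
Fixpoint bernstein (m : nat) phi : {poly R} :=
  if m is k.+1 then
    'X * bernstein k (phi \o S) + (1 - 'X) * bernstein k phi
  else (phi 0%N)%:P.

Lemma bernsteinS m phi t : (bernstein m.+1 phi).[t] =
  t * (bernstein m (phi \o S)).[t] + (1 - t) * (bernstein m phi).[t].
Proof. by rewrite /= !hornerE. Qed.

Lemma bernstein_affine m phi psi a b t :
  (bernstein m (fun k => a * phi k + b * psi k)).[t] =
  a * (bernstein m phi).[t] + b * (bernstein m psi).[t].
Proof.
elim: m phi psi => [|m IHm] phi psi; first by rewrite /= !hornerC.
rewrite !bernsteinS IHm (IHm (phi \o S) (psi \o S)); ring.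
Qed.

Lemma bernstein_cst m c t : (bernstein m (fun=> c)).[t] = c.
Proof.
elim: m => [|m IHm]; first by rewrite /= hornerC.
by rewrite bernsteinS [_ \o _](_ : _ = fun=> c)// IHm; ring.
Qed.

Lemma bernstein_sqr_dev m c t :
  (bernstein m (fun k => (k%:R - c) ^+ 2)).[t] =
  m%:R * t * (1 - t) + (m%:R * t - c) ^+ 2.
Proof.
elim: m c => [|m IHm] c; first by rewrite /= hornerC; ring.
rewrite bernsteinS IHm.
rewrite [_ \o _](_ : _ = fun k => (k%:R - (c - 1)) ^+ 2); last first.
  by apply/funext => k /=; rewrite -(natr1 k); ring.
by rewrite IHm -(natr1 m); ring.
Qed.

Lemma bernstein_le m phi psi t : 0 <= t <= 1 ->
  (forall k, (k <= m)%N -> phi k <= psi k) ->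
  (bernstein m phi).[t] <= (bernstein m psi).[t].
Proof.
move=> /andP[t0 t1].
elim: m phi psi => [|m IHm] phi psi le_phi; first by rewrite /= !hornerC le_phi.
rewrite !bernsteinS lerD// ler_wpM2l ?subr_ge0//; apply: IHm => k km.
  exact: le_phi.
by apply: le_phi; exact: leqW.
Qed.

End Bernstein.

Lemma segment_unif_continuous {R : realType} (f : R -> R) (a b e : R) :
  continuous f -> 0 < e ->
  exists2 d : R, 0 < d & forall x y, a <= x <= b -> `|x - y| < d -> `|f x - f y| < e.
Proof.
move=> cf e0.
have /compact_near_coveringP/(_ R 0^'+) := @segment_compact _ a b.
move=> /(_ (fun d x => forall y, `|x - y| < d -> `|f x - f y| < e)) [].
  move=> x _; have /cvgrPdist_lt/(_ (e / 2)) := cf x.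
  rewrite divr_gt0// => /(_ isT)/nbhs_ballP[d /= d0 fd].
  near=> x' i => y x'y.
  have xx' : `|x - x'| < d / 2 by near: x'; apply: cvgr_dist_lt; rewrite ?divr_gt0.
  have id2 : i < d / 2 by near: i; apply: nbhs_right_lt; rewrite divr_gt0.
  have xy : `|x - y| < d.
    rewrite (splitr d) -(subrKA x') (le_lt_trans (ler_normD _ _))// ltrD//.
    exact: lt_trans x'y id2.
  have fx' : `|f x - f x'| < e / 2.
    by apply: fd; rewrite /ball/= (lt_trans xx')// [ltRHS]splitr ltrDl divr_gt0.
  have fy : `|f x - f y| < e / 2 by exact: fd.
  rewrite (splitr e) -(subrKA (f x)) (le_lt_trans (ler_normD _ _))// ltrD//.
  by rewrite distrC.
move=> d /= d0 dP; exists (d / 2); first by rewrite divr_gt0.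
move=> x y xab; apply: (dP (d / 2)); rewrite ?divr_gt0//=.
by rewrite sub0r normrN gtr0_norm ?divr_gt0// [ltRHS]splitr ltrDl divr_gt0.
Unshelve. all: by end_near. Qed.

(** Bernstein's proof of the Weierstrass theorem: under the binomial law the
    mass at distance at least [d] from the mean is at most
    [m%:R^-1 * d ^- 2] by the second moment, and within distance [d] the
    function varies little. *)
Theorem weierstrass_approximation {R : realType} (f : R -> R) (B e : R) :
  0 < B -> continuous f -> 0 < e ->
  exists p : {poly R}, forall x, `|x| <= B -> `|f x - p.[x]| <= e.
Proof.
move=> B0 cf e0.
have B2 : 0 < B *+ 2 by rewrite mulrn_wgt0.
pose h t := B *+ 2 * t - B.
have [d d0 fd] := @segment_unif_continuous _ f (- B) B (e / 2) cf
                    (divr_gt0 e0 (ltr0n _ 2)).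
have cnf : continuous (fun x => `|f x|).
  by move=> x; apply: continuous_comp; [exact: cf|exact: norm_continuous].
have [c _ fM] := @EVT_max _ (fun x => `|f x|) (- B) B
  (ge0_cp (ltW B0)).2 (continuous_subspaceT cnf).
set M := `|f c| in fM.
have M0 : 0 <= M by rewrite normr_ge0.
pose K := 2 * M * (B *+ 2) ^+ 2 / d ^+ 2.
have K0 : 0 <= K by rewrite /K divr_ge0 ?exprn_ge0 ?(ltW d0)// !mulr_ge0// ?exprn_ge0// ltW.
have [m mK] : exists m : nat, K / m.+1%:R < e / 2.
  exists (Num.truncn (K / (e / 2))).
  rewrite ltr_pdivrMr// mulrC -ltr_pdivrMr ?divr_gt0//.
  exact: truncnS_gt.
have m0 : (0 : R) < m.+1%:R by rewrite ltr0n.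
pose q := bernstein m.+1 (fun k => f (h (k%:R / m.+1%:R))).
have qP t : 0 <= t <= 1 -> `|f (h t) - q.[t]| <= e.
  move=> t01.
  pose phi k : R := f (h (k%:R / m.+1%:R)).
  pose dev k : R := 1 * (e / 2) + K / m.+1%:R ^+ 2 * (k%:R - m.+1%:R * t) ^+ 2.
  have hB s : 0 <= s <= 1 -> - B <= h s <= B.
    move=> /andP[s0 s1]; rewrite /h; nra.
  have phi_dev k : (k <= m.+1)%N -> `|f (h t) - phi k| <= dev k.
    move=> km; set s : R := k%:R / m.+1%:R.
    have s01 : 0 <= s <= 1.
      by rewrite divr_ge0//= ler_pdivrMr// mul1r ler_nat.
    have devE : dev k = e / 2 + K * (s - t) ^+ 2.
      by rewrite /dev mul1r /s; congr (_ + _); field; rewrite gt_eqF.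
    rewrite devE.
    have [hst|hst] := ltP `|h t - h s| d.
      rewrite (le_trans (ltW (fd _ _ _ hst)))//; first exact: hB.
      by rewrite lerDl mulr_ge0// sqr_ge0.
    rewrite (@le_trans _ _ (2 * M))//.
      rewrite (le_trans (ler_normB _ _))// mulr_natl mulr2n lerD// fM// in_itv/=.
        exact: hB.
      exact: hB.
    rewrite ler_wpDl ?divr_ge0 ?(ltW e0)//.
    have -> : K * (s - t) ^+ 2 = 2 * M * ((h t - h s) ^+ 2 / d ^+ 2).
      by rewrite /K /h; field; rewrite gt_eqF.
    rewrite ler_peMr ?mulr_ge0// ler_pdivlMr ?exprn_gt0// mul1r.
    by rewrite -[leRHS]real_normK ?num_real// lerXn2r ?nnegrE ?(ltW d0).
  rewrite ler_norml -{1}(bernstein_cst m.+1 (f (h t)) t) -/phi.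
  rewrite -{2}(bernstein_cst m.+1 (f (h t)) t).
  have qE : q.[t] = (bernstein m.+1 phi).[t] by [].
  have dev_e : (bernstein m.+1 dev).[t] <= e.
    rewrite /dev bernstein_affine bernstein_cst bernstein_sqr_dev subrr expr0n/= addr0 mul1r.
    rewrite [leRHS]splitr lerD2l (le_trans _ (ltW mK))//.
    have -> : K / m.+1%:R ^+ 2 * (m.+1%:R * t * (1 - t)) =
        K / m.+1%:R * (t * (1 - t)).
      by move: m0; generalize (m.+1%:R : R) => r r0; field; rewrite gt_eqF.
    rewrite ler_piMr ?divr_ge0// ?(ltW m0)//; case/andP: t01 => t0 t1; nra.
  have := bernstein_le t01 (fun k km => (ler_normlP _ _ (phi_dev k km)).2).
  have := bernstein_le t01 (fun k km => (ler_normlP _ _ (phi_dev k km)).1).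
  have E1 := bernstein_affine m.+1 (fun=> f (h t)) phi 1 (-1) t.
  have E2 := bernstein_affine m.+1 (fun=> f (h t)) phi (-1) 1 t.
  have -> : (fun k => - (f (h t) - phi k)) = (fun k => -1 * f (h t) + 1 * phi k).
    by apply/funext => k; ring.
  have -> : (fun k => f (h t) - phi k) = (fun k => 1 * f (h t) + -1 * phi k).
    by apply/funext => k; ring.
  rewrite E1 E2 qE; lra.
move: q qP => q qP.
exists (q \Po ((B *+ 2)^-1 *: ('X + B%:P))) => x xB.
rewrite horner_comp hornerZ hornerD hornerX hornerC.
set t := _ * (x + B).
have xE : x = h t by rewrite /h /t mulrA divff ?gt_eqF// mul1r addrK.
rewrite {1}xE; apply: qP.
move: xB; rewrite ler_norml => /andP[x1 x2]; rewrite /t.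
rewrite mulr_ge0 ?invr_ge0 ?(ltW B2)//=; last by lra.
by rewrite mulrC ler_pdivrMr// mul1r; lra.
Qed.

(** * Eigenvalues of Hermitian matrices *)

Section Eigenvalues.
Context {R : realType}.

Lemma char_poly_eigenvalues m (M : 'M[R[i]]_m) :
  char_poly M = \prod_(z <- eigenvalues M) ('X - z%:P).
Proof.
rewrite /eigenvalues; case: closed_field_poly_normal => s /= {1}->.
by rewrite (monicP (char_poly_monic M)) scale1r.
Qed.

Lemma char_poly_unit_conj n (P A : 'M[R[i]]_n) : P \in unitmx ->
  char_poly (invmx P *m A *m P) = char_poly A.
Proof.
move=> Pu; rewrite /char_poly.
have -> : char_poly_mx (invmx P *m A *m P) =
    map_mx polyC (invmx P) *m char_poly_mx A *m map_mx polyC P.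
  rewrite /char_poly_mx mulmxBr mulmxBl !map_mxM/=; congr (_ - _).
  by rewrite scalar_mxC -mulmxA -map_mxM mulVmx// map_mx1 mulmx1.
rewrite !det_mulmx mulrAC -det_mulmx -map_mxM mulVmx//.
by rewrite map_mx1 det1 mul1r.
Qed.

(** For a left eigenvector [v], [`|z| * l1 v = l1 (v *m M)], and the row sums of [M]
    bound the right-hand side by [l1 v * B]. *)
Lemma eigenvalue_le_rowsum n (M : 'M[R[i]]_n) B z :
  rowsum_le B M -> z \in eigenvalues M -> `|z| <= B.
Proof.
move=> MB zM.
have /eigenvalueP[v vM v0] : eigenvalue M z.
  by rewrite eigenvalue_root_char char_poly_eigenvalues root_prod_XsubC.
have v_gt0 : 0 < l1 v.
  rewrite lt_neqAle l1_ge0 andbT eq_sym; apply: contra v0 => /eqP lv.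
  apply/eqP/rowP => j; rewrite mxE; apply/eqP; rewrite -normr_le0 -lv.
  by rewrite /l1 big_ord1 (bigD1 j)//= lerDl sumr_ge0.
have := l1_mulr v MB; rewrite vM.
have -> : l1 (z *: v) = `|z| * l1 v.
  rewrite /l1 mulr_sumr; apply: eq_bigr => i _; rewrite mulr_sumr.
  by apply: eq_bigr => j _; rewrite mxE normrM.
by rewrite mulrC ler_pM2l.
Qed.

Definition conj_symmetric n (M : 'M[R[i]]_n) := forall i j, M i j = (M j i)^*.

(** The eigenvalues of a Hermitian matrix are real, and their power sums are the
    traces of its powers: this is how moments of the spectrum are read off the
    entries. *)
Lemma hermitian_eigenvalues n (M : 'M[R[i]]_n) : conj_symmetric M ->
  exists2 d : 'I_n -> R,
    perm_eq (eigenvalues M) [seq (d i)%:C | i <- enum 'I_n] &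
    forall k, \tr (M ^+ k) = (\sum_i d i ^+ k)%:C.
Proof.
move=> Msym.
have Mh : M \is hermsymmx.
  apply/is_hermitianmxP; rewrite expr0 scale1r; apply/matrixP => i j.
  by rewrite !mxE Msym.
have ME := orthomx_spectralP (hermitian_normalmx Mh).
set P := spectralmx M in ME; set sp := spectral_diag M in ME.
have Pu : P \in unitmx := spectral_unit M.
have sp_real i : sp 0 i \is Num.real.
  by have /mxOverP := hermitian_spectral_diag_real Mh; exact.
exists (fun i => complex.Re (sp 0 i)).
  apply: prod_XsubC_eq; rewrite -char_poly_eigenvalues ME char_poly_unit_conj//.
  rewrite char_poly_trig ?diag_mx_is_trig// big_map [RHS]big_enum/=.
  by apply: eq_bigr => i _; rewrite mxE eqxx mulr1n RRe_real.
move=> k.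
have -> : M ^+ k = invmx P *m diag_mx (\row_i sp 0 i ^+ k) *m P.
  elim: k => [|k IHk].
    rewrite mxexp0; have -> : diag_mx (\row_i sp 0 i ^+ 0) = 1%:M.
      by rewrite -diag_const_mx; congr diag_mx; apply/rowP => i; rewrite !mxE expr0.
    by rewrite mulmx1 mulVmx.
  rewrite mxexpS IHk {1}ME -!mulmxA; congr (_ *m _).
  rewrite (mulmxA P) mulmxV// mul1mx mulmxA mulmx_diag; congr (diag_mx _ *m _).
  by apply/rowP => i; rewrite !mxE exprS.
rewrite mxtrace_mulC mulmxA mulmxV// mul1mx mxtrace_diag rmorph_sum.
by apply: eq_bigr => i _; rewrite mxE rmorphXn/= RRe_real.
Qed.

Lemma eigenvalues_block_diag n (M : 'M[R[i]]_n) :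
  perm_eq (eigenvalues (block_mx M 0 0 M)) (eigenvalues M ++ eigenvalues M).
Proof.
apply: prod_XsubC_eq; rewrite -char_poly_eigenvalues big_cat/=.
rewrite -!char_poly_eigenvalues /char_poly char_block_diag_mx.
by rewrite det_ublock.
Qed.

Lemma spectral_mean_block_diag Phi n (M : 'M[R[i]]_n) :
  spectral_mean Phi (block_mx M 0 0 M) = spectral_mean Phi M.
Proof.
rewrite /spectral_mean (perm_big _ (eigenvalues_block_diag M))/= big_cat/=.
rewrite -mulr2n addnn -mul2n natrM invfM -[X in _ * X]mulr_natl.
by rewrite mulrACA mulVf ?pnatr_eq0// mul1r.
Qed.

End Eigenvalues.

(** * Integrals of quadratic polynomials over the triangles of a cell *)

(** The stiffness matrix of the quadratic Lagrange element on a right isosceles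
    triangle, for the nodes listed by [tri_nodes] with the right angle first.
    The Dirichlet integral is invariant under similarities of the plane, so one
    matrix serves all triangles. *)
Definition elem_stiffness (R : fieldType) (a b : nat) : R :=
  let h := 1 / 2 in let x := 1 / 6 in let k := - (2 / 3) in
  let d := 8 / 3 in let l := - (4 / 3) in
  nth 0 (nth [::]
    [:: [:: 1; x; x; k; 0; k];
        [:: x; h; 0; k; 0; 0];
        [:: x; 0; h; 0; 0; k];
        [:: k; k; 0; d; l; 0];
        [:: 0; 0; 0; l; d; l];
        [:: k; 0; k; 0; l; d]] a) b.

Section PlanarIntegral.
Context {R : realType}.
Implicit Types (g : R * R -> R) (T : set (R * R)).

Lemma integral_cubic (c0 c1 c2 c3 m a b : R) : a <= b ->
  (\int[lebesgue_measure]_(x in `]a, b[)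
     (c0 + c1 * (x - m) + c2 * (x - m) ^+ 2 + c3 * (x - m) ^+ 3)%:E)%E =
  (c0 * (b - a) + c1 / 2 * ((b - m) ^+ 2 - (a - m) ^+ 2)
   + c2 / 3 * ((b - m) ^+ 3 - (a - m) ^+ 3)
   + c3 / 4 * ((b - m) ^+ 4 - (a - m) ^+ 4))%:E.
Proof.
pose Z : {poly R} := 'X - m%:P.
pose P := c0 *: Z + (c1 / 2) *: Z ^+ 2 + (c2 / 3) *: Z ^+ 3 + (c3 / 4) *: Z ^+ 4.
have ZE x : Z.[x] = x - m by rewrite hornerXsubC.
have dZ : Z^`() = 1 by rewrite derivXsubC.
have PE x : P^`().[x] =
    c0 + c1 * (x - m) + c2 * (x - m) ^+ 2 + c3 * (x - m) ^+ 3.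
  rewrite /P !derivD !derivZ !deriv_exp dZ !hornerD !hornerZ !hornerMn.
  by rewrite !hornerM !horner_exp ZE hornerC; field.
move=> ab; under eq_integral do rewrite -PE.
have cQ x : {for x, continuous (horner P^`())}.
  by apply: differentiable_continuous; apply/derivable1_diffP; exact: derivable_horner.
have cP x : {for x, continuous (horner P)}.
  by apply: differentiable_continuous; apply/derivable1_diffP; exact: derivable_horner.
move: ab; rewrite le_eqVlt => /predU1P[->|ab].
  by rewrite set_itv_ge ?bnd_simp ?ltxx// integral_set0 !subrr !mulr0 !addr0.
rewrite -(integral_itv_bndoo true false); last first.
  apply/measurable_EFinP; apply: measurable_funTS.
  by apply: continuous_measurable_fun => x; exact: cQ.
rewrite (@continuous_FTC2 _ _ (horner P))//.
- by rewrite -EFinB; congr EFin; rewrite /P !hornerD !hornerZ !horner_exp !ZE; field.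
- by apply: continuous_subspaceT => x; exact: cQ.
- split.
  + by move=> x _; exact: derivable_horner.
  + by apply: cvg_at_right_filter; exact: cP.
  + by apply: cvg_at_left_filter; exact: cP.
- by move=> x _; rewrite -derivE.
Qed.

(** Fubini for the region between two graphs over ]a, b[. *)
Lemma integral_between_graphs g T (a b : R) (lo up h : R -> R) :
  (forall p, T p <-> a < p.1 < b /\ lo p.1 < p.2 < up p.1) ->
  measurable (T : set (measurableTypeR R * measurableTypeR R)%type) ->
  leb2.-integrable T (EFin \o g) ->
  (forall x, a < x < b ->
    (\int[lebesgue_measure]_(y in `]lo x, up x[) (g (x, y))%:E)%E = (h x)%:E) ->
  (\int[leb2]_(p in T) (g p)%:E = \int[lebesgue_measure]_(x in `]a, b[) (h x)%:E)%E.
Proof.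
move=> TE mT ig gQ; rewrite [LHS]integral_mkcond.
have /integral12_prod_meas1 <- := (integrable_mkcond _ mT).1 ig.
rewrite [RHS]integral_mkcond; apply: eq_integral => x _.
rewrite /fubini_F [RHS]patchE mem_setE in_itv/=; case: ifPn => xab.
  rewrite -gQ// [RHS]integral_mkcond; apply: eq_integral => y _.
  rewrite !patchE; congr (if _ then _ else _).
  apply/idP/idP; rewrite !inE/= in_itv/=; first by move/TE => [].
  by move=> y_lo_up; apply/TE.
rewrite integral0_eq// => y _; rewrite patchE memNset// => /TE[/= xab' _].
by rewrite xab' in xab.
Qed.

Lemma integral_between_graphs_swap g T (a b : R) (lo up h : R -> R) :
  (forall p, T p <-> a < p.2 < b /\ lo p.2 < p.1 < up p.2) ->
  measurable (T : set (measurableTypeR R * measurableTypeR R)%type) ->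
  leb2.-integrable T (EFin \o g) ->
  (forall y, a < y < b ->
    (\int[lebesgue_measure]_(x in `]lo y, up y[) (g (x, y))%:E)%E = (h y)%:E) ->
  (\int[leb2]_(p in T) (g p)%:E = \int[lebesgue_measure]_(x in `]a, b[) (h x)%:E)%E.
Proof.
move=> TE mT ig gQ; rewrite [LHS]integral_mkcond.
have /integral21_prod_meas1 <- := (integrable_mkcond _ mT).1 ig.
rewrite [RHS]integral_mkcond; apply: eq_integral => y _.
rewrite /fubini_G [RHS]patchE mem_setE in_itv/=; case: ifPn => yab.
  rewrite -gQ// [RHS]integral_mkcond; apply: eq_integral => x _.
  rewrite !patchE; congr (if _ then _ else _).
  apply/idP/idP; rewrite !inE/= in_itv/=; first by move/TE => [].
  by move=> x_lo_up; apply/TE.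
rewrite integral0_eq// => x _; rewrite patchE memNset// => /TE[/= yab' _].
by rewrite yab' in yab.
Qed.

End PlanarIntegral.

Lemma measurable_ltr_set d (T : measurableType d) (R : realType)
  (f g : T -> R) : measurable_fun setT f -> measurable_fun setT g ->
  measurable [set p | f p < g p].
Proof.
move=> mf mg.
have mtrue : measurable [set true] by [].
by have := measurable_fun_ltr mf mg measurableT mtrue; rewrite setTI.
Qed.

Lemma leb2_setX (R : realType) (i j : interval R) :
  leb2 ([set` i] `*` [set` j]) =
  (lebesgue_measure ([set` i] : set R) * lebesgue_measure ([set` j] : set R))%E.
Proof. by rewrite /leb2 product_measure1E//; exact: measurable_itv. Qed.

Lemma N1_neq1 (R : numDomainType) : (-1 == 1 :> R) = false.
Proof. by apply/negbTE; rewrite lt_eqF// (lt_trans (ltrN10 R))// ltr01. Qed.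

Section ReferenceFrame.
Context {R : realType}.
Variables (xm ym eta c s : R).
Hypothesis eta_gt0 : 0 < eta.

(** The four triangles of a cell are the images of one triangle under the
    rotations by multiples of a right angle about the centre of the cell; [(c, s)]
    is the direction from the centre to the edge of the cell that the triangle
    contains. *)
Hypothesis axis : (c, s) \in [:: (0, -1); (1, 0); (0, 1); (-1, 0)].

Definition frame_tri : tri R :=
  ((xm, ym), (xm + eta * (c + s), ym + eta * (s - c)),
   (xm + eta * (c - s), ym + eta * (s + c))).

(** Coordinates along the axis of the triangle and across it, in which the triangle
    is [- rho < sigma < rho < 1]. *)
Definition frame_rho (p : R * R) : R := (c * (p.1 - xm) + s * (p.2 - ym)) / eta.
Definition frame_sigma (p : R * R) : R := (c * (p.2 - ym) - s * (p.1 - xm)) / eta.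

Let cs1 : c ^+ 2 + s ^+ 2 = 1.
Proof.
by move: axis; rewrite !inE => /or4P[] /eqP[-> ->];
  rewrite ?sqrrN ?expr0n ?expr1n/= ?addr0 ?add0r.
Qed.

Let eta_neq0 : eta != 0. Proof. by rewrite gt_eqF. Qed.

Lemma frame_x (p : R * R) :
  p.1 = xm + eta * (c * frame_rho p - s * frame_sigma p).
Proof.
rewrite /frame_rho /frame_sigma.
transitivity (xm + (c ^+ 2 + s ^+ 2) * (p.1 - xm)); first by rewrite cs1; ring.
by field.
Qed.

Lemma frame_y (p : R * R) :
  p.2 = ym + eta * (s * frame_rho p + c * frame_sigma p).
Proof.
rewrite /frame_rho /frame_sigma.
transitivity (ym + (c ^+ 2 + s ^+ 2) * (p.2 - ym)); first by rewrite cs1; ring.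
by field.
Qed.

Lemma frame_barypoint u v w : u + v + w = 1 ->
  frame_rho (barypoint frame_tri u v w) = v + w /\
  frame_sigma (barypoint frame_tri u v w) = w - v.
Proof.
move=> uvw; have -> : u = 1 - v - w by lra.
rewrite /frame_rho /frame_sigma /=; split.
- by transitivity ((c ^+ 2 + s ^+ 2) * (v + w)); [field|rewrite cs1 mul1r].
- by transitivity ((c ^+ 2 + s ^+ 2) * (w - v)); [field|rewrite cs1 mul1r].
Qed.

Lemma frame_open_tri p : open_tri frame_tri p <->
  frame_rho p < 1 /\ - frame_rho p < frame_sigma p < frame_rho p.
Proof.
split=> [[u [v [w [u0 v0 w0 uvw ->]]]]|[r1 /andP[r2 r3]]].
  have [-> ->] := frame_barypoint uvw; split; first lra.
  by apply/andP; split; lra.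
exists (1 - frame_rho p), ((frame_rho p - frame_sigma p) / 2),
  ((frame_rho p + frame_sigma p) / 2); split; [lra..|].
rewrite [LHS]surjective_pairing {1}frame_x {1}frame_y /=.
by congr (_, _); field.
Qed.

Lemma open_tri_frame_tri p : open_tri frame_tri p <->
  c * (p.1 - xm) + s * (p.2 - ym) < eta /\
  - (c * (p.1 - xm) + s * (p.2 - ym)) < c * (p.2 - ym) - s * (p.1 - xm)
    < c * (p.1 - xm) + s * (p.2 - ym).
Proof.
rewrite frame_open_tri /frame_rho /frame_sigma ltr_pdivrMr// mul1r -mulNr.
by rewrite !ltr_pM2r ?invr_gt0.
Qed.

Let measurable_pX : measurable_fun setT
  (fun p : measurableTypeR R * measurableTypeR R => p.1 - xm).
Proof. by apply: measurable_funB => //; exact: measurable_fst. Qed.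

Let measurable_pY : measurable_fun setT
  (fun p : measurableTypeR R * measurableTypeR R => p.2 - ym).
Proof. by apply: measurable_funB => //; exact: measurable_snd. Qed.

Let measurable_A : measurable_fun setT
  (fun p : measurableTypeR R * measurableTypeR R => c * (p.1 - xm) + s * (p.2 - ym)).
Proof. by apply: measurable_funD; apply: measurable_funM. Qed.

Let measurable_B : measurable_fun setT
  (fun p : measurableTypeR R * measurableTypeR R => c * (p.2 - ym) - s * (p.1 - xm)).
Proof. by apply: measurable_funB; apply: measurable_funM. Qed.

Lemma measurable_open_frame_tri : measurable
  (open_tri frame_tri : set (measurableTypeR R * measurableTypeR R)).
Proof.
have -> : open_tri frame_tri =
    [set p | c * (p.1 - xm) + s * (p.2 - ym) < eta] `&`
    ([set p | - (c * (p.1 - xm) + s * (p.2 - ym)) < c * (p.2 - ym) - s * (p.1 - xm)] `&`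
     [set p | c * (p.2 - ym) - s * (p.1 - xm) < c * (p.1 - xm) + s * (p.2 - ym)]).
  apply/seteqP; split=> p; rewrite open_tri_frame_tri /=.
    by move=> [? /andP[]].
  by move=> [? []? ?]; split => //; apply/andP.
apply: measurableI; first exact: measurable_ltr_set.
apply: measurableI; last exact: measurable_ltr_set.
by apply: measurable_ltr_set => //; exact: measurableT_comp.
Qed.

Lemma open_frame_tri_finite : (leb2 (open_tri frame_tri) < +oo)%E.
Proof.
pose box := `[xm - eta, xm + eta]%classic `*` `[ym - eta, ym + eta]%classic
  : set (measurableTypeR R * measurableTypeR R).
apply: (@le_lt_trans _ _ (leb2 box)).
  apply: le_measure; rewrite ?inE//; first exact: measurable_open_frame_tri.
    by apply: measurableX; exact: measurable_itv.
  move=> p /open_tri_frame_tri; rewrite /box /= !in_itv/=.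
  move: axis; rewrite !inE => /or4P[] /eqP[-> ->] [h1 /andP[h2 h3]];
    by split; apply/andP; split; lra.
rewrite /box leb2_setX.
by rewrite !lebesgue_measure_itv/=; do 2 case: ifP => _; rewrite ?mule0 ?mul0e ?ltry// -!EFinD -EFinM ltry.
Qed.

(** The six weights are the integrals of the monomials over the reference
    triangle with vertices (0,0), (1,-1), (1,1). *)
Lemma integral_frame_tri (q00 q10 q01 q20 q11 q02 : R) :
  \int[leb2]_(p in open_tri frame_tri)
    (q00 + q10 * frame_rho p + q01 * frame_sigma p + q20 * frame_rho p ^+ 2
     + q11 * (frame_rho p * frame_sigma p) + q02 * frame_sigma p ^+ 2) =
  eta ^+ 2 * (q00 + 2 / 3 * q10 + q20 / 2 + q02 / 6).
Proof.
set g := (fun p : R * R => _ : R).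
have mT := measurable_open_frame_tri.
have mrho : measurable_fun setT (frame_rho : measurableTypeR R * measurableTypeR R -> R).
  by apply: measurable_funM => //; exact: measurable_A.
have msigma : measurable_fun setT (frame_sigma : measurableTypeR R * measurableTypeR R -> R).
  by apply: measurable_funM => //; exact: measurable_B.
have mg : measurable_fun setT (g : measurableTypeR R * measurableTypeR R -> R).
  repeat (apply: measurable_funD); repeat (apply: measurable_funM => //);
  by [].
have ig : leb2.-integrable (open_tri frame_tri) (EFin \o g).
  apply: measurable_bounded_integrable => //.
  - exact: open_frame_tri_finite.
  - exact: measurable_funTS.
  exists (`|q00| + `|q10| + `|q01| + `|q20| + `|q11| + `|q02|); split.
    by rewrite num_real.
  move=> M ltM p /frame_open_tri[h1 /andP[h2 h3]] /=.
  apply: (le_trans _ (ltW ltM)).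
  have r1 : `|frame_rho p| <= 1 by rewrite ler_norml; apply/andP; split; lra.
  have s1 : `|frame_sigma p| <= 1 by rewrite ler_norml; apply/andP; split; lra.
  rewrite /g; move: (frame_rho p) (frame_sigma p) r1 s1 => r t r1 t1.
  do 5 (apply: (le_trans (ler_normD _ _)); apply: lerD;
    last by rewrite ?normrM ?normrX ler_piMr// ?mulr_ile1// ?exprn_ile1).
  by [].
rewrite /Rintegral.
suff -> : (\int[leb2]_(p in open_tri frame_tri) (g p)%:E)%E =
    (eta ^+ 2 * (q00 + 2 / 3 * q10 + q20 / 2 + q02 / 6))%:E by [].
have integral_x : s = 0 -> c = 1 \/ c = -1 ->
    (\int[leb2]_(p in open_tri frame_tri) (g p)%:E)%E =
    (eta ^+ 2 * (q00 + 2 / 3 * q10 + q20 / 2 + q02 / 6))%:E.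
  move=> sE cE.
  have c2 : c ^+ 2 = 1 by case: cE => ->; rewrite ?sqrrN expr1n.
  pose lo x := ym - c * (x - xm); pose up x := ym + c * (x - xm).
  pose h x := 0 + 2 * c * q00 * (x - xm) + 2 * q10 / eta * (x - xm) ^+ 2
    + 2 * c * (q20 + q02 / 3) / eta ^+ 2 * (x - xm) ^+ 3.
  pose a := if c == 1 then xm else xm - eta.
  rewrite (@integral_between_graphs _ _ _ a (a + eta) lo up h)//.
  - rewrite integral_cubic ?lerDl ?ltW//; congr EFin; rewrite /a.
    by case: cE => ->; rewrite ?eqxx ?N1_neq1; field.
  - move=> p; rewrite open_tri_frame_tri /lo /up /a sE.
    case: cE => ->; rewrite ?eqxx ?N1_neq1; split.
    + by move=> [h1 /andP[h2 h3]]; split; apply/andP; split; lra.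
    + by move=> [/andP[h1 h2] /andP[h3 h4]]; split; [|apply/andP; split]; lra.
    + by move=> [h1 /andP[h2 h3]]; split; apply/andP; split; lra.
    + by move=> [/andP[h1 h2] /andP[h3 h4]]; split; [|apply/andP; split]; lra.
  - move=> x /andP[ax xb]; have lo_up : lo x <= up x.
      by move: ax xb; rewrite /lo /up /a; case: cE => ->;
        rewrite ?eqxx ?N1_neq1 => ax xb; lra.
    pose r := c * (x - xm) / eta.
    transitivity (\int[lebesgue_measure]_(y in `]lo x, up x[)
        (q00 + q10 * r + q20 * r ^+ 2 + (q01 + q11 * r) * c / eta * (y - ym)
         + q02 / eta ^+ 2 * (y - ym) ^+ 2 + 0 * (y - ym) ^+ 3)%:E)%E.
      apply: eq_integral => y _; congr EFin.
      rewrite /g /frame_rho /frame_sigma /= sE /r.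
      by case: cE => ->; field.
    rewrite integral_cubic//; congr EFin; rewrite /h /lo /up /r.
    by case: cE => ->; field.
have integral_y : c = 0 -> s = 1 \/ s = -1 ->
    (\int[leb2]_(p in open_tri frame_tri) (g p)%:E)%E =
    (eta ^+ 2 * (q00 + 2 / 3 * q10 + q20 / 2 + q02 / 6))%:E.
  move=> cE sE.
  pose lo y := xm - s * (y - ym); pose up y := xm + s * (y - ym).
  pose h y := 0 + 2 * s * q00 * (y - ym) + 2 * q10 / eta * (y - ym) ^+ 2
    + 2 * s * (q20 + q02 / 3) / eta ^+ 2 * (y - ym) ^+ 3.
  pose a := if s == 1 then ym else ym - eta.
  rewrite (@integral_between_graphs_swap _ _ _ a (a + eta) lo up h)//.
  - rewrite integral_cubic ?lerDl ?ltW//; congr EFin; rewrite /a.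
    by case: sE => ->; rewrite ?eqxx ?N1_neq1; field.
  - move=> p; rewrite open_tri_frame_tri /lo /up /a cE.
    case: sE => ->; rewrite ?eqxx ?N1_neq1; split.
    + by move=> [h1 /andP[h2 h3]]; split; apply/andP; split; lra.
    + by move=> [/andP[h1 h2] /andP[h3 h4]]; split; [|apply/andP; split]; lra.
    + by move=> [h1 /andP[h2 h3]]; split; apply/andP; split; lra.
    + by move=> [/andP[h1 h2] /andP[h3 h4]]; split; [|apply/andP; split]; lra.
  - move=> y /andP[ay yb]; have lo_up : lo y <= up y.
      by move: ay yb; rewrite /lo /up /a; case: sE => ->;
        rewrite ?eqxx ?N1_neq1 => ay yb; lra.
    pose r := s * (y - ym) / eta.
    transitivity (\int[lebesgue_measure]_(x in `]lo y, up y[)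
        (q00 + q10 * r + q20 * r ^+ 2 + - ((q01 + q11 * r) * s / eta) * (x - xm)
         + q02 / eta ^+ 2 * (x - xm) ^+ 2 + 0 * (x - xm) ^+ 3)%:E)%E.
      apply: eq_integral => x _; congr EFin.
      rewrite /g /frame_rho /frame_sigma /= cE /r.
      by case: sE => ->; field.
    rewrite integral_cubic//; congr EFin; rewrite /h /lo /up /r.
    by case: sE => ->; field.
by move: axis; rewrite !inE => /or4P[] /eqP[cE sE];
  [apply: integral_y|apply: integral_x|apply: integral_y|apply: integral_x];
  rewrite ?cE ?sE; auto.
Qed.

Definition frame_quad (d00 d10 d01 d20 d11 d02 : R) (p : R * R) : R :=
  d00 + d10 * frame_rho p + d01 * frame_sigma p + d20 * frame_rho p ^+ 2
  + d11 * (frame_rho p * frame_sigma p) + d02 * frame_sigma p ^+ 2.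

Lemma quadratic_on_frame A phi : quadratic_on A phi ->
  exists d00 d10 d01 d20 d11 d02, forall p, A p ->
    phi p = frame_quad d00 d10 d01 d20 d11 d02 p.
Proof.
case=> c00 [c10 [c01 [c20 [c11 [c02 phiE]]]]].
pose x1 := eta * c; pose x2 := - eta * s; pose y1 := eta * s; pose y2 := eta * c.
exists (c00 + c10 * xm + c01 * ym + c20 * xm ^+ 2 + c11 * (xm * ym) + c02 * ym ^+ 2).
exists (c10 * x1 + c01 * y1 + 2 * c20 * xm * x1 + c11 * (xm * y1 + ym * x1)
  + 2 * c02 * ym * y1).
exists (c10 * x2 + c01 * y2 + 2 * c20 * xm * x2 + c11 * (xm * y2 + ym * x2)
  + 2 * c02 * ym * y2).
exists (c20 * x1 ^+ 2 + c11 * x1 * y1 + c02 * y1 ^+ 2).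
exists (2 * c20 * x1 * x2 + c11 * (x1 * y2 + x2 * y1) + 2 * c02 * y1 * y2).
exists (c20 * x2 ^+ 2 + c11 * x2 * y2 + c02 * y2 ^+ 2).
move=> p /phiE ->; rewrite frame_x frame_y /frame_quad /x1 /x2 /y1 /y2.
by move: (frame_rho p) (frame_sigma p) => r t; ring.
Qed.

Lemma derive_frame_quad (d00 d10 d01 d20 d11 d02 : R) (v p : R * R) :
  'D_v (frame_quad d00 d10 d01 d20 d11 d02) p =
  (d10 + 2 * d20 * frame_rho p + d11 * frame_sigma p) * ((c * v.1 + s * v.2) / eta) +
  (d01 + d11 * frame_rho p + 2 * d02 * frame_sigma p) * ((c * v.2 - s * v.1) / eta).
Proof.
set dr := (c * v.1 + _) / eta; set dt := (c * v.2 - _) / eta.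
set L := (X in _ = X).
pose Q := d20 * dr ^+ 2 + d11 * dr * dt + d02 * dt ^+ 2.
rewrite /derive; apply: cvg_lim => //.
(* The difference quotient of a quadratic polynomial at step [h] is exactly
   [L + h * Q]. *)
have LQ : (fun h : R => L + h * Q) @ (0 : R)^' --> L + 0 * Q.
  by apply: cvgD; [exact: cvg_cst|apply: cvgMr_tmp; exact: cvg_within].
rewrite mul0r addr0 in LQ; apply: cvg_trans LQ.
apply: near_eq_cvg; near=> h.
have h0 : h != 0 by near: h; exact: nbhs_dnbhs_neq.
have v1 : (h *: v + p).1 = h * v.1 + p.1 by [].
have v2 : (h *: v + p).2 = h * v.2 + p.2 by [].
have rE : frame_rho (h *: v + p) = frame_rho p + h * dr.
  by rewrite /frame_rho /dr v1 v2; field.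
have tE : frame_sigma (h *: v + p) = frame_sigma p + h * dt.
  by rewrite /frame_sigma /dt v1 v2; field.
rewrite /= /shift/= /frame_quad rE tE /L /Q -[_ *: _]/(_ * _).
by move: (frame_rho p) (frame_sigma p) => r t; field.
Unshelve. all: by end_near. Qed.

(** Openness makes the gradient at a point of the triangle depend only on the values
    of the function in the triangle. *)
Lemma open_frame_tri_near p : open_tri frame_tri p ->
  \forall q \near p, open_tri frame_tri q.
Proof.
move=> /open_tri_frame_tri[h1 /andP[h2 h3]].
have cX (q : R * R) : (fun q : R * R => q.1 - xm) @ q --> q.1 - xm.
  by apply: cvgB; [exact: cvg_fst|exact: cvg_cst].
have cY (q : R * R) : (fun q : R * R => q.2 - ym) @ q --> q.2 - ym.
  by apply: cvgB; [exact: cvg_snd|exact: cvg_cst].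
have cA (q : R * R) : (fun q : R * R => c * (q.1 - xm) + s * (q.2 - ym)) @ q -->
    c * (q.1 - xm) + s * (q.2 - ym).
  by apply: cvgD; apply: cvgMl_tmp; [exact: cX|exact: cY].
have cB (q : R * R) : (fun q : R * R => c * (q.2 - ym) - s * (q.1 - xm)) @ q -->
    c * (q.2 - ym) - s * (q.1 - xm).
  by apply: cvgB; apply: cvgMl_tmp; [exact: cY|exact: cX].
near=> q; apply/open_tri_frame_tri; split.
  by near: q; exact: (cvgr_lt _ (cA p)).
apply/andP; split; rewrite -subr_gt0; near: q.
  apply: (cvgr_gt _ (cvgB (cB p) (cvgN (cA p)))).
  by rewrite subr_gt0.
apply: (cvgr_gt _ (cvgB (cA p) (cB p))).
by rewrite subr_gt0.
Unshelve. all: by end_near. Qed.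

Lemma open_tri_closed (K : tri R) : open_tri K `<=` closed_tri K.
Proof.
by move=> p [u [v [w [? ? ? ? ->]]]]; exists u, v, w; split=> //; exact: ltW.
Qed.

(** Barycentric coordinates of the nodes, in the order of [tri_nodes]. *)
Definition node_weights (a : nat) : R * R * R :=
  nth (0, 0, 0) [:: (1, 0, 0); (0, 1, 0); (0, 0, 1);
    (1 / 2, 1 / 2, 0); (0, 1 / 2, 1 / 2); (1 / 2, 0, 1 / 2)] a.

Lemma tri_nodes_barypoint (K : tri R) (a : 'I_6) :
  let: (u, v, w) := node_weights a in
  u + v + w = 1 /\ nth (0, 0) (tri_nodes K) a = barypoint K u v w.
Proof.
case: K => -[[x1 y1] [x2 y2]] [x3 y3].
by case: a => -[|[|[|[|[|[|//]]]]]] _ /=; split; rewrite /midpoint/=;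
  try (congr pair); field.
Qed.

Lemma tri_nodes_closed (K : tri R) (a : 'I_6) :
  closed_tri K (nth (0, 0) (tri_nodes K) a).
Proof.
have : let: (u, v, w) := node_weights a in [/\ 0 <= u, 0 <= v & 0 <= w].
  by case: a => -[|[|[|[|[|[|//]]]]]] _ /=; split; lra.
have := tri_nodes_barypoint K a; case: node_weights => -[u v] w [uvw ->] [? ? ?].
by exists u, v, w.
Qed.

Lemma frame_quad_nodes f (d0 d1 d2 d3 d4 d5 : R) (a : 'I_6) :
  (forall p, closed_tri frame_tri p -> f p = frame_quad d0 d1 d2 d3 d4 d5 p) ->
  f (nth (0, 0) (tri_nodes frame_tri) a) = nth 0
    [:: d0; d0 + d1 - d2 + d3 - d4 + d5; d0 + d1 + d2 + d3 + d4 + d5;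
        d0 + d1 / 2 - d2 / 2 + d3 / 4 - d4 / 4 + d5 / 4; d0 + d1 + d3;
        d0 + d1 / 2 + d2 / 2 + d3 / 4 + d4 / 4 + d5 / 4] a.
Proof.
move=> fE; rewrite fE; last exact: tri_nodes_closed.
rewrite /frame_quad.
have : let: (u, v, w) := node_weights a in
    frame_rho (nth (0, 0) (tri_nodes frame_tri) a) = v + w /\
    frame_sigma (nth (0, 0) (tri_nodes frame_tri) a) = w - v.
  have := tri_nodes_barypoint frame_tri a.
  case: node_weights => -[u v] w [uvw ->]; exact: frame_barypoint.
move: (frame_rho _) (frame_sigma _) => r t.
by case: a => -[|[|[|[|[|[|//]]]]]] _ /= [-> ->]; field.
Qed.

(** Both sides are bilinear in the coefficients of the two polynomials.  On the left
    the gradients are integrated in the frame coordinates, on the right the nodal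
    values are expressed by the coefficients. *)
Lemma stiffness_frame_tri phi psi :
  quadratic_on (closed_tri frame_tri) phi ->
  quadratic_on (closed_tri frame_tri) psi ->
  \int[leb2]_(p in open_tri frame_tri) grad_dot phi psi p =
  \sum_(a < 6) \sum_(b < 6) elem_stiffness R a b *
    (phi (nth (0, 0) (tri_nodes frame_tri) a) *
     psi (nth (0, 0) (tri_nodes frame_tri) b)).
Proof.
move=> /quadratic_on_frame[d00 [d10 [d01 [d20 [d11 [d02 phiE]]]]]].
move=> /quadratic_on_frame[e00 [e10 [e01 [e20 [e11 [e02 psiE]]]]]].
have der f d0 d1 d2 d3 d4 d5 v p : (forall p, closed_tri frame_tri p ->
    f p = frame_quad d0 d1 d2 d3 d4 d5 p) -> open_tri frame_tri p ->
    'D_v f p = 'D_v (frame_quad d0 d1 d2 d3 d4 d5) p.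
  move=> fE /open_frame_tri_near pT; apply: near_eq_derive.
  by apply: filterS pT => q /open_tri_closed/fE.
transitivity (\int[leb2]_(p in open_tri frame_tri)
   (((d10 * e10 + d01 * e01) / eta ^+ 2)
    + ((2 * (d10 * e20 + d20 * e10) + d01 * e11 + d11 * e01) / eta ^+ 2) * frame_rho p
    + ((d10 * e11 + d11 * e10 + 2 * (d01 * e02 + d02 * e01)) / eta ^+ 2) * frame_sigma p
    + ((4 * d20 * e20 + d11 * e11) / eta ^+ 2) * frame_rho p ^+ 2
    + ((2 * (d20 * e11 + d11 * e20) + 2 * (d11 * e02 + d02 * e11)) / eta ^+ 2)
      * (frame_rho p * frame_sigma p)
    + ((d11 * e11 + 4 * d02 * e02) / eta ^+ 2) * frame_sigma p ^+ 2)).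
  apply: eq_Rintegral => p; rewrite inE => pT.
  rewrite /grad_dot !(der _ _ _ _ _ _ _ _ _ phiE)// !(der _ _ _ _ _ _ _ _ _ psiE)//.
  rewrite !derive_frame_quad/=.
  move: (frame_rho p) (frame_sigma p) => r t.
  rewrite !mulr1 !mulr0 ?addr0 ?add0r ?sub0r ?subr0.
  set u := d10 + _ + _; set u' := d01 + _ + _; set w := e10 + _ + _; set w' := e01 + _ + _.
  transitivity ((c ^+ 2 + s ^+ 2) * (u * w + u' * w') / eta ^+ 2); first by field.
  by rewrite cs1 mul1r /u /u' /w /w'; field.
rewrite integral_frame_tri.
under [RHS]eq_bigr => a _ do under eq_bigr => b _ do
  rewrite (frame_quad_nodes _ phiE) (frame_quad_nodes _ psiE).
rewrite !big_ord_recl !big_ord0 /elem_stiffness /=.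
by field.
Qed.

End ReferenceFrame.

(** * Nodes of the periodic mesh *)

(** Position of a node of class [r] relative to the lower left corner of its
    cell, in units of a quarter of the side of the cell.  The classes are ordered
    as the rows of the symbol: the midpoints of the half-diagonals (0, 1, 4 and 5),
    the centre of the cell (2), the lower edge midpoint (3), the left edge midpoint
    (6) and the lower left corner (7). *)
Definition node_offset (r : nat) : nat * nat :=
  nth (0, 0)%N
    [:: (3, 3); (3, 1); (2, 2); (2, 0); (1, 1); (1, 3); (0, 2); (0, 0)]%N r.

(** For the [t]-th triangle of a cell and its [a]-th node: the class of the node
    and the displacement from the given cell to the cell that owns it. *)
Definition tri_node_table (t a : nat) : nat * (nat * nat) :=
  nth (0, (0, 0))%N (nth [::]
    [:: [:: (2, (0, 0)); (7, (0, 0)); (7, (1, 0)); (4, (0, 0)); (3, (0, 0)); (1, (0, 0))];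
        [:: (2, (0, 0)); (7, (1, 0)); (7, (1, 1)); (1, (0, 0)); (6, (1, 0)); (0, (0, 0))];
        [:: (2, (0, 0)); (7, (1, 1)); (7, (0, 1)); (0, (0, 0)); (3, (0, 1)); (5, (0, 0))];
        [:: (2, (0, 0)); (7, (0, 1)); (7, (0, 0)); (5, (0, 0)); (6, (0, 0)); (4, (0, 0))]]%N
    t) a.

Definition node_class (t : 'I_4) (a : 'I_6) : 'I_8 :=
  Ordinal (ltn_pmod (tri_node_table t a).1 (isT : 0 < 8)%N).

Definition node_shift (t : 'I_4) (a : 'I_6) : nat * nat := (tri_node_table t a).2.

Notation cell_index n := ('I_n * 'I_n)%type.
Notation torus_node n := ('I_n * 'I_n * 'I_8)%type.

(** Opposite sides of the square are identified. *)
Definition cyclic_shift n (i : 'I_n) (e : nat) : 'I_n :=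
  Ordinal (ltn_pmod (i + e) (leq_ltn_trans (leq0n i) (ltn_ord i))).

Definition tri_node n (c : cell_index n) (t : 'I_4) (a : 'I_6) : torus_node n :=
  ((cyclic_shift c.1 (node_shift t a).1, cyclic_shift c.2 (node_shift t a).2),
   node_class t a).

Lemma cyclic_shift_inj n e : injective (@cyclic_shift n ^~ e).
Proof.
move=> i j /(congr1 val)/= ij; apply/val_inj => /=.
have := congr1 (fun k => k %% n)%N ij; rewrite /= !modn_mod => /eqP.
by rewrite eqn_modDr !modn_small// => /eqP.
Qed.

(** A node determines the cell of which it is the [a]-th node of the [t]-th
    triangle. *)
Lemma tri_node_inj n t a : injective (fun c : cell_index n => tri_node c t a).
Proof.
move=> [c1 c2] [c1' c2'] [] /= h1 h2; congr pair.
  by apply: (@cyclic_shift_inj n (node_shift t a).1); exact/val_inj.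
by apply: (@cyclic_shift_inj n (node_shift t a).2); exact/val_inj.
Qed.

Section NodePositions.
Context {R : realFieldType}.

Definition node_pos (n i j r : nat) : R * R :=
  ((4 * i + (node_offset r).1)%:R / (4 * n)%:R,
   (4 * j + (node_offset r).2)%:R / (4 * n)%:R).

Definition torus_pos n (Q : torus_node n) : R * R :=
  node_pos n Q.1.1 Q.1.2 Q.2.

Definition cell_tri (n i j : nat) (t : 'I_4) : tri R :=
  nth ((0, 0), (0, 0), (0, 0)) (cell_triangles n i j) t.

Lemma cell_tri_nodes n i j (t : 'I_4) (a : 'I_6) : (0 < n)%N ->
  nth (0, 0) (tri_nodes (cell_tri n i j t)) a =
  node_pos n (i + (node_shift t a).1) (j + (node_shift t a).2) (node_class t a).
Proof.
move=> n0; have n0' : (n%:R : R) != 0 by rewrite pnatr_eq0 -lt0n.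
rewrite /node_pos !(natrD, natrM) /cell_tri /node_shift /node_class.
case: t => -[|[|[|[|//]]]] t4; case: a => -[|[|[|[|[|[|//]]]]]] a6 /=;
  rewrite /midpoint/= -?(natr1 i) -?(natr1 j);
  by congr pair; field.
Qed.

Lemma node_offset_lt r : ((node_offset r).1 < 4)%N /\ ((node_offset r).2 < 4)%N.
Proof. by move: r => [|[|[|[|[|[|[|[|r]]]]]]]]//; rewrite /node_offset nth_default. Qed.

Lemma node_offset_inj (r r' : 'I_8) : node_offset r = node_offset r' -> r = r'.
Proof.
by case: r => -[|[|[|[|[|[|[|[|//]]]]]]]] r8; case: r' => -[|[|[|[|[|[|[|[|//]]]]]]]] r'8 //= _;
  exact/val_inj.
Qed.

Lemma torus_pos_inj n : injective (@torus_pos n).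
Proof.
move=> [[i j] r] [[i' j'] r']; rewrite /torus_pos /node_pos /= => -[].
have n0 : (0 < n)%N by exact: leq_ltn_trans (leq0n i) (ltn_ord i).
have n0' : ((4 * n)%:R : R)^-1 != 0 by rewrite invr_eq0 pnatr_eq0; lia.
have [lt1 lt2] := node_offset_lt r; have [lt1' lt2'] := node_offset_lt r'.
move=> /(mulIf n0')/eqP; rewrite eqr_nat => /eqP h1.
move=> /(mulIf n0')/eqP; rewrite eqr_nat => /eqP h2.
have ei : i = i' :> nat by lia.
have ej : j = j' :> nat by lia.
rewrite (val_inj ei) (val_inj ej) (@node_offset_inj r r')//.
by apply/eqP; rewrite [node_offset r]surjective_pairing [node_offset r']surjective_pairing xpair_eqE;
  apply/andP; split; apply/eqP; lia.
Qed.

Lemma interior_node_pos n i j r : (0 < n)%N -> interior_pt (node_pos n i j r) =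
  (0 < 4 * i + (node_offset r).1 < 4 * n)%N && (0 < 4 * j + (node_offset r).2 < 4 * n)%N.
Proof.
move=> n0; have n0' : (0 : R) < (4 * n)%:R by rewrite ltr0n; lia.
by rewrite /interior_pt /node_pos/= !ltr_pdivrMr// !mul1r  !pmulr_lgt0 ?invr_gt0// !ltr0n !ltr_nat.
Qed.

End NodePositions.

(** * Assembly from element matrices *)

Section Assembly.
Context {R : realType}.

Notation elem_index := ('I_4 * 'I_6 * 'I_6)%type.
Notation torus_mx n := 'M[R]_(#|{: torus_node n}|).

Lemma elem_stiffness_sym (a b : 'I_6) :
  elem_stiffness R a b = elem_stiffness R b a.
Proof.
by case: a => -[|[|[|[|[|[|//]]]]]] a6; case: b => -[|[|[|[|[|[|//]]]]]] b6.
Qed.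

(** With [alpha = 1] this is the translation-invariant stiffness matrix, with the
    viscosity for [alpha] the weighted one; products with diagonal matrices only
    change [alpha], so that all comparisons take place among the coefficients. *)
Definition assemble n (alpha : cell_index n -> elem_index -> R) : torus_mx n :=
  \sum_c \sum_(y : elem_index) (alpha c y * elem_stiffness R y.1.2 y.2) *:
    delta_mx (enum_rank (tri_node c y.1.1 y.1.2))
             (enum_rank (tri_node c y.1.1 y.2)).

Definition elem_mass : R := \sum_(y : elem_index) `|elem_stiffness R y.1.2 y.2|.

Lemma big_elem_index (V : nmodType) (F : elem_index -> V) :
  \sum_y F y = \sum_t \sum_a \sum_b F (t, a, b).
Proof. by rewrite pair_bigA/= pair_bigA/=; apply: eq_bigr => -[[]]. Qed.

Lemma elem_mass_ge0 : 0 <= elem_mass.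
Proof. by apply: sumr_ge0. Qed.

Lemma assembleB n (alpha beta : cell_index n -> elem_index -> R) :
  assemble alpha - assemble beta = assemble (fun c y => alpha c y - beta c y).
Proof.
rewrite /assemble -sumrB; apply: eq_bigr => c _; rewrite -sumrB.
by apply: eq_bigr => y _; rewrite -scalerBl mulrBl.
Qed.

Lemma l1_delta (K : numDomainType) m p (i : 'I_m) (j : 'I_p) (x : K) :
  l1 (x *: delta_mx i j) = `|x|.
Proof.
rewrite /l1 (bigD1 i)//= [X in _ + X]big1 ?addr0; last first.
  move=> i' i'i; rewrite big1// => j' _.
  by rewrite !mxE (negbTE i'i) mulr0 normr0.
rewrite (bigD1 j)//= [X in _ + X]big1 ?addr0 ?mxE ?eqxx ?mulr1//.
by move=> j' j'j; rewrite !mxE (negbTE j'j) andbF mulr0 normr0.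
Qed.

Lemma l1_sum (K : numDomainType) m p (I : Type) (r : seq I)
    (F : I -> 'M[K]_(m, p)) :
  l1 (\sum_(i <- r) F i) <= \sum_(i <- r) l1 (F i).
Proof.
elim: r => [|i r IHr]; last by rewrite !big_cons (le_trans (l1D _ _))// lerD2l.
by rewrite !big_nil /l1 big1// => i _; rewrite big1// => j _; rewrite mxE normr0.
Qed.

Lemma l1_assemble n (alpha : cell_index n -> elem_index -> R) :
  l1 (assemble alpha) <=
  \sum_(y : elem_index) `|elem_stiffness R y.1.2 y.2| * \sum_c `|alpha c y|.
Proof.
under [leRHS]eq_bigr do rewrite mulr_sumr.
rewrite exchange_big/=; apply: (le_trans (l1_sum _ _)); apply: ler_sum => c _.
apply: (le_trans (l1_sum _ _)); apply: ler_sum => y _.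
by rewrite l1_delta normrM mulrC.
Qed.

Lemma tr_assemble n (alpha : cell_index n -> elem_index -> R) :
  (assemble alpha)^T = assemble (fun c y => alpha c (y.1.1, y.2, y.1.2)).
Proof.
pose sw (y : elem_index) : elem_index := (y.1.1, y.2, y.1.2).
rewrite /assemble raddf_sum; apply: eq_bigr => c _; rewrite raddf_sum/=.
have swK : involutive sw by case=> [[? ?] ?].
rewrite (reindex_inj (inv_inj swK)); apply: eq_bigr => y _ /=.
by rewrite linearZ/= trmx_delta elem_stiffness_sym.
Qed.

Lemma assemble_entry n (alpha : cell_index n -> elem_index -> R) P Q :
  assemble alpha (enum_rank P) (enum_rank Q) =
  \sum_c \sum_(y : elem_index) (alpha c y * elem_stiffness R y.1.2 y.2) *
    ((P == tri_node c y.1.1 y.1.2) && (Q == tri_node c y.1.1 y.2))%:R.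
Proof.
rewrite /assemble summxE; apply: eq_bigr => c _; rewrite summxE.
by apply: eq_bigr => y _; rewrite !mxE !(inj_eq enum_rank_inj).
Qed.

(** By [tri_node_inj], each [y] contributes at most one cell to a given row. *)
Lemma rowsum_assemble n (alpha : cell_index n -> elem_index -> R) M :
  (forall c y, `|alpha c y| <= M) -> 0 <= M ->
  rowsum_le (M * elem_mass) (assemble alpha).
Proof.
move=> alphaM M0 k.
apply: (@le_trans _ _ (\sum_(y : elem_index) \sum_c (M * `|elem_stiffness R y.1.2 y.2|) *
    (enum_val k == tri_node c y.1.1 y.1.2)%:R)).
  rewrite exchange_big/=.
  apply: (@le_trans _ _ (\sum_j \sum_c \sum_(y : elem_index)
      (M * `|elem_stiffness R y.1.2 y.2|) *
       ((enum_val k == tri_node c y.1.1 y.1.2) &&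
        (enum_val j == tri_node c y.1.1 y.2))%:R)).
    apply: ler_sum => j _.
    rewrite -{1}(enum_valK k) -{1}(enum_valK j) assemble_entry.
    apply: (le_trans (ler_norm_sum _ _ _)); apply: ler_sum => c _.
    apply: (le_trans (ler_norm_sum _ _ _)); apply: ler_sum => y _.
    by rewrite !normrM normr_nat ler_wpM2r// ler_wpM2r.
  rewrite exchange_big/=; apply: ler_sum => c _; rewrite exchange_big/=.
  apply: ler_sum => y _; rewrite -mulr_sumr ler_wpM2l ?mulr_ge0//.
  rewrite (bigD1 (enum_rank (tri_node c y.1.1 y.2)))//= big1 ?addr0.
    by rewrite enum_rankK eqxx andbT.
  move=> j jy; rewrite -(inj_eq enum_rank_inj (enum_val j)) enum_valK (negbTE jy).
  by rewrite andbF.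
rewrite /elem_mass mulr_sumr; apply: ler_sum => y _.
rewrite -mulr_sumr ler_piMr ?mulr_ge0//.
have [c kc|nc] := pickP (fun c => enum_val k == tri_node c y.1.1 y.1.2); last first.
  by rewrite big1// => c _; rewrite nc.
rewrite (bigD1 c)//= big1 ?addr0 ?lern1 ?leq_b1// => c' c'c.
rewrite (eqP kc) eq_sym (inj_eq (@tri_node_inj n y.1.1 y.1.2)) (negbTE c'c)//.
Qed.

Definition node_diag n (delta : torus_node n -> R) : torus_mx n :=
  diag_mx (\row_k delta (enum_val k)).

Lemma node_diag_mul_assemble n (delta : torus_node n -> R) alpha :
  node_diag delta *m assemble alpha =
  assemble (fun c y => delta (tri_node c y.1.1 y.1.2) * alpha c y).
Proof.
rewrite /assemble mulmx_sumr; apply: eq_bigr => c _; rewrite mulmx_sumr.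
apply: eq_bigr => y _; apply/matrixP => i j.
rewrite /node_diag mul_diag_mx !mxE; case: eqP => [->|_]; last by rewrite !mulr0.
by rewrite enum_rankK !mulrA.
Qed.

Lemma assemble_mul_node_diag n (delta : torus_node n -> R) alpha :
  assemble alpha *m node_diag delta =
  assemble (fun c y => delta (tri_node c y.1.1 y.2) * alpha c y).
Proof.
rewrite /assemble mulmx_suml; apply: eq_bigr => c _; rewrite mulmx_suml.
apply: eq_bigr => y _; apply/matrixP => i j.
rewrite /node_diag mul_mx_diag !mxE; case: (j =P _) => [->|_]; last by rewrite andbF !mulr0 mul0r.
by rewrite enum_rankK andbT; ring.
Qed.

End Assembly.

Lemma mul_delta_mx_mul (K : nzRingType) m p q r (X : 'M[K]_(m, p))
  (Y : 'M[K]_(q, r)) k l i j :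
  (X *m delta_mx k l *m Y) i j = X i k * Y l j.
Proof.
rewrite -(mul_delta_mx (0 : 'I_1)) mulmxA -mulmxA -colE -rowE.
by rewrite mxE big_ord1 !mxE.
Qed.

(** * The stiffness matrix as a compression of a matrix on the torus *)

Section Compression.
Context {R : realType}.

Lemma cell_tri_frame n i j (t : 'I_4) : (0 < n)%N ->
  exists c s : R, (c, s) \in [:: (0, -1); (1, 0); (0, 1); (-1, 0)] /\
    cell_tri n i j t =
    frame_tri ((i%:R + 1 / 2) / n%:R) ((j%:R + 1 / 2) / n%:R) (1 / 2 / n%:R) c s.
Proof.
move=> n0; have n0' : (n%:R : R) != 0 by rewrite pnatr_eq0 -lt0n.
pose d : R * R := nth (0, 0) [:: (0, -1); (1, 0); (0, 1); (-1, 0)] t.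
exists d.1, d.2; split.
  by rewrite -surjective_pairing /d mem_nth//=.
rewrite /cell_tri /frame_tri {}/d.
by case: t => -[|[|[|[|//]]]] t4 /=; rewrite /midpoint/= -?(natr1 i) -?(natr1 j);
  congr (_, _, _); congr pair; field.
Qed.

Lemma cell_tri_mesh n i j (t : 'I_4) : (i < n)%N -> (j < n)%N ->
  cell_tri n i j t \in mesh R n.
Proof.
move=> lt_in lt_jn; apply/flattenP; exists (cell_triangles n i j).
  by apply/allpairsP; exists (i, j); rewrite !mem_iota.
by rewrite /cell_tri mem_nth//=.
Qed.

Lemma big_mesh n (F : tri R -> R) :
  \sum_(K <- mesh R n) F K =
  \sum_(c : cell_index n) \sum_(t < 4) F (cell_tri n c.1 c.2 t).
Proof.
rewrite big_flatten/= big_allpairs_dep/=.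
rewrite -(pair_bigA _ (fun i j : 'I_n => \sum_(t < 4) F (cell_tri n i j t)))/=.
have iotaE m : iota 0 m = index_iota 0 m by rewrite /index_iota subn0.
rewrite !iotaE big_mkord; apply: eq_bigr => i _; rewrite big_mkord.
apply: eq_bigr => j _; rewrite /cell_tri /cell_triangles !big_ord_recl big_ord0 !big_cons big_nil.
by rewrite addr0.
Qed.

Lemma cell_tri_node_in n (c : cell_index n) (t : 'I_4) (a : 'I_6) :
  unit_square (nth (0, 0) (tri_nodes (cell_tri n c.1 c.2 t)) a : R * R).
Proof.
have n0 : (0 < n)%N by exact: leq_ltn_trans (leq0n c.1) (ltn_ord c.1).
have n0' : (0 : R) < (4 * n)%:R by rewrite ltr0n; lia.
rewrite cell_tri_nodes// /unit_square /node_pos /=; rewrite !in_itv/=.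
rewrite !ler_pdivrMr// !mul1r !mulr_ge0 ?invr_ge0 ?ler0n ?(ltW n0')//= !ler_nat.
have c1 := ltn_ord c.1; have c2 := ltn_ord c.2.
rewrite /node_shift /node_class/=.
by case: t => -[|[|[|[|//]]]] t4; case: a => -[|[|[|[|[|[|//]]]]]] a6 /=; lia.
Qed.

Lemma interior_cell_tri_node n (c : cell_index n) (t : 'I_4) (a : 'I_6) (p : R * R) :
  interior_pt p ->
  (p == nth (0, 0) (tri_nodes (cell_tri n c.1 c.2 t)) a) =
  (p == torus_pos (tri_node c t a)).
Proof.
have n0 : (0 < n)%N by exact: leq_ltn_trans (leq0n c.1) (ltn_ord c.1).
move=> pint; rewrite cell_tri_nodes// /torus_pos /=.
have [/andP[lt_i lt_j]|wrap] :=
    boolP ((c.1 + (node_shift t a).1 < n) && (c.2 + (node_shift t a).2 < n))%N.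
  by rewrite (modn_small lt_i) (modn_small lt_j).
have c1 := ltn_ord c.1; have c2 := ltn_ord c.2.
(* A node on the right or upper side of the square is not interior; its periodic
   copy lies on the left or lower side. *)
transitivity false; [|symmetry]; apply/negbTE; apply: contraL pint => /eqP ->;
  rewrite interior_node_pos//; move: wrap; rewrite /node_shift.
  by case: t => -[|[|[|[|//]]]] t4; case: a => -[|[|[|[|[|[|//]]]]]] a6 /=; lia.
have modn_n (k e : nat) : (k < n)%N -> (e <= 1)%N -> ~~ (k + e < n)%N -> ((k + e) %% n = 0)%N.
  by move=> kn e1 ke; rewrite (_ : (k + e)%N = n) ?modnn//; lia.
rewrite negb_and => /orP[] h.
  have := modn_n _ (tri_node_table t a).2.1 c1 _ h; move: h.
  by case: t => -[|[|[|[|//]]]] t4; case: a => -[|[|[|[|[|[|//]]]]]] a6 /= h;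
    try lia; move=> ->.
have := modn_n _ (tri_node_table t a).2.2 c2 _ h; move: h.
by case: t => -[|[|[|[|//]]]] t4; case: a => -[|[|[|[|[|[|//]]]]]] a6 /= h;
  try lia; move=> ->; rewrite ?andbF.
Qed.

(** Selection of the interior nodes among the nodes of the torus. *)
Definition node_incidence n : 'M[R]_(dofs R n, #|{: torus_node n}|) :=
  \matrix_(i, k) (nth (0, 0) (interior_nodes R n) i == torus_pos (enum_val k))%:R.

Lemma interior_node_interior n (i : 'I_(dofs R n)) :
  interior_pt (nth (0, 0) (interior_nodes R n) i : R * R).
Proof.
have : nth (0, 0) (interior_nodes R n) i \in interior_nodes R n by exact: mem_nth.
by rewrite mem_undup mem_filter => /andP[].
Qed.

Lemma basis_node_value n (phi : 'I_(dofs R n) -> R * R -> R)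
    (c : cell_index n) (t : 'I_4) (a : 'I_6) i : nodal_basis phi ->
  phi i (nth (0, 0) (tri_nodes (cell_tri n c.1 c.2 t)) a) =
  (nth (0, 0) (interior_nodes R n) i == torus_pos (tri_node c t a))%:R.
Proof.
move=> [phiP phi_delta]; set p := nth _ (tri_nodes _) _.
rewrite -interior_cell_tri_node ?interior_node_interior// -/p.
have [pint|pbd] := boolP (interior_pt p); last first.
  rewrite (P2_boundary (phiP i) (cell_tri_node_in c t a) pbd).
  by case: eqP => // pE; move: pbd; rewrite -pE interior_node_interior.
have p_in : p \in interior_nodes R n.
  rewrite mem_undup mem_filter pint; apply/flatten_mapP.
  exists (cell_tri n c.1 c.2 t); first exact: cell_tri_mesh.
  by rewrite /p mem_nth//; case: (cell_tri _ _ _ _) => -[? ?] ?.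
have lt_j : (index p (interior_nodes R n) < dofs R n)%N by rewrite index_mem.
rewrite -{1}(nth_index (0, 0) p_in) -/(nat_of_ord (Ordinal lt_j)).
have -> : nth (0, 0) (interior_nodes R n) (Ordinal lt_j) =
          nth 0 (interior_nodes R n) (Ordinal lt_j) by apply: set_nth_default.
rewrite phi_delta; congr (nat_of_bool _)%:R.
rewrite -{2}(nth_index (0, 0) p_in) nth_uniq ?undup_uniq//.
Qed.

(** On a triangle a basis function is determined by its values at the six nodes,
    which are 0 or 1.  At a boundary node all basis functions vanish, and the node of
    the torus that represents it is not an interior node, so the identification of
    opposite sides changes nothing. *)
Lemma stiffness_assemble mu n (phi : 'I_(dofs R n) -> R * R -> R) :
  (0 < n)%N -> nodal_basis phi ->
  stiffness mu phi = node_incidence n *m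
    assemble (fun c y => mu (barycenter (cell_tri n c.1 c.2 y.1.1)))
    *m (node_incidence n)^T.
Proof.
move=> n0 phiB; apply/matrixP => i j.
rewrite mxE big_mesh /assemble mulmx_sumr mulmx_suml summxE.
apply: eq_bigr => c _; rewrite mulmx_sumr mulmx_suml summxE.
rewrite big_elem_index/=.
apply: eq_bigr => t _.
have phiQ k : quadratic_on (closed_tri (cell_tri n c.1 c.2 t)) (phi k).
  by apply: (P2_quadratic (phiB.1 k)); exact: cell_tri_mesh.
have -> : \int[leb2]_(p in open_tri (cell_tri n c.1 c.2 t)) grad_dot (phi j) (phi i) p =
  \sum_(a < 6) \sum_(b < 6) elem_stiffness R a b *
    (phi j (nth (0, 0) (tri_nodes (cell_tri n c.1 c.2 t)) a) *
     phi i (nth (0, 0) (tri_nodes (cell_tri n c.1 c.2 t)) b)).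
  have := phiQ i; have := phiQ j.
  have [u [v [uv ->]]] := cell_tri_frame c.1 c.2 t n0.
  by apply: stiffness_frame_tri => //; rewrite !divr_gt0// ltr0n.
rewrite exchange_big/= mulr_sumr; apply: eq_bigr => a _; rewrite mulr_sumr.
apply: eq_bigr => b _.
rewrite -scalemxAr -scalemxAl mxE -mulrA elem_stiffness_sym; congr (_ * (_ * _)).
rewrite mul_delta_mx_mul !basis_node_value// !mxE !enum_rankK.
by rewrite mulrC.
Qed.

Lemma node_incidenceM n : node_incidence n *m (node_incidence n)^T = 1%:M.
Proof.
apply/matrixP => i j; rewrite !mxE.
set p := nth (0, 0) (interior_nodes R n).
have [Q pQ] : exists Q : torus_node n, p i = torus_pos Q.
  have : p i \in interior_nodes R n by exact: mem_nth.
  rewrite mem_undup mem_filter => /andP[pint /flatten_mapP[K /flattenP[s]]].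
  move=> /allpairsP[[c1 c2] [/=]]; rewrite !mem_iota !add0n /= => h1 h2 -> Ks.
  have tP : (index K (cell_triangles n c1 c2) < 4)%N by rewrite -[4%N]/(size (cell_triangles (R := R) n c1 c2)) index_mem.
  have KE : K = cell_tri n (Ordinal h1, Ordinal h2).1 (Ordinal h1, Ordinal h2).2 (Ordinal tP).
    by rewrite /cell_tri nth_index.
  move=> pK; have aP : (index (p i) (tri_nodes K) < 6)%N.
    by move: pK; rewrite -index_mem; case: (K) => -[? ?] ?.
  exists (tri_node (Ordinal h1, Ordinal h2) (Ordinal tP) (Ordinal aP)).
  by apply/eqP; rewrite -interior_cell_tri_node// -KE nth_index.
rewrite (bigD1 (enum_rank Q))//= !mxE enum_rankK -/p -/(p i) -/(p j) pQ eqxx mul1r big1 ?addr0.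
  rewrite -pQ eq_sym /p nth_uniq ?undup_uniq//.
move=> k kQ; rewrite !mxE -/p -/(p i) pQ (inj_eq (@torus_pos_inj R n)).
by rewrite -(inj_eq enum_rank_inj) enum_valK eq_sym (negbTE kQ) mul0r.
Qed.

Lemma torus_node_tri_node n (Q : torus_node n) :
  exists t a, tri_node Q.1 t a = Q.
Proof.
have shift0 (i : 'I_n) : cyclic_shift i 0 = i.
  by apply/val_inj; rewrite /= addn0 modn_small.
case: Q => -[i j] r /=.
have [t [a [eshift eclass]]] : exists t a, node_shift t a = (0, 0)%N /\ node_class t a = r.
  pose w := nth (0, 0)%N
    [:: (1, 5); (0, 5); (0, 0); (0, 4); (0, 3); (3, 3); (3, 4); (0, 1)]%N r.
  exists (inord w.1), (inord w.2); rewrite /node_shift /node_class {}/w.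
  have [w1 w2] : (forall k, (k < 4)%N -> val (inord k : 'I_4) = k) /\
      (forall k, (k < 6)%N -> val (inord k : 'I_6) = k) by split=> k; exact: inordK.
  by case: r => -[|[|[|[|[|[|[|[|//]]]]]]]] r8; split; try apply/val_inj;
    rewrite /tri_node_table -?[nat_of_ord (inord _)]/(val _) ?w1 ?w2.
by exists t, a; rewrite /tri_node eshift eclass /= !shift0.
Qed.

Lemma torus_pos_interior_nodes n (Q : torus_node n) :
  (0 < Q.1.1)%N -> (0 < Q.1.2)%N -> torus_pos Q \in interior_nodes R n.
Proof.
move=> Q1 Q2; have lt1 := ltn_ord Q.1.1; have lt2 := ltn_ord Q.1.2.
have n0 : (0 < n)%N by lia.
have pint : interior_pt (torus_pos Q : R * R).
  by rewrite interior_node_pos//; have [] := node_offset_lt Q.2; lia.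
have [t [a taQ]] := torus_node_tri_node Q.
rewrite mem_undup mem_filter pint; apply/flatten_mapP.
exists (cell_tri n Q.1.1 Q.1.2 t); first exact: cell_tri_mesh.
have := interior_cell_tri_node Q.1 t a pint; rewrite taQ eqxx => /eqP ->.
by rewrite mem_nth//; case: (cell_tri _ _ _ _) => -[? ?] ?.
Qed.

(** The compression forgets only the O(n) boundary nodes among the
    8 n^2 nodes of the torus. *)
Lemma l1_node_incidence n :
  l1 (((node_incidence n)^T *m node_incidence n) - 1%:M) <= 16 * n%:R.
Proof.
pose bd (Q : torus_node n) := (Q.1.1 == 0%N :> nat) || (Q.1.2 == 0%N :> nat).
set p := nth (0, 0) (interior_nodes R n).
have entry k l : `|(((node_incidence n)^T *m node_incidence n) - 1%:M) k l| <=
    ((l == k) && bd (enum_val k))%:R.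
  rewrite !mxE (eq_sym k l); have [->|lk] := eqVneq l k; last first.
    rewrite subr0 big1 ?normr0// => i _; rewrite !mxE -/(p i).
    case: eqP => [->|_]; last by rewrite mul0r.
    by rewrite (inj_eq (@torus_pos_inj R n)) (inj_eq enum_val_inj) eq_sym (negbTE lk) mulr0.
  have [Qin|Qout] := boolP (torus_pos (enum_val k) \in interior_nodes R n); last first.
    rewrite big1 ?sub0r ?normrN ?normr1.
      rewrite /= ler1n lt0b; apply: contraNT Qout; rewrite negb_or => /andP[Q1 Q2].
      by apply: torus_pos_interior_nodes; rewrite lt0n.
    move=> i _; rewrite !mxE; case: eqP => [pQ|_]; last by rewrite mul0r.
    by move: Qout; rewrite -pQ mem_nth.
  have lt_i : (index (torus_pos (enum_val k)) (interior_nodes R n) < dofs R n)%N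
    by rewrite index_mem.
  rewrite (bigD1 (Ordinal lt_i))//= !mxE nth_index// eqxx mul1r big1 ?addr0.
    by rewrite subrr normr0.
  move=> i ii; rewrite !mxE; case: eqP => [pQ|_]; last by rewrite mul0r.
  case/eqP: ii; apply/val_inj => /=; rewrite -pQ index_uniq ?undup_uniq//.
have sum0 : \sum_(i < n) (i == 0%N :> nat)%:R <= 1 :> R.
  case: n {bd p entry} => [|n]; first by rewrite big_ord0.
  by rewrite big_ord_recl big1 ?addr0.
apply: (@le_trans _ _ (\sum_(Q : torus_node n) (bd Q)%:R)).
  rewrite [leRHS](reindex_onto enum_val enum_rank) => [|Q _]; last exact: enum_rankK.
  apply: (@le_trans _ _ (\sum_k \sum_l ((l == k) && bd (enum_val k))%:R)).
    by apply: ler_sum => k _; apply: ler_sum => l _; exact: entry.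
  under [leRHS]eq_bigl do rewrite enum_valK eqxx.
  apply: ler_sum => k _; rewrite (bigD1 k)//= eqxx big1 ?addr0// => l lk.
  by rewrite (negbTE lk).
apply: (@le_trans _ _ (\sum_(Q : torus_node n)
    ((Q.1.1 == 0%N :> nat)%:R + (Q.1.2 == 0%N :> nat)%:R))).
  by apply: ler_sum => Q _; rewrite /bd; do 2 case: eqP => _; rewrite -natrD ler_nat.
have sum8 (F : cell_index n -> R) :
    \sum_(Q : torus_node n) F Q.1 = (\sum_i \sum_j F (i, j)) *+ 8.
  rewrite -(pair_bigA _ (fun c (r : 'I_8) => F c))/=.
  under eq_bigr do rewrite sumr_const card_ord.
  by rewrite sumrMnl pair_bigA/=; congr (_ *+ _); apply: eq_bigr => -[].
rewrite big_split/= (sum8 (fun c => (c.1 == 0%N :> nat)%:R)).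
rewrite (sum8 (fun c => (c.2 == 0%N :> nat)%:R))/=.
under eq_bigr do rewrite sumr_const card_ord.
rewrite sumr_const card_ord sumrMnl -mulrnDl.
have n0 : 0 <= n%:R :> R by [].
move: sum0; set x := \sum_(i < n) _ => x1.
rewrite -mulrnDl -mulrnA -(mulr_natr (x + x)) natrM.
by move: (n%:R) n0 => m m0; nra.
Qed.

End Compression.

(** * The symbol and the Fourier modes of the torus *)

Section Exponential.
Context {R : realType}.
Implicit Types t u : R.

Lemma expiD t u : expi (t + u) = expi t * expi u.
Proof. by rewrite /expi cosD sinD; simpc; congr (_ +i* _); rewrite addrC. Qed.

Lemma expi0 : expi (0 : R) = 1.
Proof. by rewrite /expi cos0 sin0. Qed.

Lemma expi_neq0 t : expi t != 0.
Proof.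
apply/eqP => t0; have /eqP := expiD t (- t).
by rewrite subrr expi0 t0 mul0r oner_eq0.
Qed.

Lemma expiN t : expi (- t) = (expi t)^-1.
Proof.
by apply: (mulIf (expi_neq0 t)); rewrite -expiD addNr expi0 mulVf ?expi_neq0.
Qed.

Lemma conj_expi t : (expi t)^* = (expi t)^-1.
Proof. by rewrite -expiN /expi cosN sinN. Qed.

Lemma norm_expi t : `|expi t| = 1.
Proof. by rewrite normc_def /expi/= cos2Dsin2 sqrtr1. Qed.

Lemma expi_natl (k : nat) t : expi (k%:R * t) = expi t ^+ k.
Proof.
elim: k => [|k IHk]; first by rewrite mul0r expi0 expr0.
by rewrite exprS -IHk -expiD -(natr1 k) mulrDl mul1r addrC.
Qed.

Lemma expi2pi : expi (2 * pi : R) = 1.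
Proof. by rewrite /expi mulr_natl cos2pi sin2pi. Qed.

End Exponential.

Section Symbol.
Context {R : realType}.

(** [Ghat] attaches the midpoint of the upper left half-diagonal (class 5) to the
    cell above the one that contains it. *)
Definition symbol_shift (r : nat) : nat := (r == 5).

Definition node_phase (e1 e2 : R[i]) (t a : nat) : R[i] :=
  e1 ^+ (tri_node_table t a).2.1 *
  e2 ^+ ((tri_node_table t a).2.2 + symbol_shift (tri_node_table t a).1).

(** An explicit list, so that the sums below can be filtered by computation. *)
Definition elem_triples : seq (nat * nat * nat) :=
  [seq (ta, b) | ta <- [seq (t, a) | t <- iota 0 4, a <- iota 0 6], b <- iota 0 6].

(** Verified on each of the 64 entries. *)
Lemma Ghat_elem_triples (t1 t2 : R) (r r' : 'I_8) :
  Ghat t1 t2 r r' =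
  \sum_(y <- elem_triples | ((tri_node_table y.1.1 y.1.2).1 == r) &&
                            ((tri_node_table y.1.1 y.2).1 == r'))
     elem_stiffness _ y.1.2 y.2 *
     (node_phase (expi t1) (expi t2) y.1.1 y.1.2)^-1 *
     node_phase (expi t1) (expi t2) y.1.1 y.2.
Proof.
rewrite -big_filter.
have E1 := expi_neq0 t1; have E2 := expi_neq0 t2.
rewrite /Ghat mxE !opprD !expiD !expiN /h3.
have -> : (6^-1 * (1 + expi t1) * (1 + expi t2))^* =
   6^-1 * (1 + (expi t1)^-1) * (1 + (expi t2)^-1) :> R[i].
  by rewrite !rmorphM !rmorphD !rmorph1 fmorphV rmorph_nat /= !conj_expi.
move: (expi t1) (expi t2) E1 E2 => e1 e2 E1 E2.
case: r => -[|[|[|[|[|[|[|[|//]]]]]]]] r8;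
case: r' => -[|[|[|[|[|[|[|[|//]]]]]]]] r'8;
match goal with |- context [seq.filter ?a ?l] =>
  let v := eval vm_compute in (seq.filter a l) in change (seq.filter a l) with v end;
rewrite ?big_cons big_nil /node_phase /symbol_shift /elem_stiffness /=;
first [by []|by field; rewrite ?E1 ?E2].
Qed.

Notation elem_index := ('I_4 * 'I_6 * 'I_6)%type.

(** The symbol is assembled from the element matrix just as the stiffness matrix
    is, with Bloch phases in place of positions. *)
Lemma Ghat_assemble (t1 t2 : R) (r r' : 'I_8) :
  Ghat t1 t2 r r' =
  \sum_(y : elem_index) elem_stiffness _ y.1.2 y.2 *
     (node_phase (expi t1) (expi t2) y.1.1 y.1.2)^-1 *
     node_phase (expi t1) (expi t2) y.1.1 y.2 *
     ((r == node_class y.1.1 y.1.2) && (r' == node_class y.1.1 y.2))%:R.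
Proof.
rewrite Ghat_elem_triples big_mkcond big_elem_index /elem_triples.
have iotaE m : iota 0 m = index_iota 0 m by rewrite /index_iota subn0.
rewrite !big_allpairs_dep !iotaE big_mkord.
apply: eq_bigr => t _; rewrite big_mkord; apply: eq_bigr => a _.
rewrite big_mkord; apply: eq_bigr => b _ /=.
have clsE (c : 'I_6) (q : 'I_8) :
    ((tri_node_table t c).1 == q) = (q == node_class t c).
  rewrite eq_sym -val_eqE /= modn_small//.
  by case: t c => -[|[|[|[|//]]]] t4 -[[|[|[|[|[|[|//]]]]]] c6].
by rewrite !clsE; case: ifP => _; rewrite ?mulr1 ?mulr0.
Qed.

Lemma rmorph_elem_stiffness (a b : 'I_6) :
  (elem_stiffness R a b)%:C = elem_stiffness R[i] a b.
Proof.
case: a => -[|[|[|[|[|[|//]]]]]] a6; case: b => -[|[|[|[|[|[|//]]]]]] b6;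
by rewrite /elem_stiffness /= ?rmorphN ?fmorph_div ?rmorph_nat ?rmorph0 ?rmorph1.
Qed.

Lemma norm_node_phase (t1 t2 : R) t a : `|node_phase (expi t1) (expi t2) t a| = 1.
Proof. by rewrite normrM !normrX !norm_expi !expr1n mulr1. Qed.

Lemma node_phase_neq0 (t1 t2 : R) t a : node_phase (expi t1) (expi t2) t a != 0.
Proof. by rewrite -normr_eq0 norm_node_phase oner_eq0. Qed.

Lemma conj_node_phase (t1 t2 : R) t a : (node_phase (expi t1) (expi t2) t a)^* =
  (node_phase (expi t1) (expi t2) t a)^-1.
Proof.
by rewrite /node_phase rmorphM !rmorphXn /= !conj_expi invfM !exprVn.
Qed.

Lemma Ghat_hermitian (t1 t2 : R) (r r' : 'I_8) :
  Ghat t1 t2 r r' = (Ghat t1 t2 r' r)^*.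
Proof.
rewrite !Ghat_assemble !big_elem_index rmorph_sum; apply: eq_bigr => t _.
rewrite exchange_big rmorph_sum; apply: eq_bigr => a _.
rewrite rmorph_sum; apply: eq_bigr => b _ /=.
rewrite rmorphM [X in _ = X * _]rmorphM [X in _ = X * _ * _]rmorphM /=.
rewrite rmorph_nat fmorphV /= !conj_node_phase invrK andbC.
rewrite -(rmorph_elem_stiffness a b) -(rmorph_elem_stiffness b a).
rewrite elem_stiffness_sym [X in _ = X * _ * _ * _]conjc_real.
by congr (_ * _); rewrite mulrAC.
Qed.

Lemma rowsum_Ghat (t1 t2 : R) : rowsum_le (elem_mass (R := R))%:C (Ghat t1 t2).
Proof.
move=> r.
apply: (@le_trans _ _ (\sum_r' \sum_(y : elem_index)
    `|elem_stiffness R y.1.2 y.2|%:C * (r' == node_class y.1.1 y.2)%:R)).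
  apply: ler_sum => r' _; rewrite Ghat_assemble.
  apply: (le_trans (ler_norm_sum _ _ _)); apply: ler_sum => y _.
  rewrite normrM [X in X * _ <= _]normrM [X in X * _ * _ <= _]normrM.
  rewrite normfV !norm_node_phase invr1 !mulr1 -rmorph_elem_stiffness.
  rewrite normr_nat normc_def /= expr0n/= addr0 sqrtr_sqr.
  rewrite ler_wpM2l ?ler0c// ler_nat; by case: (_ == _); case: (_ == _).
rewrite exchange_big/= /elem_mass rmorph_sum; apply: ler_sum => y _.
rewrite -mulr_sumr (bigD1 (node_class y.1.1 y.2))//= eqxx big1 ?addr0 ?mulr1//.
by move=> r' /negbTE ->.
Qed.

End Symbol.

Section FourierModes.
Context {R : realType}.

(** The frequencies are centred, so that the grid fills [-pi, pi] and not
    [0, 2 pi]. *)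
Definition frequency (n : nat) (j : 'I_n) : R :=
  2 * pi * (j%:R - (n./2)%:R) / n%:R.

Lemma expi_2pi_nat (k : nat) : expi (2 * pi * k%:R : R) = 1.
Proof. by rewrite mulrC expi_natl expi2pi expr1n. Qed.

Lemma expi_frequency_root n (j : 'I_n) : expi (frequency j) ^+ n = 1.
Proof.
have n0 : (0 < n)%N by exact: leq_ltn_trans (leq0n j) (ltn_ord j).
rewrite -expi_natl /frequency mulrCA divff ?pnatr_eq0 -?lt0n// mulr1 mulrBr.
by rewrite expiD expiN !expi_2pi_nat invr1 mulr1.
Qed.

Lemma expi_primitive n m : (0 < m < n)%N -> expi (2 * pi / n%:R : R) ^+ m != 1.
Proof.
move=> /andP[m0 mn]; rewrite -expi_natl.
have n0' : (0 < n)%N by exact: ltn_trans mn.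
have n0 : (0 : R) < n%:R by rewrite ltr0n.
set y := pi * m%:R / n%:R : R.
have -> : m%:R * (2 * pi / n%:R) = y *+ 2 by rewrite /y -mulr_natr; ring.
have y_gt0 : 0 < sin y.
  apply: sin_gt0_pi; rewrite /y !mulr_gt0 ?invr_gt0 ?pi_gt0 ?ltr0n//=.
  by rewrite ltr_pdivrMr// ltr_pM2l ?pi_gt0// ltr_nat.
apply/eqP => /(congr1 (@complex.Re R)); rewrite /expi /= cos_mulr2n => cos1.
have := cos2Dsin2 y; have : 0 < sin y ^+ 2 by rewrite exprn_gt0.
move: cos1; rewrite -mulr_natr; lra.
Qed.

Lemma sum_frequency n (a b : 'I_n) :
  \sum_(j < n) expi (frequency j) ^+ a * (expi (frequency j) ^+ b)^-1 =
  (n * (a == b))%:R.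
Proof.
have n0 : (0 < n)%N by exact: leq_ltn_trans (leq0n a) (ltn_ord a).
have [->|ab] := eqVneq a b.
  under eq_bigr do rewrite divff ?expf_neq0 ?expi_neq0//.
  by rewrite sumr_const card_ord muln1.
pose z : R[i] := expi (2 * pi / n%:R).
have z0 : z != 0 by exact: expi_neq0.
pose x := z ^+ a / z ^+ b.
have x1 : x != 1.
  rewrite /x; have : (a < b)%N || (b < a)%N by rewrite -neq_ltn.
  case/orP => lt_ab.
    rewrite -(subnK (ltnW lt_ab)) exprD invfM mulrCA divff ?expf_neq0// mulr1.
    rewrite invr_eq1; apply: expi_primitive; have := ltn_ord b; lia.
  rewrite -(subnK (ltnW lt_ab)) exprD -mulrA divff ?expf_neq0// mulr1.
  by apply: expi_primitive; have := ltn_ord a; lia.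
have xn : x ^+ n = 1.
  have zn : z ^+ n = 1.
    by rewrite -expi_natl mulrCA divff ?pnatr_eq0 -?lt0n// mulr1 expi2pi.
  by rewrite /x expr_div_n -!exprM ![(_ * n)%N]mulnC !exprM zn !expr1n divr1.
pose w : R[i] := expi (- (2 * pi * (n./2)%:R / n%:R)).
have omegaE (j : 'I_n) : expi (frequency j) = z ^+ j * w.
  rewrite -expi_natl -expiD /frequency; congr expi; field.
  by rewrite pnatr_eq0 -lt0n.
have termE (j : 'I_n) : expi (frequency j) ^+ a * (expi (frequency j) ^+ b)^-1 =
    (w ^+ a / w ^+ b) * x ^+ j.
  have -> : x ^+ j = (z ^+ j) ^+ a / (z ^+ j) ^+ b.
    by rewrite /x expr_div_n -!exprM (mulnC a) (mulnC b).
  by rewrite omegaE 2!exprMn invfM mulrACA mulrC.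
rewrite (eq_bigr _ (fun j _ => termE j)) -mulr_sumr muln0.
have := subrX1 x n; rewrite xn subrr => /esym/eqP.
rewrite mulf_eq0 subr_eq0 (negbTE x1)/= => /eqP ->; rewrite mulr0//.
Qed.

Notation torus_mx n := 'M[R[i]]_(#|{: torus_node n}|).

Definition bloch_phase n (j : cell_index n) (Q : torus_node n) : R[i] :=
  expi (frequency j.1) ^+ Q.1.1 *
  expi (frequency j.2) ^+ (Q.1.2 + symbol_shift Q.2).

(** The [r]-th column is the plane wave of frequency [j] carried by the nodes of
    class [r]. *)
Definition bloch_mode n (j : cell_index n) : 'M[R[i]]_(#|{: torus_node n}|, 8) :=
  \matrix_(k, r) (bloch_phase j (enum_val k) * ((enum_val k).2 == r)%:R).

Definition bloch_dual n (j : cell_index n) : 'M[R[i]]_(8, #|{: torus_node n}|) :=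
  \matrix_(r, k) ((bloch_phase j (enum_val k))^-1 * ((enum_val k).2 == r)%:R).

Definition flat_stiffness n : 'M[R]_(#|{: torus_node n}|) :=
  assemble (fun=> fun=> 1).

Lemma bloch_phase_neq0 n j (Q : torus_node n) : bloch_phase j Q != 0.
Proof. by rewrite mulf_neq0// expf_neq0// expi_neq0. Qed.

Lemma bloch_phase_tri_node n (j : cell_index n) c t a :
  bloch_phase j (tri_node c t a) =
  expi (frequency j.1) ^+ c.1 * expi (frequency j.2) ^+ c.2 *
  node_phase (expi (frequency j.1)) (expi (frequency j.2)) t a.
Proof.
have shiftE : symbol_shift (node_class t a) = symbol_shift (tri_node_table t a).1.
  by case: t => -[|[|[|[|//]]]] t4; case: a => -[|[|[|[|[|[|//]]]]]] a6.
rewrite /bloch_phase /node_phase shiftE /= !exprD.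
rewrite !expr_mod ?expi_frequency_root// !exprD /node_shift.
by rewrite -!mulrA; congr (_ * _); rewrite mulrCA.
Qed.

Lemma sum_tri_node n (P : torus_node n) t a (F : cell_index n -> R[i]) (x : R[i]) :
  (forall c, P = tri_node c t a -> F c = x) ->
  \sum_c (P == tri_node c t a)%:R * F c = (P.2 == node_class t a)%:R * x.
Proof.
move=> Fx; have [Pa|Pa] := eqVneq P.2 (node_class t a); last first.
  rewrite mul0r big1// => c _; case: eqP => [PE|_]; last by rewrite mul0r.
  by move: Pa; rewrite PE eqxx.
have surj i e : exists i' : 'I_n, cyclic_shift i' e = i.
  by have [g _ gK] := injF_bij (@cyclic_shift_inj n e); exists (g i).
have [c1 c1P] := surj P.1.1 (node_shift t a).1.
have [c2 c2P] := surj P.1.2 (node_shift t a).2.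
have PE : P = tri_node (c1, c2) t a.
  by rewrite /tri_node /= c1P c2P -Pa; case: (P) => -[].
rewrite (bigD1 (c1, c2))//= big1 ?addr0.
  by rewrite -PE eqxx !mul1r (Fx _ PE).
move=> c cc; rewrite PE (inj_eq (@tri_node_inj n t a)) eq_sym (negbTE cc).
by rewrite mul0r.
Qed.

(** Bloch waves block-diagonalise the translation-invariant stiffness matrix,
    and the blocks are the values of the symbol. *)
Lemma flat_stiffness_bloch n (j : cell_index n) :
  map_mx (real_complex R) (flat_stiffness n) *m bloch_mode j =
  bloch_mode j *m Ghat (frequency j.1) (frequency j.2).
Proof.
apply/matrixP => k r; set P := enum_val k.
transitivity (bloch_phase j P * Ghat (frequency j.1) (frequency j.2) P.2 r); last first.
  rewrite [RHS]mxE (bigD1 P.2)//= big1 ?addr0 => [|r' r'P].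
    by rewrite [bloch_mode _ _ _]mxE -/P eqxx mulr1.
  by rewrite [bloch_mode _ _ _]mxE -/P eq_sym (negbTE r'P) mulr0 mul0r.
rewrite Ghat_assemble mulr_sumr /flat_stiffness /assemble exchange_big/=.
rewrite map_mx_sum mulmx_suml summxE; apply: eq_bigr => y _.
rewrite map_mx_sum mulmx_suml summxE.
transitivity (\sum_c (P == tri_node c y.1.1 y.1.2)%:R *
    (elem_stiffness R[i] y.1.2 y.2 * bloch_phase j (tri_node c y.1.1 y.2) *
     (r == node_class y.1.1 y.2)%:R)).
  apply: eq_bigr => c _; rewrite map_mxZ map_delta_mx -scalemxAl mxE mul1r.
  rewrite -[delta_mx _ _]mul1mx mul_delta_mx_mul !mxE enum_rankK.
  rewrite -(inj_eq enum_val_inj) enum_rankK -/P /= rmorph_elem_stiffness.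
  by rewrite (eq_sym (node_class _ _) r); ring.
rewrite (@sum_tri_node _ _ _ _ _ (elem_stiffness R[i] y.1.2 y.2 *
    (bloch_phase j P / node_phase (expi (frequency j.1)) (expi (frequency j.2)) y.1.1 y.1.2 *
     node_phase (expi (frequency j.1)) (expi (frequency j.2)) y.1.1 y.2) *
     (r == node_class y.1.1 y.2)%:R)).
  by rewrite -mulnb natrM; ring.
move=> c ->; rewrite !bloch_phase_tri_node.
by rewrite mulfK ?node_phase_neq0.
Qed.

(** Completeness of the plane waves. *)
Lemma sum_bloch_mode n :
  \sum_(j : cell_index n) bloch_mode j *m bloch_dual j = (n%:R ^+ 2)%:M.
Proof.
apply/matrixP => k l; rewrite summxE mxE.
set P := enum_val k; set Q := enum_val l.
have entry (j : cell_index n) : (bloch_mode j *m bloch_dual j) k l =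
    (P.2 == Q.2)%:R *
    ((expi (frequency j.1) ^+ P.1.1 * (expi (frequency j.1) ^+ Q.1.1)^-1) *
     (expi (frequency j.2) ^+ P.1.2 * (expi (frequency j.2) ^+ Q.1.2)^-1)).
  rewrite mxE (bigD1 P.2)//= big1 ?addr0 => [|r rP]; last first.
    by rewrite mxE -/P eq_sym (negbTE rP) mulr0 mul0r.
  rewrite !mxE -/P -/Q eqxx mulr1 (eq_sym Q.2).
  have [PQ|_] := eqVneq P.2 Q.2; last by rewrite !(mulr0, mul0r).
  rewrite mul1r mulr1 /bloch_phase PQ !exprD.
  have x1 := expf_neq0 Q.1.1 (expi_neq0 (frequency j.1)).
  have x2 := expf_neq0 Q.1.2 (expi_neq0 (frequency j.2)).
  have x3 := expf_neq0 (symbol_shift Q.2) (expi_neq0 (frequency j.2)).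
  move: (_ ^+ Q.1.1) (_ ^+ Q.1.2) (_ ^+ symbol_shift _) x1 x2 x3 => y1 y2 y3 *.
  by rewrite !invfM mulrACA [X in _ * X]mulrACA divff// mulr1.
rewrite (eq_bigr _ (fun j _ => entry j)) -mulr_sumr.
rewrite -(pair_bigA _ (fun j1 j2 =>
  (expi (frequency j1) ^+ P.1.1 * (expi (frequency j1) ^+ Q.1.1)^-1) *
  (expi (frequency j2) ^+ P.1.2 * (expi (frequency j2) ^+ Q.1.2)^-1)))/=.
rewrite -big_distrlr/= !sum_frequency -!natrM -[RHS]mulr_natr -natrX -natrM.
congr _%:R; rewrite -(inj_eq enum_val_inj) -/P -/Q.
by case: (P) (Q) => [[p1 p2] r] [[q1 q2] r'] /=; rewrite !xpair_eqE;
  case: eqP => _; case: eqP => _; case: eqP => _ /=; lia.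
Qed.

(** The phases cancel: a diagonal matrix that is constant on cells has the same mean
    in every plane wave. *)
Lemma bloch_dual_diag n (j : cell_index n) (d : cell_index n -> R) :
  bloch_dual j *m map_mx (real_complex R) (node_diag (fun Q => d Q.1)) *m bloch_mode j =
  (\sum_c d c)%:C%:M.
Proof.
apply/matrixP => r r'; rewrite /node_diag map_diag_mx mul_mx_diag !mxE.
transitivity (\sum_(Q : torus_node n) (d Q.1)%:C * ((Q.2 == r) && (Q.2 == r'))%:R).
  rewrite [RHS](reindex_onto enum_val enum_rank) => [|Q _]; last exact: enum_rankK.
  under [RHS]eq_bigl do rewrite enum_valK eqxx.
  apply: eq_bigr => k _; rewrite !mxE -mulnb natrM.
  have := bloch_phase_neq0 j (enum_val k); move: (bloch_phase _ _) => z z0.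
  by field.
rewrite -(pair_bigA _ (fun c q => (d c)%:C * ((q == r) && (q == r'))%:R))/=.
rewrite rmorph_sum -sumrMnl; apply: eq_bigr => c _.
rewrite (bigD1 r)//= eqxx big1 ?addr0 ?mulr_natr//.
by move=> q /negbTE ->; rewrite mulr0.
Qed.

Lemma node_diagX n (d : torus_node n -> R) k :
  node_diag d ^+ k = node_diag (fun Q => d Q ^+ k).
Proof.
elim: k => [|k IHk].
  rewrite mxexp0 /node_diag -diag_const_mx; congr diag_mx.
  by apply/rowP => i; rewrite !mxE expr0.
rewrite mxexpS IHk /node_diag mulmx_diag; congr diag_mx.
by apply/rowP => i; rewrite !mxE exprS.
Qed.

(** Inserting the resolution of the identity by plane waves turns [flat_stiffness]
    into a power of the symbol, and the diagonal factor into a mean that does not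
    depend on the frequency; hence the product. *)
Lemma trace_diag_flat n (d : cell_index n -> R) k :
  n%:R ^+ 2 * (\tr (node_diag (fun Q => d Q.1) ^+ k *m flat_stiffness n ^+ k))%:C =
  (\sum_c d c ^+ k)%:C *
  \sum_(j : cell_index n) \tr (Ghat (frequency j.1) (frequency j.2) ^+ k).
Proof.
pose rc := real_complex R; pose C := map_mx rc (flat_stiffness n).
pose D := map_mx rc (node_diag (fun Q => d Q.1 ^+ k)).
have CkW j : C ^+ k *m bloch_mode j =
    bloch_mode j *m Ghat (frequency j.1) (frequency j.2) ^+ k.
  elim: k {D} => [|k IHk]; first by rewrite !mxexp0 mul1mx mulmx1.
  rewrite mxexpSr -mulmxA flat_stiffness_bloch mulmxA IHk -mulmxA.
  by rewrite -mxexpSr.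
have -> : (\tr (node_diag (fun Q => d Q.1) ^+ k *m flat_stiffness n ^+ k))%:C =
    \tr (D *m C ^+ k).
  rewrite -trace_map_mx map_mxM node_diagX; congr (\tr (_ *m _)).
  elim: k {D CkW} => [|k IHk]; first by rewrite !mxexp0 map_mx1.
  by rewrite !mxexpS map_mxM IHk.
have -> : n%:R ^+ 2 * \tr (D *m C ^+ k) =
    \tr (D *m C ^+ k *m \sum_(j : cell_index n) bloch_mode j *m bloch_dual j).
  by rewrite sum_bloch_mode mul_mx_scalar mxtraceZ.
rewrite mulmx_sumr raddf_sum mulr_sumr; apply: eq_bigr => j _.
rewrite /= mulmxA -(mulmxA D) CkW mxtrace_mulC !mulmxA (@bloch_dual_diag n j (fun c => d c ^+ k)).
by rewrite mul_scalar_mx mxtraceZ.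
Qed.

End FourierModes.

(** * Integrals of non-Borel functions and of step functions *)

Lemma measureU_null d (T : measurableType d) (R : realType)
    (mu : {measure set T -> \bar R}) (A B : set T) :
  measurable A -> measurable B -> mu A = 0%E -> mu B = 0%E -> mu (A `|` B) = 0%E.
Proof. by move=> mA mB A0 B0; rewrite measureU0. Qed.

Section NullSets.
Context d (T : measurableType d) (R : realType) (mu : {measure set T -> \bar R}).
Import HBNNSimple.
Local Open Scope ereal_scope.

(** The integral is a supremum over Borel simple functions, hence it makes sense
    for arbitrary functions and does not see Borel null sets. *)
Lemma ge0_integral_null_sub (D D' N : set T) (f : T -> \bar R) :
  measurable D' -> measurable N -> mu N = 0 -> D' `<=` D -> D `<=` D' `|` N ->
  (forall x, D x -> 0 <= f x) ->
  \int[mu]_(x in D) f x = \int[mu]_(x in D') f x.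
Proof.
move=> mD' mN N0 D'D DD'N f0.
have f0' x : D' x -> 0 <= f x by move/D'D/f0.
apply/eqP; rewrite eq_le !ge0_integralE//; apply/andP; split; last first.
  apply: le_ereal_sup => _ [h /= hf <-]; exists h => //= x.
  apply: (le_trans (hf x)); rewrite !patchE; case: ifPn => [|_].
    by rewrite inE => /D'D xD; rewrite mem_set.
  by case: ifPn => //; rewrite inE => /f0.
apply: ge_ereal_sup => _ [h /= hf <-].
have [h' h'E] : exists h' : {nnsfun T >-> R}, forall x, h' x = (h x * \1_D' x)%R.
  by exists (mul_nnsfun h (indic_nnsfun R mD')).
have hh' x : ~ N x -> h x = h' x.
  move=> xN; rewrite h'E indicE.
  have [xD'|xD'] := boolP (x \in D'); first by rewrite mulr1.
  rewrite mulr0; apply/eqP; rewrite eq_le fun_ge0 andbT -lee_fin.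
  apply: (le_trans (hf x)); rewrite patchE; case: ifPn => //.
  rewrite inE => /DD'N[] // /mem_set; by rewrite (negbTE xD').
have -> : sintegral mu h = sintegral mu h'.
  rewrite -!integralT_nnsfun.
  rewrite (ge0_negligible_integral mN)//; last 2 first.
  - exact/measurable_EFinP.
  - by move=> x _; rewrite lee_fin.
  rewrite [RHS](ge0_negligible_integral mN)//; last 2 first.
  - exact/measurable_EFinP.
  - by move=> x _; rewrite lee_fin.
  by apply: eq_integral => x; rewrite inE => -[_ xN]; rewrite hh'.
apply: ereal_sup_ubound; exists h' => //= x.
rewrite h'E patchE indicE; case: ifPn => [|_]; last by rewrite mulr0.
rewrite inE mulr1 => xD'; apply: (le_trans (hf x)).
by rewrite patchE mem_set//; exact: D'D.
Qed.

Lemma integral_null_sub (D D' N : set T) (f : T -> \bar R) :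
  measurable D' -> measurable N -> mu N = 0 -> D' `<=` D -> D `<=` D' `|` N ->
  \int[mu]_(x in D) f x = \int[mu]_(x in D') f x.
Proof.
move=> mD' mN N0 D'D DD'N; rewrite integralE [RHS]integralE.
by congr (_ - _); apply: (ge0_integral_null_sub mD' mN N0 D'D DD'N).
Qed.

End NullSets.

Section StepFunctions.
Context d (T : measurableType d) (R : realType) (mu : {measure set T -> \bar R}).
Context (I : finType) (A : I -> set T) (c : I -> R).
Hypothesis mA : forall i, measurable (A i).

Definition step_fun (x : T) : R := \sum_i c i * \1_(A i) x.

Lemma measurable_step_fun (D : set T) : measurable_fun D step_fun.
Proof.
apply: measurable_funTS; rewrite /step_fun.
by apply: measurable_sum => i; apply: measurable_funM => //; exact: measurable_indic.
Qed.

Lemma step_funE x i : A i x -> (forall j, A j x -> j = i) -> step_fun x = c i.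
Proof.
move=> xi uniq; rewrite /step_fun (bigD1 i)//= indicE mem_set// mulr1.
rewrite big1 ?addr0// => j ji; rewrite indicE memNset ?mulr0// => /uniq ji'.
by rewrite ji' eqxx in ji.
Qed.

Lemma step_fun_le (M : R) x : 0 <= M -> (forall i, `|c i| <= M) ->
  (forall i j, A i x -> A j x -> i = j) -> `|step_fun x| <= M.
Proof.
move=> M0 cM uniq; have [[i xi]|none] := pselect (exists i, A i x).
  by rewrite (step_funE xi)// => j xj; exact: uniq.
rewrite /step_fun big1 ?normr0// => i _; rewrite indicE memNset ?mulr0//.
by move=> xi; apply: none; exists i.
Qed.

Lemma step_fun_out x : (forall i, ~ A i x) -> step_fun x = 0.
Proof.
by move=> none; rewrite /step_fun big1// => i _; rewrite indicE memNset ?mulr0.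
Qed.

Lemma integral_step_fun (D : set T) : measurable D -> (mu D < +oo)%E ->
  (\int[mu]_(x in D) (step_fun x)%:E = \sum_i (c i)%:E * mu (A i `&` D))%E.
Proof.
move=> mD finD; rewrite /step_fun; under eq_integral do rewrite -sumEFin.
have int_indic i : mu.-integrable D (EFin \o \1_(A i)).
  apply: measurable_bounded_integrable => //.
  exists 1%R; split => // M M1 x _ /=; rewrite indicE ger0_norm ?ler0n//.
  by apply: (le_trans _ (ltW M1)); case: (x \in A i); rewrite ?lexx ?ler01.
rewrite integral_sum//; last first.
  by move=> i; under eq_fun do rewrite EFinM; exact: (integrableZl mD (c i) (int_indic i)).
apply: eq_bigr => i _; under eq_integral do rewrite EFinM.
rewrite (integralZl mD (int_indic i)); congr (_ * _)%E; exact: integral_indic.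
Qed.

End StepFunctions.

(** * Riemann sums over the product of the mesh and the frequency grid *)

Section GridSlots.
Context {R : realType}.
Variables (lo L : R).
Hypothesis L_gt0 : 0 < L.

Definition grid_slot (n i : nat) : set R :=
  `[lo + L * i%:R / n%:R, lo + L * i.+1%:R / n%:R[%classic.

Lemma grid_slotP n i x : (0 < n)%N ->
  grid_slot n i x <-> i%:R <= n%:R * ((x - lo) / L) < i.+1%:R.
Proof.
move=> n0; have n0' : (0 : R) < n%:R by rewrite ltr0n.
rewrite /grid_slot /= in_itv/= -!lerBrDl -!ltrBlDl.
rewrite ler_pdivrMr// ltr_pdivlMr// mulrA ler_pdivlMr// ltr_pdivrMr//.
by rewrite ![_ * L]mulrC ![_ * n%:R]mulrC.
Qed.

Lemma grid_slot_ex n x : (0 < n)%N -> lo <= x < lo + L ->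
  exists i : 'I_n, grid_slot n i x.
Proof.
move=> n0 /andP[lox xL]; pose y := n%:R * ((x - lo) / L).
have n0' : (0 : R) < n%:R by rewrite ltr0n.
have y0 : 0 <= y by rewrite mulr_ge0// divr_ge0// ?subr_ge0// ltW.
have yn : y < n%:R.
  by rewrite /y gtr_pMr// ltr_pdivrMr// mul1r ltrBlDl.
have lt_n : (Num.truncn y < n)%N.
  by rewrite -(ltr_nat R) (le_lt_trans _ yn)// truncn_le.
exists (Ordinal lt_n); apply/(grid_slotP _ _ n0) => /=.
by rewrite -/y truncn_itv.
Qed.

Lemma grid_slot_uniq n i j x : (0 < n)%N ->
  grid_slot n i x -> grid_slot n j x -> i = j.
Proof.
move=> n0 /(grid_slotP _ _ n0)/andP[i1 i2] /(grid_slotP _ _ n0)/andP[j1 j2].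
have := le_lt_trans i1 j2; have := le_lt_trans j1 i2.
by rewrite !ltr_nat !ltnS => ji ij; apply/eqP; rewrite eqn_leq ij ji.
Qed.

Lemma grid_slot_sub n i : (i < n)%N -> grid_slot n i `<=` `[lo, lo + L[.
Proof.
move=> lt_in x; have n0 : (0 < n)%N by exact: leq_ltn_trans lt_in.
have n0' : (0 : R) < n%:R by rewrite ltr0n.
rewrite /grid_slot /= !in_itv/= => /andP[h1 h2]; apply/andP; split.
  by apply: le_trans h1; rewrite lerDl !mulr_ge0 ?invr_ge0 ?ler0n// ltW.
apply: (lt_le_trans h2); rewrite lerD2l -mulrA ger_pMr// ler_pdivrMr// mul1r.
by rewrite ler_nat.
Qed.

Lemma grid_slot_dist n i x : grid_slot n i x ->
  `|x - (lo + L * i%:R / n%:R)| <= L / n%:R.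
Proof.
rewrite /grid_slot /= in_itv/= -(natr1 i) mulrDr mulr1 mulrDl addrA => /andP[h1 h2].
by rewrite ger0_norm ?subr_ge0// lerBlDl; exact: ltW.
Qed.

Lemma lebesgue_grid_slot n i : (0 < n)%N ->
  lebesgue_measure (grid_slot n i) = (L / n%:R)%:E.
Proof.
move=> n0; rewrite /grid_slot lebesgue_measure_itv/= lte_fin ltrD2l.
rewrite ltr_pM2r ?invr_gt0 ?ltr0n// ltr_pM2l// ltr_nat ltnSn -EFinD.
by congr EFin; rewrite -(natr1 i); field; rewrite pnatr_eq0 -lt0n.
Qed.

Lemma measurable_grid_slot n i :
  measurable (grid_slot n i : set (measurableTypeR R)).
Proof. exact: measurable_itv. Qed.

End GridSlots.

Section RiemannSums.
Context {R : realType}.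
Local Notation plane := (measurableTypeR R * measurableTypeR R)%type.

Let pi2_gt0 : 0 < 2 * pi :> R. Proof. by rewrite mulr_gt0// pi_gt0. Qed.

Definition grid_box n (q : cell_index n * cell_index n) : set ((R * R) * (R * R)) :=
  (grid_slot 0 1 n q.1.1 `*` grid_slot 0 1 n q.1.2) `*`
  (grid_slot (- pi) (2 * pi) n q.2.1 `*` grid_slot (- pi) (2 * pi) n q.2.2).

Definition half_open_domain : set ((R * R) * (R * R)) :=
  (`[0, 1[ `*` `[0, 1[) `*` (`[- pi, pi[ `*` `[- pi, pi[).

(** The domain of the symbol without its upper faces and without the exceptional
    set [N] of the first two variables. *)
Definition good_domain (N : set (R * R)) : set ((R * R) * (R * R)) :=
  half_open_domain `\` (N `*` setT).

Lemma leb2_prod (A B : set (measurableTypeR R)) : measurable A -> measurable B ->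
  leb2 (A `*` B) = (lebesgue_measure A * lebesgue_measure B)%E.
Proof. exact: product_measure1E. Qed.

Lemma leb4_prod (A B : set plane) : measurable A -> measurable B ->
  leb4 (A `*` B) = (leb2 A * leb2 B)%E.
Proof. exact: product_measure1E. Qed.

Lemma measurable_grid_box n (q : cell_index n * cell_index n) :
  measurable (grid_box q : set (plane * plane)).
Proof. by apply: measurableX; apply: measurableX; exact: measurable_grid_slot. Qed.

Lemma leb4_grid_box n (q : cell_index n * cell_index n) :
  leb4 (grid_box q) = ((2 * pi) ^+ 2 / n%:R ^+ 4)%:E.
Proof.
have n0 : (0 < n)%N by exact: leq_ltn_trans (leq0n q.1.1) (ltn_ord q.1.1).
rewrite leb4_prod; try by apply: measurableX; exact: measurable_grid_slot.
rewrite !leb2_prod; try exact: measurable_grid_slot.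
rewrite !lebesgue_grid_slot// -!EFinM; congr EFin; field.
by rewrite pnatr_eq0 -lt0n.
Qed.

Lemma half_open_box n t : (0 < n)%N -> half_open_domain t ->
  exists q : cell_index n * cell_index n, grid_box q t.
Proof.
move=> n0; rewrite /half_open_domain /= !in_itv/= => -[[t1 t2] [t3 t4]].
have [i1 h1] := @grid_slot_ex _ 0 1 ltr01 n t.1.1 n0 ltac:(by rewrite add0r).
have [i2 h2] := @grid_slot_ex _ 0 1 ltr01 n t.1.2 n0 ltac:(by rewrite add0r).
have piE : - pi + 2 * pi = pi :> R by ring.
have [i3 h3] := @grid_slot_ex _ (- pi) (2 * pi) pi2_gt0 n t.2.1 n0 ltac:(by rewrite piE).
have [i4 h4] := @grid_slot_ex _ (- pi) (2 * pi) pi2_gt0 n t.2.2 n0 ltac:(by rewrite piE).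
by exists ((i1, i2), (i3, i4)).
Qed.

Lemma grid_box_uniq n (q q' : cell_index n * cell_index n) t :
  grid_box q t -> grid_box q' t -> q = q'.
Proof.
have n0 : (0 < n)%N by exact: leq_ltn_trans (leq0n q.1.1) (ltn_ord q.1.1).
case: q q' => -[q1 q2] [q3 q4] [[q1' q2'] [q3' q4']] [[/= a1 a2] [/= a3 a4]] [[/= b1 b2] [/= b3 b4]].
congr ((_, _), (_, _)); apply/val_inj.
- exact: (grid_slot_uniq ltr01 n0 a1 b1).
- exact: (grid_slot_uniq ltr01 n0 a2 b2).
- exact: (grid_slot_uniq pi2_gt0 n0 a3 b3).
- exact: (grid_slot_uniq pi2_gt0 n0 a4 b4).
Qed.

Lemma grid_box_sub n (q : cell_index n * cell_index n) : grid_box q `<=` half_open_domain.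
Proof.
move=> t [[/= a1 a2] [/= a3 a4]]; split; split => /=.
- by have := grid_slot_sub ltr01 (ltn_ord q.1.1) a1; rewrite add0r.
- by have := grid_slot_sub ltr01 (ltn_ord q.1.2) a2; rewrite add0r.
- have := grid_slot_sub pi2_gt0 (ltn_ord q.2.1) a3.
  by rewrite (_ : - pi + 2 * pi = pi)//; ring.
- have := grid_slot_sub pi2_gt0 (ltn_ord q.2.2) a4.
  by rewrite (_ : - pi + 2 * pi = pi)//; ring.
Qed.

Lemma measurable_half_open : measurable (half_open_domain : set (plane * plane)).
Proof. by apply: measurableX; apply: measurableX; exact: measurable_itv. Qed.

Lemma measurable_good_domain (N : set plane) : measurable N ->
  measurable (good_domain N : set (plane * plane)).
Proof.
move=> mN; apply: measurableD; first exact: measurable_half_open.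
by apply: measurableX.
Qed.

Lemma leb4_half_open_lty : (leb4 half_open_domain < +oo)%E.
Proof.
rewrite leb4_prod; try by apply: measurableX; exact: measurable_itv.
rewrite !leb2_prod; try exact: measurable_itv.
rewrite !lebesgue_measure_itv/= !lte_fin ltr01.
have -> : - pi < pi :> R by rewrite gtrN ?pi_gt0.
by rewrite -!EFinD -!EFinM ltry.
Qed.

Lemma leb4_cylinder0 (N : set plane) : measurable N -> leb2 N = 0 ->
  leb4 (N `*` setT) = 0.
Proof. by move=> mN N0; rewrite leb4_prod// N0 mul0e. Qed.

Lemma good_domain_sub (N : set plane) : good_domain N `<=` symbol_domain.
Proof.
move=> t [[/= [t1 t2] [t3 t4]] _]; move: t1 t2 t3 t4.
rewrite /symbol_domain /unit_square /= !in_itv/=.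
by move=> /andP[-> /ltW->] /andP[-> /ltW->] /andP[-> /ltW->] /andP[-> /ltW->].
Qed.

Lemma symbol_domain_cover (N : set plane) : measurable N -> leb2 N = 0 ->
  exists Z : set (plane * plane),
    [/\ measurable Z, leb4 Z = 0 & symbol_domain `<=` good_domain N `|` Z].
Proof.
move=> mN N0.
pose edge (x : R) : set plane := [set x] `*` setT `|` setT `*` [set x].
have medge x : measurable (edge x) by apply: measurableU; apply: measurableX.
have edge0 x : leb2 (edge x) = 0.
  have null1 : leb2 ([set x] `*` setT) = 0 by rewrite leb2_prod// lebesgue_measure_set1 mul0e.
  have null2 : leb2 (setT `*` [set x]) = 0 by rewrite leb2_prod// lebesgue_measure_set1 mule0.
  by apply: measureU_null => //; exact: measurableX.
have m1 : measurable (N `*` setT : set (plane * plane)) by exact: measurableX.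
have m2 : measurable (edge 1 `*` setT : set (plane * plane)) by exact: measurableX.
have m3 : measurable (setT `*` edge pi : set (plane * plane)) by exact: measurableX.
have null1 := leb4_cylinder0 mN N0; have null2 := leb4_cylinder0 (medge 1) (edge0 1).
have null3 : leb4 (setT `*` edge pi) = 0 by rewrite leb4_prod// edge0 mule0.
have m12 := measurableU _ _ m1 m2.
exists ((N `*` setT `|` edge 1 `*` setT) `|` setT `*` edge pi); split.
- exact: measurableU.
- exact: (@measureU_null _ _ _ leb4 _ _ m12 m3
    (@measureU_null _ _ _ leb4 _ _ m1 m2 null1 null2) null3).
- move=> t; rewrite /symbol_domain /unit_square /= !in_itv/=.
  move=> [[/andP[a1 b1] /andP[a2 b2]] [/andP[a3 b3] /andP[a4 b4]]].
  have [Nt|Nt] := pselect (N t.1); first by right; left; left.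
  move: b1; rewrite le_eqVlt => /predU1P[e1|b1]; first by right; left; right; split => //; left.
  move: b2; rewrite le_eqVlt => /predU1P[e2|b2]; first by right; left; right; split => //; right.
  move: b3; rewrite le_eqVlt => /predU1P[e3|b3]; first by right; right; split => //; left.
  move: b4; rewrite le_eqVlt => /predU1P[e4|b4]; first by right; right; split => //; right.
  left; split; last by case.
  by rewrite /half_open_domain /= !in_itv/= a1 a2 a3 a4 b1 b2 b3 b4.
Qed.

Lemma integral_symbol_domain (N : set plane) (f : (R * R) * (R * R) -> \bar R) :
  measurable N -> leb2 N = 0 ->
  (\int[leb4]_(t in symbol_domain) f t = \int[leb4]_(t in good_domain N) f t)%E.
Proof.
move=> mN N0; have [Z [mZ Z0 ZP]] := symbol_domain_cover mN N0.
exact: (@integral_null_sub _ _ _ leb4 _ _ _ f (measurable_good_domain mN) mZ Z0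
  (@good_domain_sub N) ZP).
Qed.

(** Dominated convergence for the step functions that take the value [v n q] on the
    box [q].  The samples [v n q] need not be values of [g], and the measurability of
    [g] is a conclusion. *)
Theorem riemann_sum_cvg (N : set plane)
    (v : forall n, cell_index n * cell_index n -> R) (M : R)
    (g : (R * R) * (R * R) -> R) :
  measurable N -> leb2 N = 0 -> 0 <= M -> (forall n q, `|v n q| <= M) ->
  (forall t (q : forall n, cell_index n.+1 * cell_index n.+1), good_domain N t ->
     (forall n, grid_box (q n) t) -> (fun n => v n.+1 (q n)) @ \oo --> g t) ->
  measurable_fun (good_domain N : set (plane * plane)) (g : plane * plane -> R) /\
  (fun n => n%:R ^- 4 * \sum_q v n q) @ \oo -->
    ((4 * pi ^+ 2)^-1 * \int[leb4]_(t in symbol_domain) g t : R).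
Proof.
move=> mN N0 M0 vM vg.
have mG := measurable_good_domain mN.
pose F n : plane * plane -> R := step_fun (@grid_box n) (v n).
have mF n (D : set (plane * plane)) : measurable_fun D (F n).
  by apply: measurable_step_fun => q; exact: measurable_grid_box.
have cvgF t : good_domain N t -> (fun n => F n t) @ \oo --> g t.
  move=> Gt.
  have ex_q n : exists q : cell_index n.+1 * cell_index n.+1, grid_box q t.
    exact: half_open_box (ltn0Sn n) Gt.1.
  pose q n := sval (cid (ex_q n)); have qt n : grid_box (q n) t := svalP (cid (ex_q n)).
  have qF n : F n.+1 t = v n.+1 (q n).
    by rewrite /F (step_funE _ (qt n))// => q' q't; exact: grid_box_uniq q't (qt n).
  rewrite -(cvg_shiftS (fun n => F n t)).
  by under eq_fun do rewrite qF; exact: vg.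
have FM n t : `|F n t| <= M.
  by apply: step_fun_le => // q q'; exact: grid_box_uniq.
have cvgFE t : good_domain N t -> (EFin \o F n) t @[n --> \oo] --> (EFin \o g) t.
  by move=> Gt; apply: cvg_EFin; [exact: nearW|exact: cvgF].
have mg : measurable_fun (good_domain N : set (plane * plane)) (EFin \o g).
  apply: (emeasurable_fun_cvg (fun n => EFin \o F n)).
    by move=> n; apply/measurable_EFinP; exact: mF.
  exact: cvgFE.
split; first exact/measurable_EFinP.
have fG : (leb4 (good_domain N) < +oo)%E.
  apply: le_lt_trans leb4_half_open_lty; apply: le_measure; rewrite ?inE//.
    exact: measurable_half_open.
  by move=> t [].
have iM : leb4.-integrable (good_domain N) (EFin \o cst M).
  apply: measurable_bounded_integrable => //.
  by exists M; split; rewrite ?num_real// => x /ltW Mx t _ /=; rewrite ger0_norm.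
have mFE n : measurable_fun (good_domain N : set (plane * plane)) (EFin \o F n).
  by apply/measurable_EFinP; exact: mF.
have [||ig _ cvgI] := @dominated_convergence _ _ _ leb4 _ mG
    (fun n => EFin \o F n) (EFin \o g) (EFin \o cst M) mFE mg _ iM _.
- by apply: aeW; exact: cvgFE.
- by apply: aeW => t n _; rewrite /= lee_fin; exact: FM.
have intF n : (\int[leb4]_(t in good_domain N) (F n t)%:E =
    ((2 * pi) ^+ 2 * (n%:R ^- 4 * \sum_q v n q))%:E)%E.
  rewrite -(@integral_null_sub _ _ _ leb4 half_open_domain _ (N `*` setT)) => //; last 4 first.
  - exact: measurableX.
  - exact: leb4_cylinder0.
  - by move=> t [].
  - by move=> t Dt; have [|] := pselect (N t.1); [right|left; split=> // -[]].
  have IS := @integral_step_fun _ _ _ leb4 _ (@grid_box n) (v n)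
    (@measurable_grid_box n) half_open_domain measurable_half_open leb4_half_open_lty.
  rewrite /F IS.
  rewrite mulrA mulr_sumr -sumEFin; apply: eq_bigr => q _.
  rewrite setIidl; last exact: grid_box_sub.
  have := leb4_grid_box q; rewrite -[leb4 _]/(Measure.sort leb4 _) => ->.
  by rewrite -EFinM mulrC.
rewrite /Rintegral (integral_symbol_domain _ mN N0).
have finI : (\int[leb4]_(t in good_domain N) (g t)%:E)%E \is a fin_num.
  exact: integrable_fin_num.
have : (fun n => (2 * pi) ^+ 2 * (n%:R ^- 4 * \sum_q v n q)) @ \oo -->
    fine (\int[leb4]_(t in good_domain N) (g t)%:E)%E.
  have -> : (fun n => (2 * pi) ^+ 2 * (n%:R ^- 4 * \sum_q v n q)) =
      fine \o (fun n => \int[leb4]_(t in good_domain N) (F n t)%:E)%E.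
    by apply/funext => n /=; rewrite intF.
  by apply: fine_cvg; rewrite fineK.
move=> /(cvgMl_tmp (a := (4 * pi ^+ 2)^-1)).
rewrite (_ : (fun n => (4 * pi ^+ 2)^-1 * ((2 * pi) ^+ 2 * _)) =
             (fun n => n%:R ^- 4 * \sum_q v n q))//.
apply/funext => n; rewrite mulrA (_ : (4 * pi ^+ 2)^-1 * (2 * pi) ^+ 2 = 1) ?mul1r//.
by have := pi_gt0 R; move: (pi : R) => p p0; field; rewrite gt_eqF.
Qed.

End RiemannSums.

(** * Riemann-integrable functions are continuous almost everywhere *)

Section Partitions.
Context {R : realType}.
Implicit Types (s t : seq R) (x : R).

Lemma knot_size s : itv_partition 0 1 s -> knot s (size s) = 1.
Proof. exact: itv_partition_nth_size. Qed.

Lemma knot_ge0 s i : itv_partition 0 1 s -> (i <= size s)%N -> 0 <= knot s i.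
Proof. by move=> sP si; apply: itv_partition_nth_ge. Qed.

Lemma knot_le1 s i : itv_partition 0 1 s -> (i <= size s)%N -> knot s i <= 1.
Proof. by move=> sP si; apply: itv_partition_nth_le. Qed.

Lemma knot_lt s i j : itv_partition 0 1 s -> (i < j <= size s)%N ->
  knot s i < knot s j.
Proof.
move=> [sP _] /andP[ij js]; rewrite /knot.
have /lt_sorted_ltn_nth -> // : sorted <%O (0 :: s) by [].
by rewrite inE /= ltnS (leq_trans (ltnW ij)).
Qed.

Lemma knot_le s i j : itv_partition 0 1 s -> (i <= j <= size s)%N ->
  knot s i <= knot s j.
Proof.
move=> sP /andP[]; rewrite leq_eqVlt => /predU1P[-> //|ij js].
by apply/ltW/knot_lt => //; rewrite ij.
Qed.

Lemma knot_locate s x : itv_partition 0 1 s -> 0 <= x <= 1 ->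
  (forall i, (i <= size s)%N -> x != knot s i) ->
  exists i : 'I_(size s), knot s i < x < knot s i.+1.
Proof.
move=> sP /andP[x0 x1] xs.
pose P i := (i <= size s)%N && (knot s i < x).
have P0 : exists i, P i.
  by exists 0%N; rewrite /P /= lt_neqAle eq_sym xs.
have Pb i : P i -> (i <= size s)%N by case/andP.
have [i /andP[is_ ix] imax] := ex_maxnP P0 Pb.
have lt_is : (i < size s)%N.
  rewrite ltn_neqAle is_ andbT; apply/eqP => ie.
  by move: ix; rewrite ie knot_size// ltNge x1.
exists (Ordinal lt_is) => /=; rewrite ix /= ltNge; apply/negP.
rewrite le_eqVlt => /predU1P[e|lt_x]; first by move: (xs i.+1 lt_is); rewrite e eqxx.
by have := imax i.+1; rewrite /P lt_x andbT ltnn => /(_ lt_is).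
Qed.

Lemma knot_disjoint s (i j : 'I_(size s)) x : itv_partition 0 1 s ->
  knot s i < x < knot s i.+1 -> knot s j < x < knot s j.+1 -> i = j.
Proof.
move=> sP /andP[i1 i2] /andP[j1 j2]; apply/val_inj/eqP.
rewrite eqn_leq; apply/andP; split; rewrite leqNgt; apply/negP => lt_.
  have := knot_le (i := j.+1) (j := i) sP; rewrite lt_ (ltnW (ltn_ord i)) => /(_ isT).
  by rewrite leNgt (lt_trans i1 j2).
have := knot_le (i := i.+1) (j := j) sP; rewrite lt_ (ltnW (ltn_ord j)) => /(_ isT).
by rewrite leNgt (lt_trans j1 i2).
Qed.

Lemma sum_cell_area s t : itv_partition 0 1 s -> itv_partition 0 1 t ->
  \sum_(i < size s) \sum_(j < size t) cell_area s t i j = 1.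
Proof.
move=> sP tP.
have tele (u : seq R) : itv_partition 0 1 u -> \sum_(i < size u) (knot u i.+1 - knot u i) = 1.
  move=> uP; rewrite -(big_mkord xpredT (fun i => knot u i.+1 - knot u i)).
  by rewrite (telescope_sumr (knot u))// knot_size// /knot/= subr0.
rewrite /cell_area; under eq_bigr do rewrite -mulr_sumr tele// mulr1.
exact: tele.
Qed.

Lemma cell_area_ge0 s t (i : 'I_(size s)) (j : 'I_(size t)) :
  itv_partition 0 1 s -> itv_partition 0 1 t -> 0 <= cell_area s t i j.
Proof.
by move=> sP tP; rewrite mulr_ge0// subr_ge0 knot_le// leqnSn /=; exact: ltn_ord.
Qed.

End Partitions.

Section StepMajorants.
Context {R : realType}.
Local Notation plane := (measurableTypeR R * measurableTypeR R)%type.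
Variables (s t : seq R).
Hypotheses (sP : itv_partition 0 1 s) (tP : itv_partition 0 1 t).

Definition open_cell (ij : 'I_(size s) * 'I_(size t)) : set (R * R) :=
  `]knot s ij.1, knot s ij.1.+1[ `*` `]knot t ij.2, knot t ij.2.+1[.

Definition grid_lines : set (R * R) :=
  [set p | (exists2 i, (i <= size s)%N & p.1 = knot s i) \/
           (exists2 j, (j <= size t)%N & p.2 = knot t j)].

Lemma open_cell_uniq ij kl p : open_cell ij p -> open_cell kl p -> ij = kl.
Proof.
case: ij kl => [i j] [k l] [/=]; rewrite !in_itv/= => i1 j1 [/=].
rewrite !in_itv/= => k1 l1.
by rewrite (knot_disjoint sP i1 k1) (knot_disjoint tP j1 l1).
Qed.

Lemma open_cell_sub ij : open_cell ij `<=` unit_square.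
Proof.
move=> p [/=]; rewrite !in_itv/= => /andP[a b] /andP[c d].
have i1 := ltn_ord ij.1; have i2 := ltn_ord ij.2.
rewrite /unit_square /= !in_itv/=; split; apply/andP; split.
- exact: le_trans (knot_ge0 sP (ltnW i1)) (ltW a).
- exact: le_trans (ltW b) (knot_le1 sP i1).
- exact: le_trans (knot_ge0 tP (ltnW i2)) (ltW c).
- exact: le_trans (ltW d) (knot_le1 tP i2).
Qed.

Lemma open_cell_ex p : unit_square p -> ~ grid_lines p -> exists ij, open_cell ij p.
Proof.
rewrite /unit_square /= !in_itv/= => -[p1 p2] pl.
have [i iP] := knot_locate sP p1 (fun i si => introN eqP (fun e =>
  pl (or_introl (ex_intro2 _ _ i si e)))).
have [j jP] := knot_locate tP p2 (fun i si => introN eqP (fun e =>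
  pl (or_intror (ex_intro2 _ _ i si e)))).
by exists (i, j); split; rewrite /= in_itv.
Qed.

Lemma measurable_open_cell ij : measurable (open_cell ij : set plane).
Proof. by apply: measurableX; exact: measurable_itv. Qed.

Lemma leb2_open_cell ij : leb2 (open_cell ij) = (cell_area s t ij.1 ij.2)%:E.
Proof.
rewrite leb2_setX !lebesgue_measure_itv/= !lte_fin.
rewrite !knot_lt ?ltnSn ?ltn_ord//= -!EFinD -EFinM//.
Qed.

Lemma grid_lines_null : measurable (grid_lines : set plane) /\ leb2 grid_lines = 0.
Proof.
pose A (u : seq R) : set (measurableTypeR R) := [set x | exists2 i, (i <= size u)%N & x = knot u i].
have AE u : A u = [set` [seq knot u i | i <- iota 0 (size u).+1]].
  apply/seteqP; split=> x /=.
    move=> [i iu ->].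
    suff : knot u i \in [seq knot u i | i <- iota 0 (size u).+1] by [].
    by apply: map_f; rewrite mem_iota.
  move=> h; have {h} : x \in [seq knot u i | i <- iota 0 (size u).+1] by [].
  by case/mapP => i; rewrite mem_iota => /andP[_ iu] ->; exists i.
have finA u : finite_set (A u) by rewrite AE; exact: finite_seq.
have mA u : measurable (A u) by apply: countable_measurable; [move=> x; exact: measurable_set1|exact/finite_set_countable/finA].
have A0 u : lebesgue_measure (A u) = 0.
  by apply: countable_lebesgue_measure0; exact/finite_set_countable/finA.
have -> : grid_lines = (A s `*` setT) `|` (setT `*` A t).
  by apply/seteqP; split=> p /=; [case=> h; [left|right]|case=> -[? ?]; [left|right]].
have null1 : leb2 (A s `*` setT) = 0 by rewrite leb2_prod// A0 mul0e.
have null2 : leb2 (setT `*` A t) = 0 by rewrite leb2_prod// A0 mule0.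
split; first by apply: measurableU; exact: measurableX.
by apply: measureU_null => //; exact: measurableX.
Qed.

Lemma leb2_unit_square : leb2 (unit_square : set (R * R)) = 1%:E.
Proof.
rewrite /unit_square leb2_setX !lebesgue_measure_itv/= lte_fin ltr01.
by rewrite -!EFinD -EFinM subr0 mulr1.
Qed.

Lemma measurable_unit_square : measurable (unit_square : set plane).
Proof. by apply: measurableX; exact: measurable_itv. Qed.

(** The extra constant makes the step function a bound on the grid lines too. *)
Definition step_bound (c : 'I_(size s) * 'I_(size t) -> R) (B : R) (p : R * R) : R :=
  B + step_fun open_cell (fun ij => c ij - B) p.

Lemma step_boundE c B ij p : open_cell ij p -> step_bound c B p = c ij.
Proof.
move=> pij; have uniq kl : open_cell kl p -> kl = ij.
  by move=> pkl; exact: open_cell_uniq pkl pij.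
by rewrite /step_bound (step_funE _ pij uniq) addrC subrK.
Qed.

Lemma step_bound_out c B p : (forall ij, ~ open_cell ij p) -> step_bound c B p = B.
Proof. by move=> none; rewrite /step_bound step_fun_out ?addr0. Qed.

Lemma measurable_step_bound c B :
  measurable_fun setT (step_bound c B : plane -> R).
Proof.
apply: measurable_funD => //; apply: measurable_step_fun.
exact: measurable_open_cell.
Qed.

Lemma integrable_step_bound c B :
  leb2.-integrable unit_square (EFin \o step_bound c B).
Proof.
have finS : (leb2 (unit_square : set (R * R)) < +oo)%E by rewrite leb2_unit_square ltry.
apply: (measurable_bounded_integrable measurable_unit_square finS).
  by apply: measurable_funTS; exact: measurable_step_bound.
exists (`|B| + \sum_ij `|c ij - B|); split; rewrite ?num_real// => x /ltW Bx p _ /=.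
apply: le_trans Bx; rewrite /step_bound (le_trans (ler_normD _ _))// lerD2l.
apply: step_fun_le.
- exact: sumr_ge0.
- by move=> ij; rewrite (bigD1 ij)//= lerDl sumr_ge0.
- by move=> ij kl; exact: open_cell_uniq.
Qed.

Lemma integral_step_bound c B :
  (\int[leb2]_(p in unit_square) (step_bound c B p)%:E)%E =
  (\sum_(i < size s) \sum_(j < size t) cell_area s t i j * c (i, j))%:E.
Proof.
rewrite /step_bound; under eq_integral do rewrite EFinD.
have mS := measurable_unit_square.
have finS : (leb2 (unit_square : set (R * R)) < +oo)%E by rewrite leb2_unit_square ltry.
have iB : leb2.-integrable unit_square (EFin \o cst B).
  apply: measurable_bounded_integrable => //.
  by exists `|B|; split; rewrite ?num_real// => x /ltW Bx p _.
have istep : leb2.-integrable unit_square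
    (EFin \o step_fun open_cell (fun ij => c ij - B)).
  apply: measurable_bounded_integrable => //.
    by apply: measurable_step_fun; exact: measurable_open_cell.
  exists (\sum_ij `|c ij - B|); split; rewrite ?num_real// => x /ltW Bx p _ /=.
  apply: le_trans Bx; apply: step_fun_le.
  - exact: sumr_ge0.
  - by move=> ij; rewrite (bigD1 ij)//= lerDl sumr_ge0.
  - by move=> ij kl; exact: open_cell_uniq.
rewrite (integralD mS iB istep).
have -> : (\int[leb2]_(p in unit_square) (EFin \o cst B) p = B%:E)%E.
  transitivity (\int[leb2]_(p in unit_square) (cst B%:E) p)%E; first by [].
  rewrite (@integral_cst _ _ _ leb2 _ mS).
  by have := leb2_unit_square; rewrite -[leb2 _]/(Measure.sort leb2 _) => ->; rewrite mule1.
rewrite (@integral_step_fun _ _ _ leb2 _ open_cell _ measurable_open_cell _ mS finS).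
have -> : (\sum_i (c i - B)%:E * leb2 (open_cell i `&` unit_square) =
    (\sum_(ij : 'I_(size s) * 'I_(size t)) (c ij - B) * cell_area s t ij.1 ij.2)%:E)%E.
  rewrite -sumEFin; apply: eq_bigr => ij _; rewrite setIidl; last exact: open_cell_sub.
  by rewrite EFinM; congr (_ * _)%E; exact: leb2_open_cell.
rewrite -EFinD; congr EFin.
have -> : \sum_ij (c ij - B) * cell_area s t ij.1 ij.2 =
    \sum_i \sum_j (c (i, j) - B) * cell_area s t i j.
  by rewrite pair_bigA/=; apply: eq_bigr => -[].
rewrite -{1}(mulr1 B) -(sum_cell_area sP tP) mulr_sumr -big_split/=.
apply: eq_bigr => i _; rewrite mulr_sumr -big_split/=; apply: eq_bigr => j _.
by ring.
Qed.

End StepMajorants.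

Section AlmostEverywhereContinuity.
Context {R : realType}.
Local Notation plane := (measurableTypeR R * measurableTypeR R)%type.
Variables (f : R * R -> R) (M : R).
Hypothesis fM : forall p, unit_square p -> `|f p| <= M.

Lemma cell_sub (s t : seq R) i j : itv_partition 0 1 s -> itv_partition 0 1 t ->
  (i < size s)%N -> (j < size t)%N -> cell s t i j `<=` unit_square.
Proof.
move=> sP tP si tj p [/=]; rewrite !in_itv/= => /andP[a b] /andP[c d].
rewrite /unit_square /= !in_itv/=; split; apply/andP; split.
- exact: le_trans (knot_ge0 sP (ltnW si)) a.
- exact: le_trans b (knot_le1 sP si).
- exact: le_trans (knot_ge0 tP (ltnW tj)) c.
- exact: le_trans d (knot_le1 tP tj).
Qed.

Lemma cell_bounds (s t : seq R) i j : itv_partition 0 1 s -> itv_partition 0 1 t ->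
  (i < size s)%N -> (j < size t)%N ->
  [/\ - M <= sup (f @` cell s t i j), inf (f @` cell s t i j) <= M &
      forall p, cell s t i j p ->
        inf (f @` cell s t i j) <= f p <= sup (f @` cell s t i j)].
Proof.
move=> sP tP si tj; have sub := cell_sub sP tP si tj.
have [hs hi] : has_ubound (f @` cell s t i j) /\ has_lbound (f @` cell s t i j).
  by split; [exists M|exists (- M)] => _ [p /sub/fM] + <-; rewrite ler_norml => /andP[].
pose q := (knot s i, knot t j).
have cq : cell s t i j q.
  by split; rewrite /= in_itv/= lexx/= knot_le// leqnSn.
have bnd p : cell s t i j p ->
    inf (f @` cell s t i j) <= f p <= sup (f @` cell s t i j).
  move=> cp; apply/andP; split; first by apply: ge_inf => //; exists p.
  by apply: ub_le_sup => //; exists p.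
have /andP[q1 q2] := bnd q cq; have := fM (sub q cq); rewrite ler_norml => /andP[q3 q4].
by split=> //; [exact: le_trans q3 q2|exact: le_trans q1 q4].
Qed.

Lemma darboux_gap (e : R) : lower_integral f = upper_integral f -> 0 < e ->
  exists s t s' t',
    [/\ itv_partition 0 1 s, itv_partition 0 1 t, itv_partition 0 1 s',
        itv_partition 0 1 t' & upper_sum f s t - lower_sum f s' t' < e].
Proof.
move=> lu e0; have e2 : 0 < e / 2 by rewrite divr_gt0.
have part1 : itv_partition 0 1 [:: (1 : R)] by apply: itv_partition1.
have hasU : has_inf [set I | exists s t, [/\ itv_partition 0 1 s,
    itv_partition 0 1 t & I = upper_sum f s t]].
  split; first by exists (upper_sum f [:: 1] [:: 1]), [:: 1], [:: 1].
  exists (- M) => _ [s [t [sP tP ->]]].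
  rewrite -[leLHS]mul1r -(sum_cell_area sP tP) mulr_suml.
  apply: ler_sum => i _; rewrite mulr_suml; apply: ler_sum => j _.
  by rewrite ler_wpM2l ?cell_area_ge0//; have [] := cell_bounds sP tP (ltn_ord i) (ltn_ord j).
have hasL : has_sup [set I | exists s t, [/\ itv_partition 0 1 s,
    itv_partition 0 1 t & I = lower_sum f s t]].
  split; first by exists (lower_sum f [:: 1] [:: 1]), [:: 1], [:: 1].
  exists M => _ [s [t [sP tP ->]]].
  rewrite -[leRHS]mul1r -(sum_cell_area sP tP) mulr_suml.
  apply: ler_sum => i _; rewrite mulr_suml; apply: ler_sum => j _.
  by rewrite ler_wpM2l ?cell_area_ge0//; have [] := cell_bounds sP tP (ltn_ord i) (ltn_ord j).
have [_ [s [t [sP tP ->]]] ltU] := inf_adherent e2 hasU.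
have [_ [s' [t' [s'P t'P ->]]] ltL] := sup_adherent e2 hasL.
exists s, t, s', t'; split => //.
move: ltU ltL; rewrite -/(upper_integral f) -/(lower_integral f) lu.
rewrite (splitr e); lra.
Qed.

Definition small_oscillation (p : R * R) (eta : R) : Prop :=
  exists2 d, 0 < d & forall q, unit_square q ->
    `|q.1 - p.1| < d -> `|q.2 - p.2| < d -> `|f q - f p| < eta.

Lemma open_cell_ball (s t : seq R) ij p : open_cell (s := s) (t := t) ij p ->
  exists2 d : R, 0 < d & forall q, `|q.1 - p.1| < d -> `|q.2 - p.2| < d ->
    cell s t ij.1 ij.2 q.
Proof.
move=> [/=]; rewrite !in_itv/= => /andP[a b] /andP[c d].
pose m := Num.min (Num.min (p.1 - knot s ij.1) (knot s ij.1.+1 - p.1))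
                  (Num.min (p.2 - knot t ij.2) (knot t ij.2.+1 - p.2)).
exists m; first by rewrite /m !lt_min !subr_gt0 a b c d.
move=> q; rewrite /m !lt_min => /andP[/andP[q1 q2] _] /andP[_ /andP[q3 q4]].
move: q1 q2 q3 q4; rewrite !ltr_norml => /andP[? ?] /andP[? ?] /andP[? ?] /andP[? ?].
by split; rewrite /= in_itv/=; apply/andP; split; lra.
Qed.

(** Upper and lower step functions whose integrals are close differ by at least [eta]
    only on a set of small measure; elsewhere, off the grid lines, they pin the
    function down near the point. *)
Lemma small_bad_set (eta e : R) : lower_integral f = upper_integral f ->
  0 < eta -> 0 < e ->
  exists B : set plane, [/\ measurable B, (leb2 B <= e%:E)%E &
    forall p, unit_square p -> ~ B p -> small_oscillation p eta].
Proof.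
move=> lu eta0 e0.
have [s [t [s' [t' [sP tP s'P t'P gap]]]]] := darboux_gap lu (mulr_gt0 e0 eta0).
pose cu (ij : 'I_(size s) * 'I_(size t)) := sup (f @` cell s t ij.1 ij.2).
pose cl (ij : 'I_(size s') * 'I_(size t')) := inf (f @` cell s' t' ij.1 ij.2).
pose U := step_bound (s := s) (t := t) cu M.
pose L := step_bound (s := s') (t := t') cl (- M).
pose E : set plane := unit_square `&` [set p | eta <= U p - L p].
have open_sub (s0 t0 : seq R) ij p : open_cell (s := s0) (t := t0) ij p -> cell s0 t0 ij.1 ij.2 p.
  move=> [/=]; rewrite !in_itv/= => /andP[/ltW a /ltW b] /andP[/ltW c /ltW d].
  by split; rewrite /= in_itv/= ?a ?b ?c ?d.
have LU p : unit_square p -> L p <= f p <= U p.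
  move=> Sp; have := fM Sp; rewrite ler_norml => /andP[fm fM'].
  apply/andP; split.
    have [[ij pij]|none] := pselect (exists ij, open_cell (s := s') (t := t') ij p).
      rewrite /L (step_boundE s'P t'P _ _ pij).
      by have [_ _ /(_ p (open_sub _ _ _ _ pij))/andP[]] := cell_bounds s'P t'P (ltn_ord ij.1) (ltn_ord ij.2).
    by rewrite /L step_bound_out// => ij pij; apply: none; exists ij.
  have [[ij pij]|none] := pselect (exists ij, open_cell (s := s) (t := t) ij p).
    rewrite /U (step_boundE sP tP _ _ pij).
    by have [_ _ /(_ p (open_sub _ _ _ _ pij))/andP[]] := cell_bounds sP tP (ltn_ord ij.1) (ltn_ord ij.2).
  by rewrite /U step_bound_out// => ij pij; apply: none; exists ij.
have mU : measurable_fun setT (U : plane -> R) by exact: measurable_step_bound.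
have mL : measurable_fun setT (L : plane -> R) by exact: measurable_step_bound.
have mS := @measurable_unit_square R.
have mE : measurable E.
  have mtrue : measurable [set true] by [].
  have := measurable_fun_ler (measurable_cst eta) (measurable_funB mU mL) measurableT mtrue.
  rewrite setTI => mle; apply: measurableI => //.
have finS : (leb2 (unit_square : set (R * R)) < +oo)%E by rewrite leb2_unit_square ltry.
have leE : (leb2 E <= e%:E)%E.
  have int_le : ((\int[leb2]_(p in unit_square) (step_fun (fun _ : unit => E) (fun=> eta) p)%:E)
      <= \int[leb2]_(p in unit_square) (U p - L p)%:E)%E.
    apply: ge0_le_integral => //.
    - move=> p _; rewrite lee_fin /step_fun sumr_ge0// => i _.
      by rewrite mulr_ge0 ?(ltW eta0).
    - by apply/measurable_EFinP; apply: measurable_step_fun.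
    - by apply/measurable_EFinP; apply: measurable_funTS; exact: measurable_funB.
    - move=> p Sp; rewrite lee_fin.
      have [Ep|Ep] := pselect (E p).
        by rewrite (@step_funE _ _ _ _ (fun=> E) (fun=> eta) p tt Ep) => [|[]//]; case: Ep.
      by rewrite step_fun_out// subr_ge0; have /andP[Lf fU] := LU p Sp; exact: le_trans Lf fU.
  rewrite (@integral_step_fun _ _ _ leb2 _ _ _ (fun _ : unit => mE) _ mS finS) in int_le.
  rewrite (eq_bigr (fun _ => eta%:E * leb2 E)%E) in int_le; last first.
    by move=> _ _; rewrite setIidl// => p [].
  have sum1 (x : \bar R) : (\sum_(i : unit) x = x)%E.
    by rewrite (bigD1 tt)//= big1 ?adde0// => -[]; rewrite eqxx.
  rewrite {}sum1 in int_le.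
  have intUL : (\int[leb2]_(p in unit_square) (U p - L p)%:E =
      (upper_sum f s t - lower_sum f s' t')%:E)%E.
    under eq_integral do rewrite EFinB.
    rewrite (integralB mS (integrable_step_bound sP tP _ _) (integrable_step_bound s'P t'P _ _)).
    have := integral_step_bound sP tP cu M; have := integral_step_bound s'P t'P cl (- M).
    by rewrite -/U -/L => -> ->; rewrite -EFinB.
  rewrite intUL in int_le.
  rewrite -(@lee_pmul2l _ eta%:E) ?ltry ?lte_fin//.
  by apply: (le_trans int_le); rewrite -EFinM lee_fin mulrC ltW.
have [mG1 G1] := grid_lines_null s t; have [mG2 G2] := grid_lines_null s' t'.
pose G : set plane := grid_lines s t `|` grid_lines s' t'.
have mG : measurable G by exact: measurableU.
have G0 : leb2 G = 0 by exact: (@measureU_null _ _ _ leb2 _ _ mG1 mG2 G1 G2).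
exists (E `|` G); split; first exact: measurableU.
  by have := @measureU0 _ _ _ leb2 _ _ mE mG G0; rewrite -[leb2 _]/(Measure.sort leb2 _) => ->.
move=> p Sp BP.
have [ij pij] := open_cell_ex sP tP Sp (fun h => BP (or_intror (or_introl h))).
have [kl pkl] := open_cell_ex s'P t'P Sp (fun h => BP (or_intror (or_intror h))).
have ltUL : U p - L p < eta.
  by rewrite ltNge; apply/negP => h; apply: BP; left; split.
rewrite /U /L (step_boundE sP tP _ _ pij) (step_boundE s'P t'P _ _ pkl) in ltUL.
have [d1 d1_gt0 ball1] := open_cell_ball pij.
have [d2 d2_gt0 ball2] := open_cell_ball pkl.
exists (Num.min d1 d2); first by rewrite lt_min d1_gt0.
move=> q Sq; rewrite !lt_min => /andP[a1 a2] /andP[b1 b2].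
have [_ _ bU] := cell_bounds sP tP (ltn_ord ij.1) (ltn_ord ij.2).
have [_ _ bL] := cell_bounds s'P t'P (ltn_ord kl.1) (ltn_ord kl.2).
have /andP[_ qU] := bU q (ball1 q a1 b1); have /andP[qL _] := bL q (ball2 q a2 b2).
have /andP[_ pU] := bU p (open_sub _ _ _ _ pij); have /andP[pL _] := bL p (open_sub _ _ _ _ pkl).
move: ltUL; rewrite /cu /cl => ltUL; rewrite ltr_norml; apply/andP; split; lra.
Qed.

(** Lebesgue's criterion. *)
Theorem riemann_ae_continuous : lower_integral f = upper_integral f ->
  exists N : set plane, [/\ measurable N, leb2 N = 0 &
    forall p, unit_square p -> ~ N p -> forall eta, 0 < eta -> small_oscillation p eta].
Proof.
move=> lu.
have /choice[B BP] : forall km : nat * nat, exists B : set plane,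
    [/\ measurable B, (leb2 B <= (km.2.+1%:R^-1)%:E)%E &
    forall p, unit_square p -> ~ B p -> small_oscillation p (km.1.+1%:R^-1)].
  by move=> km; apply: small_bad_set => //; rewrite invr_gt0.
pose Nk k : set plane := \bigcap_m B (k, m).
have mNk k : measurable (Nk k).
  by apply: bigcapT_measurable => m; have [] := BP (k, m).
have Nk0 k : leb2 (Nk k) = 0.
  apply/eqP; rewrite eq_le measure_ge0 andbT; apply/lee_addgt0Pr => e e0; rewrite add0e.
  have [m me] : exists m : nat, m.+1%:R^-1 < e.
    exists (Num.truncn e^-1); rewrite invf_plt ?posrE//; exact: truncnS_gt.
  have [mB Bm _] := BP (k, m).
  apply: (@le_trans _ _ (leb2 (B (k, m)))).
    by apply: le_measure; rewrite ?inE// => p; apply.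
  by apply: (le_trans Bm); rewrite lee_fin ltW.
exists (\bigcup_k Nk k); split.
- by apply: bigcupT_measurable.
- apply/negligibleP; first exact: bigcupT_measurable.
  by apply: negligible_bigcup => k; apply/negligibleP => //; exact: Nk0.
move=> p Sp Np eta eta0.
have [k keta] : exists k : nat, k.+1%:R^-1 < eta.
  by exists (Num.truncn eta^-1); rewrite invf_plt ?posrE//; exact: truncnS_gt.
have [m Bm] : exists m, ~ B (k, m) p.
  by apply: contrapT => h; apply: Np; exists k => // m _; apply: contrapT => h'; apply: h; exists m.
have [_ _ /(_ p Sp Bm)[d d0 dP]] := BP (k, m).
by exists d => // q Sq q1 q2; apply: lt_trans keta; exact: dP.
Qed.

End AlmostEverywhereContinuity.

(** * Sampling of the viscosity *)

Section Sampling.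
Context {R : realType}.
Local Notation plane := (measurableTypeR R * measurableTypeR R)%type.

Lemma cvg_inv_nat (K : R) : (fun n : nat => K / n%:R) @ \oo --> (0 : R).
Proof.
apply/cvgrPdist_lt => e e0; near=> n.
rewrite sub0r normrN normrM normfV [`|n%:R|]ger0_norm//.
have n0 : (0 : R) < n%:R.
  by rewrite ltr0n; near: n; exists 1%N.
rewrite ltr_pdivrMr// mulrC -ltr_pdivrMr//.
apply: (@lt_le_trans _ _ (Num.truncn (`|K| / e)).+1%:R); first exact: truncnS_gt.
by rewrite ler_nat; near: n; exists (Num.truncn (`|K| / e)).+1.
Unshelve. all: by end_near. Qed.

Lemma cvg_le_inv (u : R^nat) (l K : R) n1 :
  (forall n, (n1 <= n)%N -> `|u n - l| <= K / n.+1%:R) -> u @ \oo --> l.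
Proof.
move=> uK; apply/cvgrPdist_le => e e0.
have : (fun n : nat => K / n.+1%:R) @ \oo --> (0 : R).
  by have := cvg_inv_nat K; rewrite -(cvg_shiftS (fun n => K / n%:R)).
move/cvgrPdist_le => /(_ e e0) [n2 _ n2P].
exists (maxn n1 n2) => // n /=; rewrite geq_max => /andP[n1n n2n].
rewrite distrC (le_trans (uK n n1n))//.
by have := n2P n n2n; rewrite sub0r normrN; apply: le_trans; exact: ler_norm.
Qed.

(** Points attached to the cells of the mesh that converge to every point whose
    cells they are attached to. *)
Definition tracks (P : forall n, cell_index n -> R * R) : Prop :=
  (forall n c, unit_square (P n c)) /\
  forall t (q : forall n, cell_index n.+1 * cell_index n.+1),
    half_open_domain t -> (forall n, grid_box (q n) t) ->
    (fun n => (P n.+1 (q n).1).1) @ \oo --> t.1.1 /\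
    (fun n => (P n.+1 (q n).1).2) @ \oo --> t.1.2.

Definition cell_corner n (c : cell_index n) : R * R := (c.1%:R / n%:R, c.2%:R / n%:R).

Definition cell_barycenter (t : 'I_4) n (c : cell_index n) : R * R :=
  barycenter (cell_tri n c.1 c.2 t).

Definition node_corner (t : 'I_4) (a : 'I_6) n (c : cell_index n) : R * R :=
  cell_corner (tri_node c t a).1.

Lemma cell_corner_in n (c : cell_index n) : unit_square (cell_corner c).
Proof.
have n0 : (0 < n)%N by exact: leq_ltn_trans (leq0n c.1) (ltn_ord c.1).
have n0' : (0 : R) < n%:R by rewrite ltr0n.
rewrite /unit_square /cell_corner /= !in_itv/= !ler_pdivrMr// !mul1r !ler_nat.
by rewrite !divr_ge0 ?ler0n// ?(ltnW (ltn_ord _)).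
Qed.

Lemma tracks_corner : tracks cell_corner.
Proof.
split=> [n c|t q _ qt]; first exact: cell_corner_in.
have near1 (i : forall n, 'I_n.+1) (x : R) : (forall n, grid_slot 0 1 n.+1 (i n) x) ->
    (fun n => (i n)%:R / n.+1%:R) @ \oo --> x.
  move=> ix; apply: (@cvg_le_inv _ _ 1 0) => n _; rewrite distrC.
  by have := grid_slot_dist (ix n); rewrite add0r mul1r.
by split; apply: near1 => n; have [[]] := qt n.
Qed.

Lemma cell_barycenter_near n (c : cell_index n) t :
  [/\ c.1%:R / n%:R <= (cell_barycenter t c).1 <= c.1.+1%:R / n%:R &
      c.2%:R / n%:R <= (cell_barycenter t c).2 <= c.2.+1%:R / n%:R].
Proof.
have n0 : (0 < n)%N by exact: leq_ltn_trans (leq0n c.1) (ltn_ord c.1).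
have n0' : (0 : R) < n%:R by rewrite ltr0n.
have nn : n%:R != 0 :> R by rewrite gt_eqF.
rewrite /cell_barycenter; have [u [v [uv ->]]] := @cell_tri_frame R n c.1 c.2 t n0.
rewrite /frame_tri /barycenter /=.
have -> : ((c.1%:R + 1 / 2) / n%:R + ((c.1%:R + 1 / 2) / n%:R + 1 / 2 / n%:R * (u + v)) +
    ((c.1%:R + 1 / 2) / n%:R + 1 / 2 / n%:R * (u - v))) / 3 =
    (c.1%:R + 1 / 2 + u / 3) / n%:R by field.
have -> : ((c.2%:R + 1 / 2) / n%:R + ((c.2%:R + 1 / 2) / n%:R + 1 / 2 / n%:R * (v - u)) +
    ((c.2%:R + 1 / 2) / n%:R + 1 / 2 / n%:R * (v + u))) / 3 =
    (c.2%:R + 1 / 2 + v / 3) / n%:R by field.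
rewrite !ler_pM2r ?invr_gt0// -(natr1 c.1) -(natr1 c.2).
move: (c.1%:R : R) (c.2%:R : R) => x y.
by move: uv; rewrite !inE => /or4P[] /eqP[-> ->]; split; apply/andP; split; lra.
Qed.

Lemma tracks_barycenter t0 : tracks (@cell_barycenter t0).
Proof.
split=> [n c|t q _ qt].
  have n0 : (0 < n)%N by exact: leq_ltn_trans (leq0n c.1) (ltn_ord c.1).
  have n0' : (0 : R) < n%:R by rewrite ltr0n.
  have [/andP[a1 b1] /andP[a2 b2]] := cell_barycenter_near c t0.
  rewrite /unit_square /= !in_itv/=; split; apply/andP; split.
  - by apply: le_trans a1; rewrite divr_ge0.
  - by apply: (le_trans b1); rewrite ler_pdivrMr// mul1r ler_nat; exact: ltn_ord.
  - by apply: le_trans a2; rewrite divr_ge0.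
  - by apply: (le_trans b2); rewrite ler_pdivrMr// mul1r ler_nat; exact: ltn_ord.
have dist (x y z w : R) : z <= x <= w -> z <= y < w -> `|x - y| <= w - z.
  by move=> /andP[? ?] /andP[? ?]; rewrite ler_norml; apply/andP; split; lra.
have step n (i : nat) : i.+1%:R / n.+1%:R - i%:R / n.+1%:R = 1 / n.+1%:R :> R.
  by rewrite -(natr1 i) -mulrBl addrAC subrr add0r.
split; apply: (@cvg_le_inv _ _ 1 0) => n _;
  have [b1 b2] := cell_barycenter_near (q n).1 t0; have [[s1 s2] _] := qt n.
  rewrite -(step n (q n).1.1); apply: dist b1 _.
  by move: s1; rewrite /grid_slot /= in_itv/= !add0r !mul1r.
rewrite -(step n (q n).1.2); apply: dist b2 _.
by move: s2; rewrite /grid_slot /= in_itv/= !add0r !mul1r.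
Qed.

Lemma node_shift_le1 t a : ((node_shift t a).1 <= 1)%N /\ ((node_shift t a).2 <= 1)%N.
Proof. by case: t => -[|[|[|[|//]]]] t4; case: a => -[|[|[|[|[|[|//]]]]]] a6. Qed.

(** The boxes of a point with both physical coordinates below 1 are eventually away
    from the upper and right sides, where shifts wrap around. *)
Lemma tracks_node_corner t0 a0 : tracks (@node_corner t0 a0).
Proof.
split=> [n c|t q Dt qt]; first exact: cell_corner_in.
have near1 (i : forall n, 'I_n.+1) (e : nat) (x : R) : (e <= 1)%N -> 0 <= x < 1 ->
    (forall n, grid_slot 0 1 n.+1 (i n) x) ->
    (fun n => (cyclic_shift (i n) e)%:R / n.+1%:R) @ \oo --> x.
  move=> e1 /andP[x0 x1] ix.
  apply: (@cvg_le_inv _ _ 2 (Num.truncn (1 - x)^-1)) => n nx /=.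
  have n0 : (0 : R) < n.+1%:R by [].
  have lt_in := ltn_ord (i n).
  have big_n : 1 / n.+1%:R < 1 - x.
    rewrite div1r invf_plt ?posrE ?subr_gt0//.
    by apply: (lt_le_trans (truncnS_gt _)); rewrite ler_nat ltnS.
  have slot := ix n; move: slot; rewrite /grid_slot /= in_itv/= !add0r !mul1r.
  move=> /andP[h1 h2].
  have no_wrap : (i n + e < n.+1)%N.
    rewrite ltnNge; apply/negP => wrap.
    have ie : (i n).+1 = n.+1 by lia.
    have : (i n)%:R / n.+1%:R = 1 - 1 / n.+1%:R :> R.
      have -> : (i n)%:R = n.+1%:R - 1 :> R.
        by case: (i n) ie => m ? /= ie; rewrite -[in RHS]ie -natr1 addrK.
      by rewrite mulrBl divff// gt_eqF.
    by move=> iE; move: h1; rewrite iE lerBlDr -lerBlDl leNgt big_n.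
  rewrite modn_small// natrD mulrDl.
  have e_le : (e%:R : R) / n.+1%:R <= 1 / n.+1%:R by rewrite ler_pM2r ?invr_gt0// (ler_nat _ e 1).
  have e_ge : 0 <= (e%:R : R) / n.+1%:R by rewrite divr_ge0.
  move: h2; rewrite -natr1 mulrDl => h2.
  have -> : (2 : R) / n.+1%:R = 1 / n.+1%:R + 1 / n.+1%:R by rewrite -mulrDl.
  move: h1 h2 e_le e_ge; move: (_ / _) (_ / _) (1 / _) => a b w *.
  by rewrite ler_norml; apply/andP; split; lra.
have [e1 e2] := node_shift_le1 t0 a0.
move: Dt; rewrite /half_open_domain /= !in_itv/= => -[[t1 t2] _].
by split; apply: near1 => // n; have [[]] := qt n.
Qed.

Variables (mu : R * R -> R) (M : R) (N : set plane).
Hypotheses (mN : measurable N) (N0 : leb2 N = 0).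
Hypothesis muM : forall p, unit_square p -> `|mu p| <= M.
Hypothesis mu_cont : forall p, unit_square p -> ~ N p ->
  forall eta, 0 < eta -> small_oscillation mu p eta.

Lemma bound_ge0 : 0 <= M.
Proof.
apply: (@le_trans _ _ `|mu (0, 0)|); first exact: normr_ge0.
by apply: muM; rewrite /unit_square /= !in_itv/= !lexx ler01.
Qed.

Lemma sample_cvg P t (q : forall n, cell_index n.+1 * cell_index n.+1) :
  tracks P -> good_domain N t -> (forall n, grid_box (q n) t) ->
  (fun n => mu (P n.+1 (q n).1)) @ \oo --> mu t.1.
Proof.
move=> [Pin Pt] Gt qt; have [P1 P2] := Pt t q Gt.1 qt.
have [St _] := good_domain_sub Gt.
have Nt : ~ N t.1 by move=> Nt; apply: Gt.2; split.
apply/cvgrPdist_lt => e e0; have [d d0 dP] := mu_cont St Nt e0.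
move/cvgrPdist_lt: P1 => /(_ d d0) P1; move/cvgrPdist_lt: P2 => /(_ d d0) P2.
near=> n; rewrite distrC; apply: dP; first exact: Pin.
  by rewrite distrC; near: n.
by rewrite distrC; near: n.
Unshelve. all: by end_near. Qed.

Lemma sum_fst n (F : cell_index n -> R) :
  \sum_(q : cell_index n * cell_index n) F q.1 = n%:R ^+ 2 * \sum_c F c.
Proof.
rewrite -(pair_bigA _ (fun c _ => F c))/=.
under eq_bigr do rewrite sumr_const card_prod card_ord.
by rewrite sumrMnl -[LHS]mulr_natr natrM expr2 mulrC.
Qed.

(** Both samples converge to [mu] outside [N], so this is a Riemann sum of functions
    that tend to 0 almost everywhere. *)
Lemma oscillation_sum_cvg0 P P' : tracks P -> tracks P' ->
  (fun n => n%:R ^- 2 * \sum_c `|mu (P n c) - mu (P' n c)|) @ \oo --> (0 : R).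
Proof.
move=> tP tP'.
pose v n (q : cell_index n * cell_index n) := `|mu (P n q.1) - mu (P' n q.1)|.
have [||_] := @riemann_sum_cvg R N v (M + M) (fun=> 0) mN N0 (addr_ge0 bound_ge0 bound_ge0).
- move=> n q; rewrite /v normr_id (le_trans (ler_normB _ _))// lerD// muM//.
    by have [] := tP.
  by have [] := tP'.
- move=> t q Gt qt; rewrite /v -(normr0 R) -(subrr (mu t.1)).
  by apply: cvg_norm; apply: cvgB; exact: sample_cvg.
rewrite /Rintegral integral0 mulr0.
suff vE n : n%:R ^- 4 * \sum_q v n q =
    n%:R ^- 2 * \sum_c `|mu (P n c) - mu (P' n c)| by under eq_fun do rewrite vE.
rewrite /v (sum_fst (fun c => `|mu (P n c) - mu (P' n c)|)) mulrA.
have [->|n0] := eqVneq n 0%N; first by rewrite !big1 ?mulr0// => -[[]].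
by congr (_ * _); field; rewrite pnatr_eq0.
Qed.

End Sampling.

(** * Asymptotics of the trace moments *)

Section Moments.
Context {R : realType}.

Lemma cvg_finite_sum (I : Type) (r : seq I) (f : I -> R^nat) (l : I -> R) :
  (forall i, f i @ \oo --> l i) ->
  (fun n => \sum_(i <- r) f i n) @ \oo --> \sum_(i <- r) l i.
Proof.
move=> fl; elim: r => [|i r IHr].
  by rewrite big_nil; under eq_fun do rewrite big_nil; exact: cvg_cst.
by rewrite big_cons; under eq_fun do rewrite big_cons; exact: (cvgD (fl i) IHr).
Qed.

Lemma cvg0_sum (I : Type) (r : seq I) (f : I -> R^nat) :
  (forall i, f i @ \oo --> (0 : R)) ->
  (fun n => \sum_(i <- r) f i n) @ \oo --> (0 : R).
Proof.
by move=> f0; have := @cvg_finite_sum _ r f (fun=> 0) f0; rewrite [X in _ --> X -> _]big1.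
Qed.

Notation torus_dim n := #|{: torus_node n}|.
Notation elem_index := ('I_4 * 'I_6 * 'I_6)%type.

Lemma assemble_approx (alpha beta : forall n, cell_index n -> elem_index -> R) :
  (forall y, (fun n => n%:R ^- 2 * \sum_c `|alpha n c y - beta n c y|) @ \oo --> (0 : R)) ->
  mx_approx (fun n => assemble (alpha n)) (fun n => assemble (beta n)).
Proof.
move=> ab0.
apply: (@mx_approx_le _ _ (fun n => \sum_(y : elem_index)
    (n%:R ^- 2 * \sum_c `|alpha n c y - beta n c y|) * `|elem_stiffness R y.1.2 y.2|)).
  by apply: cvg0_sum => y; exact: cvg0Mr.
move=> n; under [leRHS]eq_bigr do rewrite -mulrA.
rewrite -mulr_sumr ler_wpM2l ?invr_ge0 ?exprn_ge0// assembleB.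
apply: (le_trans (l1_assemble _)).
by under eq_bigr do rewrite mulrC.
Qed.

Lemma assemble_bounded (alpha : forall n, cell_index n -> elem_index -> R) M :
  0 <= M -> (forall n c y, `|alpha n c y| <= M) ->
  mx_bounded (fun n => assemble (alpha n)).
Proof.
move=> M0 aM; exists (M * elem_mass); first by rewrite mulr_ge0 ?elem_mass_ge0.
by move=> n; rewrite tr_assemble; split; apply: rowsum_assemble.
Qed.

Lemma rowsum_diag m (v : 'rV[R]_m) M :
  (forall i, `|v 0 i| <= M) -> rowsum_le M (diag_mx v).
Proof.
move=> vM i; rewrite (bigD1 i)//= big1 ?addr0 ?mxE ?eqxx ?mulr1n// => j ji.
by rewrite mxE eq_sym (negbTE ji) mulr0n normr0.
Qed.

Lemma node_diag_bounded (delta : forall n, torus_node n -> R) M :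
  0 <= M -> (forall n Q, `|delta n Q| <= M) ->
  mx_bounded (fun n => node_diag (delta n)).
Proof.
move=> M0 dM; exists M => // n.
rewrite /node_diag tr_diag_mx.
by split; apply: rowsum_diag => i; rewrite mxE.
Qed.

Lemma rowsum_indicator m n (p : 'I_m -> 'I_n -> bool) :
  (forall i j j', p i j -> p i j' -> j = j') ->
  rowsum_le (1 : R) (\matrix_(i, j) (p i j)%:R).
Proof.
move=> p_fun i; have [j pij|pi0] := pickP (p i); last first.
  by rewrite big1// => j _; rewrite mxE pi0 normr0.
rewrite (bigD1 j)//= big1 ?addr0 ?mxE ?pij ?normr1// => j' j'j; rewrite mxE.
by have [pij'|_] := boolP (p i j'); rewrite ?normr0//; rewrite (p_fun _ _ _ pij pij') eqxx in j'j.
Qed.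

Lemma rowsum_node_incidence n : rowsum_le 1 (node_incidence n : 'M[R]_(_, _)).
Proof.
apply: rowsum_indicator => i k l /eqP -> /eqP kl.
exact/enum_val_inj/(@torus_pos_inj R n).
Qed.

Lemma rowsum_node_incidence_tr n : rowsum_le 1 (node_incidence n : 'M[R]_(_, _))^T.
Proof.
have -> : (node_incidence n : 'M[R]_(_, _))^T =
    \matrix_(k, i) (nth (0, 0) (interior_nodes R n) i == torus_pos (enum_val k))%:R.
  by apply/matrixP => k i; rewrite !mxE.
apply: rowsum_indicator => k i j /eqP <- /eqP ij; apply/val_inj/eqP => /=.
by rewrite eq_sym -(nth_uniq (0, 0) (ltn_ord j) (ltn_ord i)) ?undup_uniq// ij.
Qed.

Definition node_projection n : 'M[R]_(torus_dim n) :=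
  (node_incidence n)^T *m node_incidence n.

Lemma node_projection_bounded :
  mx_bounded node_projection.
Proof.
exists 1 => // n; rewrite /node_projection trmx_mul trmxK.
suff H : rowsum_le (1 * 1) ((node_incidence n)^T *m (node_incidence n) : 'M[R]_(torus_dim n)).
  by rewrite mulr1 in H.
by apply: rowsum_le_mul => //; [exact: rowsum_node_incidence_tr|exact: rowsum_node_incidence].
Qed.

Lemma node_projection_approx :
  mx_approx node_projection
            (fun n => 1%:M).
Proof.
apply: (@mx_approx_le _ _ (fun n => 16 / n%:R)); first exact: cvg_inv_nat.
move=> n; apply: (@le_trans _ _ (n%:R ^- 2 * (16 * n%:R))).
  by rewrite ler_wpM2l ?invr_ge0 ?exprn_ge0//; exact: l1_node_incidence.
have [->|n0] := eqVneq n 0%N; first by rewrite !mulr0 invr0 mulr0.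
by rewrite le_eqVlt; apply/orP; left; apply/eqP; field; rewrite pnatr_eq0.
Qed.

Definition torus_stiffness (mu : R * R -> R) n : 'M[R]_(torus_dim n) :=
  assemble (fun c y => mu (cell_barycenter y.1.1 c)).

Definition compressed_stiffness (mu : R * R -> R) n : 'M[R]_(dofs R n) :=
  node_incidence n *m torus_stiffness mu n *m (node_incidence n)^T.

(** As [P *m P^T = 1], the trace of a matrix equals that of its conjugate by [P^T],
    and inner occurrences of [P^T *m P] can be absorbed into the powers. *)
Lemma trace_compression m n (P : 'M[R]_(m, n)) (B : 'M[R]_n) k :
  P *m P^T = 1%:M ->
  \tr ((P *m B *m P^T) ^+ k) = \tr ((P^T *m P *m B) ^+ k *m (P^T *m P)).
Proof.
move=> PP; rewrite -[X in \tr X]mulmx1 -PP mulmxA mxtrace_mulC mulmxA; congr mxtrace.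
set A := P *m B *m P^T; set X := P^T *m P *m B; rewrite -mulmxA.
elim: k => [|k IHk]; first by rewrite !mxexp0 !mul1mx.
by rewrite !mxexpS {1}/A {1}/X -!mulmxA IHk.
Qed.

Lemma ReMC (x : R) (z : R[i]) : complex.Re (x%:C * z) = x * complex.Re z.
Proof. by case: z => a b /=; rewrite mul0r subr0. Qed.

Lemma Re_sum (I : Type) (r : seq I) (F : I -> R[i]) :
  complex.Re (\sum_(i <- r) F i) = \sum_(i <- r) complex.Re (F i).
Proof. by apply: (big_morph (@complex.Re R)) => // -[a b] [c d]. Qed.

Variables (mu : R * R -> R) (M : R) (N : set (measurableTypeR R * measurableTypeR R)).
Hypotheses (mN : measurable N) (N0 : leb2 N = 0).
Hypothesis muM : forall p, unit_square p -> `|mu p| <= M.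
Hypothesis mu_cont : forall p, unit_square p -> ~ N p ->
  forall eta, 0 < eta -> small_oscillation mu p eta.

Let M0 : 0 <= M := bound_ge0 muM.

Definition corner_diag n : 'M[R]_(torus_dim n) :=
  node_diag (fun Q => mu (cell_corner Q.1)).

Lemma cell_barycenter_in n (c : cell_index n) t : unit_square (cell_barycenter t c : R * R).
Proof. by have [] := tracks_barycenter (R := R) t. Qed.

Lemma torus_stiffness_bounded : mx_bounded (torus_stiffness mu).
Proof.
by apply: (assemble_bounded M0) => n c y; apply: muM; exact: cell_barycenter_in.
Qed.

Lemma flat_stiffness_bounded : mx_bounded (@flat_stiffness R).
Proof. by apply: (@assemble_bounded _ 1) => // n c y; rewrite normr1. Qed.

Lemma corner_diag_bounded : mx_bounded corner_diag.
Proof. by apply: (node_diag_bounded M0) => n Q; apply: muM; exact: cell_corner_in. Qed.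

(** On most elements the viscosity at the barycenter is close to that at the corner
    of the cell that owns a given node. *)
Lemma torus_stiffness_approx :
  mx_approx (torus_stiffness mu) (fun n => corner_diag n *m flat_stiffness n).
Proof.
apply: mx_approx_eq (assemble_approx (alpha := fun n c y => mu (cell_barycenter y.1.1 c))
  (beta := fun n c y => mu (node_corner y.1.1 y.1.2 c)) _) => // [n|y].
  rewrite /flat_stiffness /corner_diag node_diag_mul_assemble.
  by apply: eq_bigr => c _; apply: eq_bigr => y _; rewrite mulr1.
exact: (oscillation_sum_cvg0 mN N0 muM mu_cont (tracks_barycenter _) (tracks_node_corner _ _)).
Qed.

(** The two products are assembled with the values of [mu] at the owners of two nodes
    of the same triangle. *)
Lemma corner_diag_comm :
  mx_approx (fun n => corner_diag n *m flat_stiffness n)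
            (fun n => flat_stiffness n *m corner_diag n).
Proof.
apply: mx_approx_eq (assemble_approx
  (alpha := fun n c y => mu (node_corner y.1.1 y.1.2 c))
  (beta := fun n c y => mu (node_corner y.1.1 y.2 c)) _) => [n|n|y].
- rewrite /flat_stiffness /corner_diag node_diag_mul_assemble.
  by apply: eq_bigr => c _; apply: eq_bigr => y _; rewrite mulr1.
- rewrite /flat_stiffness /corner_diag assemble_mul_node_diag.
  by apply: eq_bigr => c _; apply: eq_bigr => y _; rewrite mulr1.
exact: (oscillation_sum_cvg0 mN N0 muM mu_cont (tracks_node_corner _ _) (tracks_node_corner _ _)).
Qed.

Lemma compressed_power_approx k :
  mx_approx (fun n => (node_projection n *m torus_stiffness mu n) ^+ k
                      *m node_projection n)
            (fun n => corner_diag n ^+ k *m flat_stiffness n ^+ k).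
Proof.
have bPi := node_projection_bounded; have bB := torus_stiffness_bounded.
have bD := corner_diag_bounded; have bC := flat_stiffness_bounded.
have bDC := mx_bounded_mul bD bC.
have b1 : mx_bounded (fun n => 1%:M : 'M[R]_(torus_dim n)) := mx_bounded_exp 0 bD.
have PiB : mx_approx
    (fun n => node_projection n *m torus_stiffness mu n)
    (fun n => corner_diag n *m flat_stiffness n).
  apply: mx_approx_trans torus_stiffness_approx.
  apply: mx_approx_eq (mx_approx_mul b1 bB node_projection_approx
    (mx_approx_refl _)) => n //; by rewrite mul1mx.
have PiBk := mx_approx_exp k (mx_bounded_mul bPi bB) bDC PiB.
apply: mx_approx_trans (mx_approx_exp_mul k bD bC corner_diag_comm).
apply: mx_approx_eq (mx_approx_mul (mx_bounded_exp k bDC) bPi PiBk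
  node_projection_approx) => n //; by rewrite mulmx1.
Qed.

Definition symbol_moment n k (q : cell_index n * cell_index n) : R :=
  mu (cell_corner q.1) ^+ k *
  complex.Re (\tr (Ghat (frequency q.2.1) (frequency q.2.2) ^+ k)).

(** The trace of the compression is replaced by that of [D^k C^k], which Bloch waves
    evaluate exactly. *)
Lemma moment_cvg k :
  (fun n => n%:R ^- 2 * \tr (compressed_stiffness mu n ^+ k) -
            n%:R ^- 4 * \sum_(q : cell_index n * cell_index n) symbol_moment k q) @ \oo --> (0 : R).
Proof.
suff mE n : n%:R ^- 2 * \tr (compressed_stiffness mu n ^+ k) -
      n%:R ^- 4 * \sum_(q : cell_index n * cell_index n) symbol_moment k q =
    n%:R ^- 2 * (\tr ((node_projection n *m torus_stiffness mu n) ^+ k *m node_projection n) -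
                 \tr (corner_diag n ^+ k *m flat_stiffness n ^+ k)).
  by under eq_fun do rewrite mE; exact: mx_approx_trace (compressed_power_approx k).
rewrite mulrBr -trace_compression ?node_incidenceM//; congr (_ - _).
have [->|n0] := eqVneq n 0%N.
  by rewrite big1 ?expr0n ?invr0 ?mul0r// => -[[[]]].
have nn : n%:R != 0 :> R by rewrite pnatr_eq0.
have := congr1 (@complex.Re R) (trace_diag_flat (fun c : cell_index n => mu (cell_corner c)) k).
have -> : (n%:R ^+ 2 : R[i]) = (n%:R ^+ 2 : R)%:C by rewrite rmorphXn /= rmorph_nat.
rewrite !ReMC /= Re_sum => trE.
rewrite -(pair_bigA _ (fun c j : cell_index n => mu (cell_corner c) ^+ k *
  complex.Re (\tr (Ghat (frequency j.1) (frequency j.2) ^+ k))))/=.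
under eq_bigr do rewrite -mulr_sumr.
by rewrite -mulr_suml -trE; field.
Qed.

End Moments.

(** * Spectral sums of test functions on the real line *)

Section SpectralSums.
Context {R : realType}.

(** Test functions live on the real line, where the eigenvalues of Hermitian
    matrices lie. *)
Definition spectral_sum (f : R -> R) m (X : 'M[R[i]]_m) : R :=
  \sum_(z <- eigenvalues X) f (complex.Re z).

Lemma spectral_sumE m (X : 'M[R[i]]_m) : conj_symmetric X ->
  exists d : 'I_m -> R,
    [/\ forall f, spectral_sum f X = \sum_i f (d i),
        forall Phi, spectral_mean Phi X = m%:R^-1 * \sum_i Phi (d i)%:C,
        forall k, complex.Re (\tr (X ^+ k)) = \sum_i d i ^+ k &
        forall B, rowsum_le B%:C X -> forall i, `|d i| <= B].
Proof.
move=> hX; have [d dX trX] := hermitian_eigenvalues hX; exists d; split.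
- by move=> f; rewrite /spectral_sum (perm_big _ dX) big_map big_enum.
- by move=> Phi; rewrite /spectral_mean (perm_big _ dX) big_map big_enum.
- by move=> k; rewrite trX.
move=> B XB i.
have d_in : (d i)%:C \in eigenvalues X.
  by rewrite (perm_mem dX); apply: map_f; rewrite mem_enum.
by have := eigenvalue_le_rowsum XB d_in; rewrite normc_def /= expr0n addr0 sqrtr_sqr lecR.
Qed.

Lemma spectral_meanE (Phi : R[i] -> R[i]) m (X : 'M[R[i]]_m) : conj_symmetric X ->
  spectral_mean Phi X =
  (m%:R^-1 * spectral_sum (fun x => complex.Re (Phi x%:C)) X) +i*
  (m%:R^-1 * spectral_sum (fun x => complex.Im (Phi x%:C)) X).
Proof.
move=> hX; have [d [sE mE _ _]] := spectral_sumE hX; rewrite mE !sE.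
have -> : (m%:R : R[i])^-1 = (m%:R^-1 : R)%:C by rewrite fmorphV rmorph_nat.
have -> : \sum_i Phi (d i)%:C =
    (\sum_i complex.Re (Phi (d i)%:C)) +i* (\sum_i complex.Im (Phi (d i)%:C)).
  elim/big_rec3: _ => [//|i y1 y2 y3 _ ->].
  by case: (Phi _).
by simpc.
Qed.

Lemma spectral_sum_horner (p : {poly R}) m (X : 'M[R[i]]_m) : conj_symmetric X ->
  spectral_sum (fun x => p.[x]) X =
  \sum_(k < size p) p`_k * complex.Re (\tr (X ^+ k)).
Proof.
move=> hX; have [d [-> _ trX _]] := spectral_sumE hX.
under eq_bigr do rewrite horner_coef.
rewrite exchange_big; apply: eq_bigr => k _ /=.
by rewrite trX mulr_sumr.
Qed.

Lemma spectral_sum_dist (f g : R -> R) B e m (X : 'M[R[i]]_m) :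
  conj_symmetric X -> rowsum_le B%:C X ->
  (forall x, `|x| <= B -> `|f x - g x| <= e) ->
  `|spectral_sum f X - spectral_sum g X| <= m%:R * e.
Proof.
move=> hX XB fg; have [d [sE _ _ dB]] := spectral_sumE hX.
rewrite !sE -sumrB (le_trans (ler_norm_sum _ _ _))//.
apply: (@le_trans _ _ (\sum_(i < m) e)); last by rewrite sumr_const card_ord mulr_natl.
by apply: ler_sum => i _; apply: fg; exact: dB.
Qed.

(** Since all spectra lie in one bounded interval, convergence for polynomial test
    functions extends to continuous ones. *)
Lemma cvg_by_poly (V : (R -> R) -> R^nat) (l : (R -> R) -> R) (B K : R) (f : R -> R) :
  0 < B -> 0 <= K -> continuous f ->
  (forall g e, (forall x, `|x| <= B -> `|f x - g x| <= e) ->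
     (forall n, `|V f n - V g n| <= K * e) /\ `|l f - l g| <= K * e) ->
  (forall p : {poly R}, V (fun x => p.[x]) @ \oo --> l (fun x => p.[x])) ->
  V f @ \oo --> l f.
Proof.
move=> B0 K0 fc Vl Vp; apply/cvgrPdist_lt => e e0.
have K1 : 0 < 4 * (K + 1) by lra.
have e'0 : 0 < e / (4 * (K + 1)) by rewrite divr_gt0.
have [p fp] := weierstrass_approximation B0 fc e'0.
have [Vfp lfp] := Vl _ _ fp.
have Ke : K * (e / (4 * (K + 1))) <= e / 4.
  rewrite mulrA ler_pdivrMr// (_ : e / 4 * (4 * (K + 1)) = e * (K + 1)); last by field.
  by nra.
have e2 : 0 < e / 2 by rewrite divr_gt0.
have /cvgrPdist_lt/(_ _ e2) := Vp p.
apply: filterS => n; have := Vfp n; move: lfp.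
move: (V _ n) (V _ n) (l _) (l _) => a b c d.
rewrite !ler_norml !ltr_norml => /andP[? ?] /andP[? ?] /andP[? ?].
by apply/andP; split; lra.
Qed.

End SpectralSums.

(** * Sampling of the symbol *)

Section ComplexLimits.
Context {R : realType}.

(** Convergence of complex sequences, by components. *)
Definition cvgc (z : nat -> R[i]) (w : R[i]) : Prop :=
  (fun n => complex.Re (z n)) @ \oo --> complex.Re w /\
  (fun n => complex.Im (z n)) @ \oo --> complex.Im w.

Lemma norm_Im_le (z : R[i]) : `|complex.Im z|%:C <= `|z|.
Proof. by rewrite normc_def lecR -sqrtr_sqr ler_wsqrtr// lerDr sqr_ge0. Qed.

Lemma cvgc_cst w : cvgc (fun=> w) w.
Proof. by split; exact: cvg_cst. Qed.

Lemma cvgcD z z' w w' : cvgc z w -> cvgc z' w' -> cvgc (fun n => z n + z' n) (w + w').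
Proof.
have ReD (x y : R[i]) : complex.Re (x + y) = complex.Re x + complex.Re y by case: x y => ? ? [].
have ImD (x y : R[i]) : complex.Im (x + y) = complex.Im x + complex.Im y by case: x y => ? ? [].
move=> [z1 z2] [z1' z2']; rewrite /cvgc ReD ImD; split.
  by under eq_fun do rewrite ReD; exact: (cvgD z1 z1').
by under eq_fun do rewrite ImD; exact: (cvgD z2 z2').
Qed.

Lemma cvgcM z z' w w' : cvgc z w -> cvgc z' w' -> cvgc (fun n => z n * z' n) (w * w').
Proof.
have ReM (x y : R[i]) : complex.Re (x * y) =
  complex.Re x * complex.Re y - complex.Im x * complex.Im y by case: x y => ? ? [].
have ImM (x y : R[i]) : complex.Im (x * y) =
  complex.Re x * complex.Im y + complex.Im x * complex.Re y.
  by case: x y => ? ? [].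
move=> [z1 z2] [z1' z2']; rewrite /cvgc ReM ImM; split.
  by under eq_fun do rewrite ReM; exact: (cvgB (cvgM z1 z1') (cvgM z2 z2')).
by under eq_fun do rewrite ImM; exact: (cvgD (cvgM z1 z2') (cvgM z2 z1')).
Qed.

Lemma cvgcJ z w : cvgc z w -> cvgc (fun n => (z n)^*) (w^*).
Proof.
have ReJ (x : R[i]) : complex.Re x^* = complex.Re x by case: x.
have ImJ (x : R[i]) : complex.Im x^* = - complex.Im x by case: x.
move=> [z1 z2]; rewrite /cvgc ReJ ImJ; split.
  by under eq_fun do rewrite ReJ.
by under eq_fun do rewrite ImJ; exact: cvgN.
Qed.

Lemma cvgcX z w k : cvgc z w -> cvgc (fun n => z n ^+ k) (w ^+ k).
Proof.
move=> zw; elim: k => [|k IHk]; first exact: cvgc_cst.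
by rewrite exprS; under eq_fun do rewrite exprS; exact: cvgcM.
Qed.

Lemma cvgc_sum (I : Type) (r : seq I) (z : I -> nat -> R[i]) (w : I -> R[i]) :
  (forall i, cvgc (z i) (w i)) ->
  cvgc (fun n => \sum_(i <- r) z i n) (\sum_(i <- r) w i).
Proof.
move=> zw; elim: r => [|i r IHr].
  by rewrite big_nil; under eq_fun do rewrite big_nil; exact: cvgc_cst.
by rewrite big_cons; under eq_fun do rewrite big_cons; exact: cvgcD.
Qed.

Lemma cvgc_expi (u : R^nat) t : u @ \oo --> t -> cvgc (fun n => expi (u n)) (expi t).
Proof.
by move=> ut; split; [exact: (continuous_cvg _ (@continuous_cos R t))|
                      exact: (continuous_cvg _ (@continuous_sin R t))].
Qed.

Lemma cvgc_node_phase (u v : R^nat) t1 t2 t a : u @ \oo --> t1 -> v @ \oo --> t2 ->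
  cvgc (fun n => node_phase (expi (u n)) (expi (v n)) t a)
       (node_phase (expi t1) (expi t2) t a).
Proof. by move=> ut vt; apply: cvgcM; apply: cvgcX; exact: cvgc_expi. Qed.

Lemma cvgc_Ghat (u v : R^nat) t1 t2 r r' : u @ \oo --> t1 -> v @ \oo --> t2 ->
  cvgc (fun n => Ghat (u n) (v n) r r') (Ghat t1 t2 r r').
Proof.
move=> ut vt; rewrite Ghat_assemble; under eq_fun do rewrite Ghat_assemble.
apply: cvgc_sum => y; apply: cvgcM; last exact: cvgc_cst.
apply: cvgcM; last exact: cvgc_node_phase.
apply: cvgcM; first exact: cvgc_cst.
rewrite -conj_node_phase; under eq_fun do rewrite -conj_node_phase.
by apply: cvgcJ; exact: cvgc_node_phase.
Qed.

Lemma cvgc_mxX m (X : nat -> 'M[R[i]]_m) (Y : 'M[R[i]]_m) k i j :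
  (forall i j, cvgc (fun n => X n i j) (Y i j)) ->
  cvgc (fun n => (X n ^+ k) i j) ((Y ^+ k) i j).
Proof.
move=> XY; elim: k i j => [|k IHk] i j.
  by under eq_fun do rewrite mxexp0; rewrite mxexp0; exact: cvgc_cst.
under eq_fun do rewrite mxexpS mxE; rewrite mxexpS mxE.
by apply: cvgc_sum => l; exact: cvgcM.
Qed.

End ComplexLimits.

Section SymbolSamples.
Context {R : realType}.
Variables (mu : R * R -> R) (M : R) (N : set (measurableTypeR R * measurableTypeR R)).
Hypotheses (mN : measurable N) (N0 : leb2 N = 0).
Hypothesis muM : forall p, unit_square p -> `|mu p| <= M.
Hypothesis mu_cont : forall p, unit_square p -> ~ N p ->
  forall eta, 0 < eta -> small_oscillation mu p eta.

Let M0 : 0 <= M := bound_ge0 muM.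

Definition sample_point n (q : cell_index n * cell_index n) : (R * R) * (R * R) :=
  (cell_corner q.1, (frequency q.2.1, frequency q.2.2)).

(** A sampled frequency is the left end of its slot, up to an error of [pi / m] for
    odd [m]. *)
Lemma frequency_shift (m : nat) (x : R) : (0 < m)%N ->
  2 * pi * (x - (m./2)%:R) / m%:R = - pi + 2 * pi * x / m%:R + pi * (odd m)%:R / m%:R.
Proof.
move=> m0; have mE : m%:R = (odd m)%:R + 2 * (m./2)%:R :> R.
  by rewrite -natrM -natrD mul2n odd_double_half.
have nn : m%:R != 0 :> R by rewrite pnatr_eq0 -lt0n.
apply: (mulIf nn); rewrite [RHS]mulrDl [X in _ = X + _]mulrDl !divfK// mE; ring.
Qed.

Lemma frequency_cvg (j : forall n, 'I_n.+1) (x : R) :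
  (forall n, grid_slot (- pi) (2 * pi) n.+1 (j n) x) ->
  (fun n => frequency (j n)) @ \oo --> x.
Proof.
move=> jx; apply: (@cvg_le_inv _ _ _ (3 * pi) 0) => n _.
have := grid_slot_dist (jx n); rewrite /frequency.
have nn : (0 : R) < n.+1%:R by [].
have pi0 := pi_gt0 R.
rewrite frequency_shift//.
have : 0 <= (pi : R) * (odd n.+1)%:R / n.+1%:R <= pi / n.+1%:R.
  rewrite divr_ge0 ?mulr_ge0 ?pi_ge0 ?ler0n//= ler_pM2r ?invr_gt0//.
  by rewrite ger_pMr// lern1 leq_b1.
have -> : 3 * pi / n.+1%:R = 2 * pi / n.+1%:R + pi / n.+1%:R :> R.
  by field; rewrite gt_eqF.
move: (pi * _ / _) (2 * pi * _ / _) (2 * pi / _) (pi / _) => a b c d /andP[a0 ad].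
by rewrite !ler_norml => /andP[? ?]; apply/andP; split; lra.
Qed.

Lemma symbol_hermitian t : conj_symmetric (symbol mu t).
Proof.
move=> i j; rewrite /symbol mxE Ghat_hermitian [X in _ = X^*]mxE rmorphM /=; congr (_ * _).
by rewrite [RHS]conjc_real.
Qed.

Lemma rowsum_symbol t : unit_square t.1 -> rowsum_le (M * elem_mass)%:C (symbol mu t).
Proof.
move=> St i; under eq_bigr do rewrite mxE normrM.
rewrite -mulr_sumr rmorphM /= ler_pM ?sumr_ge0//; last exact: rowsum_Ghat.
by rewrite normc_def /= expr0n addr0 sqrtr_sqr lecR muM.
Qed.

Lemma sample_point_in n (q : cell_index n * cell_index n) : unit_square (sample_point q).1.
Proof. exact: cell_corner_in. Qed.

Lemma symbol_sample_cvg t (q : forall n, cell_index n.+1 * cell_index n.+1) r r' :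
  good_domain N t -> (forall n, grid_box (q n) t) ->
  cvgc (fun n => symbol mu (sample_point (q n)) r r') (symbol mu t r r').
Proof.
move=> Gt qt; rewrite /symbol mxE; under eq_fun do rewrite mxE.
apply: cvgcM.
  split; last exact: cvg_cst.
  exact: (sample_cvg mu_cont (tracks_corner (R := R)) Gt qt).
by apply: cvgc_Ghat; apply: frequency_cvg => n; have [_ []] := qt n.
Qed.

(** The entries are limits of step functions. *)
Lemma measurable_symbol_entry r r' :
  measurable_fun (good_domain N) (fun t => complex.Re (symbol mu t r r')) /\
  measurable_fun (good_domain N) (fun t => complex.Im (symbol mu t r r')).
Proof.
have bound (f : R[i] -> R) : (forall z, `|f z|%:C <= `|z|) -> forall n (q : cell_index n * cell_index n),
    `|f (symbol mu (sample_point q) r r')| <= M * elem_mass.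
  move=> fz n q; rewrite -lecR; apply: (le_trans (fz _)).
  apply: le_trans (rowsum_symbol (sample_point_in q) r).
  by rewrite (bigD1 r')//= lerDl sumr_ge0.
have ME : 0 <= M * elem_mass :> R by rewrite mulr_ge0 ?elem_mass_ge0.
split.
  have [] // := @riemann_sum_cvg R N
    (fun n q => complex.Re (symbol mu (sample_point q) r r')) _
    (fun t => complex.Re (symbol mu t r r')) mN N0 ME.
    by apply: bound; exact: normc_ge_Re.
  by move=> t q Gt qt; have [] := symbol_sample_cvg r r' Gt qt.
have [] // := @riemann_sum_cvg R N
  (fun n q => complex.Im (symbol mu (sample_point q) r r')) _
  (fun t => complex.Im (symbol mu t r r')) mN N0 ME.
  by apply: bound; exact: norm_Im_le.
by move=> t q Gt qt; have [] := symbol_sample_cvg r r' Gt qt.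
Qed.

Lemma spectral_sum_sample_cvg (f : R -> R) t (q : forall n, cell_index n.+1 * cell_index n.+1) :
  continuous f -> good_domain N t -> (forall n, grid_box (q n) t) ->
  (fun n => spectral_sum f (symbol mu (sample_point (q n)))) @ \oo -->
  spectral_sum f (symbol mu t).
Proof.
move=> fc Gt qt.
have B0 : 0 < M * elem_mass + 1 :> R by rewrite ltr_wpDl ?mulr_ge0 ?elem_mass_ge0.
have weaken t' : unit_square t'.1 -> rowsum_le (M * elem_mass + 1)%:C (symbol mu t').
  by move=> St i; apply: (le_trans (rowsum_symbol St i)); rewrite lecR lerDl.
apply: (@cvg_by_poly _ (fun g n => spectral_sum g (symbol mu (sample_point (q n))))
  (fun g => spectral_sum g (symbol mu t)) _ 8 _ B0) => // [g e fg|p].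
  split=> [n|]; apply: spectral_sum_dist fg => //; try exact: symbol_hermitian.
    by apply: weaken; exact: sample_point_in.
  by apply: weaken; have [] := good_domain_sub Gt.
rewrite (spectral_sum_horner _ (symbol_hermitian _)).
under eq_fun do rewrite (spectral_sum_horner _ (symbol_hermitian _)).
apply: cvg_finite_sum => k; apply: cvgMl_tmp.
have [] // : cvgc (fun n => \tr (symbol mu (sample_point (q n)) ^+ k)) (\tr (symbol mu t ^+ k)).
apply: cvgc_sum => i; apply: cvgc_mxX => r r'.
exact: symbol_sample_cvg.
Qed.

End SymbolSamples.

(** * Limits of spectral means *)

Section RealLimits.
Context {R : realType}.
Variables (mu : R * R -> R) (M : R) (N : set (measurableTypeR R * measurableTypeR R)).
Hypotheses (mN : measurable N) (N0 : leb2 N = 0).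
Hypothesis muM : forall p, unit_square p -> `|mu p| <= M.
Hypothesis mu_cont : forall p, unit_square p -> ~ N p ->
  forall eta, 0 < eta -> small_oscillation mu p eta.

Let M0 : 0 <= M := bound_ge0 muM.
Let B : R := M * elem_mass + 1.

(* The added 1 keeps the common spectral radius bound positive when [M = 0]. *)
Let B0 : 0 < B.
Proof. by rewrite ltr_wpDl ?mulr_ge0 ?elem_mass_ge0. Qed.

Definition complex_stiffness n : 'M[R[i]]_(dofs R n) :=
  map_mx (real_complex R) (compressed_stiffness mu n).

Lemma complex_stiffness_hermitian n : conj_symmetric (complex_stiffness n).
Proof.
have sym : (compressed_stiffness mu n)^T = compressed_stiffness mu n.
  by rewrite /compressed_stiffness !trmx_mul trmxK mulmxA /torus_stiffness tr_assemble.
move=> i j; rewrite /complex_stiffness mxE [X in _ = X^*]mxE [RHS]conjc_real.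
by rewrite -[in LHS]sym mxE.
Qed.

Lemma rowsum_complex_stiffness n : rowsum_le B%:C (complex_stiffness n).
Proof.
have H : rowsum_le (1 * (M * elem_mass) * 1) (compressed_stiffness mu n).
  apply: rowsum_le_mul => //; last exact: rowsum_node_incidence_tr.
  apply: rowsum_le_mul; [by rewrite mulr_ge0 ?elem_mass_ge0|exact: rowsum_node_incidence|].
  by apply: rowsum_assemble => // c y; apply: muM; exact: cell_barycenter_in.
move=> i; have := H i; rewrite mul1r mulr1 => Hi.
have -> : \sum_j `|complex_stiffness n i j| = (\sum_j `|compressed_stiffness mu n i j|)%:C.
  rewrite rmorph_sum; apply: eq_bigr => j _.
  by rewrite mxE normc_def /= expr0n addr0 sqrtr_sqr.
by rewrite lecR (le_trans Hi)// lerDl.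
Qed.

Lemma rowsum_symbol_sample t : unit_square t.1 -> rowsum_le B%:C (symbol mu t).
Proof. by move=> St i; apply: (le_trans (rowsum_symbol muM St i)); rewrite lecR lerDl. Qed.

Lemma Re_trace_stiffness n k :
  complex.Re (\tr (complex_stiffness n ^+ k)) = \tr (compressed_stiffness mu n ^+ k).
Proof.
have -> : complex_stiffness n ^+ k = map_mx (real_complex R) (compressed_stiffness mu n ^+ k).
  elim: k => [|k IHk]; first by rewrite !mxexp0 map_mx1.
  by rewrite !mxexpS IHk map_mxM.
by rewrite trace_map_mx.
Qed.

Lemma Re_trace_symbol n k (q : cell_index n * cell_index n) :
  complex.Re (\tr (symbol mu (sample_point q) ^+ k)) = symbol_moment mu k q.
Proof.
by rewrite /symbol exprZn mxtraceZ -rmorphXn ReMC.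
Qed.

Lemma dofs_le n : (dofs R n <= 8 * n ^ 2)%N.
Proof.
have := mulmx1_min (node_incidenceM (R := R) n).
by rewrite !card_prod !card_ord mulnC mulnn.
Qed.

Let T (f : R -> R) n : R := 8^-1 * (n%:R ^- 2 * spectral_sum f (complex_stiffness n)).

Let S (f : R -> R) n : R := n%:R ^- 4 *
  \sum_(q : cell_index n * cell_index n) 8^-1 * spectral_sum f (symbol mu (sample_point q)).

(** For polynomials this is a linear combination of the limits [moment_cvg]; the
    weight 1/8 makes both spectral sums asymptotically means. *)
Lemma spectral_gap_cvg0 (f : R -> R) : continuous f ->
  (fun n => T f n - S f n) @ \oo --> (0 : R).
Proof.
move=> fc.
apply: (@cvg_by_poly _ (fun g n => T g n - S g n) (fun=> 0) B 2) => // [g e fg|p].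
  have e0 : 0 <= e.
    by apply: le_trans (fg 0 _); rewrite ?normr_ge0 ?normr0 ?ltW.
  split=> [n|]; last by rewrite subr0 normr0 mulr_ge0.
  have cancel_pow k : 0 <= (n%:R : R) ^- k * n%:R ^+ k <= 1.
    rewrite mulr_ge0 ?invr_ge0 ?exprn_ge0//=.
    have [->|nn] := eqVneq ((n%:R : R) ^+ k) 0; first by rewrite mulr0.
    by rewrite mulVf.
  have Tfg : `|T f n - T g n| <= e.
    rewrite /T -!mulrBr !normrM (@ger0_norm R 8^-1)// ger0_norm ?invr_ge0 ?exprn_ge0//.
    have := spectral_sum_dist (complex_stiffness_hermitian (n := n)) (rowsum_complex_stiffness (n := n)) fg.
    move=> h; rewrite mulrC ler_pdivrMr//.
    apply: (@le_trans _ _ (n%:R ^- 2 * ((8 * n ^ 2)%:R * e))).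
      rewrite ler_wpM2l ?invr_ge0 ?exprn_ge0// (le_trans h)// ler_wpM2r// ler_nat.
      exact: dofs_le.
    have := cancel_pow 2%N; rewrite natrM natrX.
    move: (n%:R ^- 2 : R) (n%:R ^+ 2 : R) => x y; nra.
  have Sfg : `|S f n - S g n| <= e.
    rewrite /S -mulrBr -sumrB normrM ger0_norm ?invr_ge0 ?exprn_ge0//.
    apply: (@le_trans _ _ (n%:R ^- 4 * (n%:R ^+ 4 * e))); last first.
      by rewrite mulrA; have /andP[_ h] := cancel_pow 4%N; exact: ler_piMl.
    rewrite ler_wpM2l ?invr_ge0 ?exprn_ge0//.
    apply: (le_trans (ler_norm_sum _ _ _)).
    apply: (@le_trans _ _ (\sum_(q : cell_index n * cell_index n) e)); last first.
      rewrite sumr_const !card_prod card_ord -[leLHS]mulr_natl !natrM.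
      by rewrite le_eqVlt; apply/orP; left; apply/eqP; ring.
    apply: ler_sum => q _; rewrite -mulrBr normrM (@ger0_norm R 8^-1)//.
    rewrite mulrC ler_pdivrMr// mulrC.
    apply: spectral_sum_dist fg; first exact: symbol_hermitian.
    by apply: rowsum_symbol_sample; exact: sample_point_in.
  move: Tfg Sfg; move: (T f n) (T g n) (S f n) (S g n) => a b c d.
  by rewrite !ler_norml => /andP[? ?] /andP[? ?]; apply/andP; split; lra.
suff TS n : T (fun x => p.[x]) n - S (fun x => p.[x]) n = \sum_(k < size p)
    (8^-1 * p`_k) * (n%:R ^- 2 * \tr (compressed_stiffness mu n ^+ k) -
      n%:R ^- 4 * \sum_(q : cell_index n * cell_index n) symbol_moment mu k q).
  under eq_fun do rewrite TS.
  apply: cvg0_sum => k; under eq_fun do rewrite mulrC.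
  by apply: cvg0Mr; exact: (moment_cvg mN N0 muM mu_cont).
rewrite /T /S spectral_sum_horner; last exact: complex_stiffness_hermitian.
under [\sum_(q : _ * _) _]eq_bigr do rewrite (spectral_sum_horner _ (symbol_hermitian _ _)) mulr_sumr.
rewrite exchange_big/= !mulr_sumr -sumrB; apply: eq_bigr => k _.
rewrite Re_trace_stiffness -mulr_sumr.
rewrite (eq_bigr (fun q => p`_k * symbol_moment mu k q)) => [|q _]; last first.
  by congr (_ * _); exact: Re_trace_symbol.
by rewrite -mulr_sumr; ring.
Qed.

Lemma spectral_samples_cvg (f : R -> R) : continuous f ->
  S f @ \oo --> (4 * pi ^+ 2)^-1 *
    \int[leb4]_(t in symbol_domain) (8^-1 * spectral_sum f (symbol mu t)).
Proof.
move=> fc; have [p fp] := weierstrass_approximation B0 fc ltr01.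
pose C := 1 + \sum_(k < size p) `|p`_k| * B ^+ k.
have C0 : 0 <= C.
  by rewrite addr_ge0 ?sumr_ge0// => k _; rewrite mulr_ge0// exprn_ge0// ltW.
have fC x : `|x| <= B -> `|f x - 0| <= C.
  move=> xB; rewrite subr0 -(subrK p.[x] (f x)) (le_trans (ler_normD _ _))// lerD ?fp//.
  rewrite horner_coef (le_trans (ler_norm_sum _ _ _))//; apply: ler_sum => k _.
  by rewrite normrM normrX ler_wpM2l// lerXn2r// nnegrE// ltW.
have [] // := @riemann_sum_cvg R N
  (fun n q => 8^-1 * spectral_sum f (symbol mu (sample_point q))) C
  (fun t => 8^-1 * spectral_sum f (symbol mu t)) mN N0 C0.
  move=> n q; rewrite normrM (@ger0_norm R 8^-1)// mulrC ler_pdivrMr// mulrC.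
  have := spectral_sum_dist (symbol_hermitian mu (sample_point q))
    (rowsum_symbol_sample (sample_point_in q)) fC.
  by rewrite /spectral_sum [X in _ - X]big1// subr0.
move=> t q Gt qt; apply: cvgMl_tmp.
exact: (spectral_sum_sample_cvg muM mu_cont fc Gt qt).
Qed.

(** The moment of order 0 counts the unknowns. *)
Lemma dofs_cvg : (fun n => 8^-1 * (n%:R ^- 2 * (dofs R n)%:R)) @ \oo --> (1 : R).
Proof.
rewrite -(cvg_shiftS (fun n => 8^-1 * (n%:R ^- 2 * (dofs R n)%:R) : R)).
have nn n : n.+1%:R != 0 :> R by rewrite pnatr_eq0.
have gap0 : (fun n => 8^-1 * (n.+1%:R ^- 2 * (dofs R n.+1)%:R - 8)) @ \oo --> (0 : R).
  have := moment_cvg mN N0 muM mu_cont 0; rewrite -cvg_shiftS => h.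
  under eq_fun do rewrite mulrC; apply: cvg0Mr.
  suff E n : n.+1%:R ^- 2 * (dofs R n.+1)%:R - 8 =
     n.+1%:R ^- 2 * \tr (compressed_stiffness mu n.+1 ^+ 0) - n.+1%:R ^- 4 *
       \sum_(q : cell_index n.+1 * cell_index n.+1) symbol_moment mu 0 q.
    by under eq_fun do rewrite E.
  rewrite mxexp0 mxtrace1; congr (_ - _).
  rewrite (eq_bigr (fun=> 8)) => [|q _]; last first.
    by rewrite /symbol_moment expr0 mul1r mxexp0 mxtrace1 -(rmorph_nat (real_complex R)).
  rewrite sumr_const !card_prod card_ord -[8 *+ _]mulr_natr !natrM.
  have := nn n; move: (n.+1%:R : R) => x x0; by field.
suff E n : 8^-1 * (n.+1%:R ^- 2 * (dofs R n.+1)%:R) =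
    8^-1 * (n.+1%:R ^- 2 * (dofs R n.+1)%:R - 8) + 1 :> R.
  under eq_fun do rewrite E.
  have := cvgD gap0 (@cvg_cst _ (1 : R) nat \oo _); rewrite add0r; exact.
by move: (_ * (dofs R n.+1)%:R) => x; field.
Qed.

Theorem spectral_mean_cvg (f : R -> R) : continuous f ->
  (fun n => (dofs R n)%:R^-1 * spectral_sum f (complex_stiffness n)) @ \oo -->
  (4 * pi ^+ 2)^-1 * \int[leb4]_(t in symbol_domain) (8^-1 * spectral_sum f (symbol mu t)).
Proof.
move=> fc; set I := _ * \int[_]_(_ in _) _.
have TI : T f @ \oo --> I.
  have -> : T f = (fun n => T f n - S f n + S f n) by apply/funext => n; rewrite subrK.
  by have := cvgD (spectral_gap_cvg0 fc) (spectral_samples_cvg fc); rewrite add0r; exact.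
have lim : (fun n => T f n * (8^-1 * (n%:R ^- 2 * (dofs R n)%:R))^-1) @ \oo --> I.
  by have := cvgM TI (cvgV (oner_neq0 R) dofs_cvg); rewrite invr1 mulr1; exact.
rewrite -(cvg_shiftS (fun n => (dofs R n)%:R^-1 * spectral_sum f (complex_stiffness n) : R)).
move: lim; rewrite -(cvg_shiftS (fun n => T f n * (8^-1 * (n%:R ^- 2 * (dofs R n)%:R))^-1)).
suff -> : (fun n => T f n.+1 * (8^-1 * (n.+1%:R ^- 2 * (dofs R n.+1)%:R))^-1) =
    (fun n => (dofs R n.+1)%:R^-1 * spectral_sum f (complex_stiffness n.+1)) by [].
apply/funext => n.
rewrite /T; move: (spectral_sum _ _) => s.
have nn : n.+1%:R != 0 :> R by rewrite pnatr_eq0.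
have [->|d0] := eqVneq ((dofs R n.+1)%:R : R) 0; first by rewrite !(mulr0, invr0) mul0r.
move: nn d0; move: (n.+1%:R : R) ((dofs R n.+1)%:R : R) => x y x0 y0.
by field; rewrite x0 y0.
Qed.

End RealLimits.

(** * Complex test functions and the eigenvalue distribution *)

Section ComplexTestFunctions.
Context {R : realType}.

Lemma norm_complex_le (a b : R) : `|a +i* b| <= (`|a| + `|b|)%:C.
Proof.
have -> : a +i* b = a%:C + (0 +i* b) by simpc.
apply: (le_trans (ler_normD _ _)).
by rewrite !normc_def /= !expr0n /= addr0 add0r !sqrtr_sqr rmorphD.
Qed.

Lemma cvg_complex (u v : R^nat) (a b : R) : u @ \oo --> a -> v @ \oo --> b ->
  (fun n => u n +i* v n : R[i]^o) @ \oo --> (a +i* b : R[i]^o).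
Proof.
move=> ua vb; apply/cvgrPdist_lt => e e0.
have eE : e = (complex.Re e)%:C by case: e e0 => x y; rewrite ltcE /= => /andP[/eqP -> _].
have e0' : 0 < complex.Re e / 2 by move: e0; rewrite {1}eE ltcR => e0; rewrite divr_gt0.
move/cvgrPdist_lt: ua => /(_ _ e0') ua; move/cvgrPdist_lt: vb => /(_ _ e0') vb.
near=> n; rewrite eE.
have -> : a +i* b - (u n +i* v n) = (a - u n) +i* (b - v n) by [].
apply: (le_lt_trans (norm_complex_le _ _)); rewrite ltcR (splitr (complex.Re e)) ltrD//.
  by near: n.
by near: n.
Unshelve. all: by end_near. Qed.

Lemma continuous_on_reals (Phi : R[i] -> R[i]) (f : R[i] -> R) :
  (forall z w, `|f z - f w|%:C <= `|z - w|) ->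
  continuous (Phi : R[i]^o -> R[i]^o) -> continuous (fun x : R => f (Phi x%:C)).
Proof.
move=> f_lip Phic x; apply/cvgrPdist_lt => e e0.
have e0c : 0 < e%:C by rewrite ltcR.
have /cvgrPdist_lt/(_ _ e0c) := Phic x%:C.
move=> /nbhs_ballP[d /= d0 dP].
have dE : d = (complex.Re d)%:C by case: d d0 {dP} => a b; rewrite ltcE /= => /andP[/eqP -> _].
have d0' : 0 < complex.Re d by move: d0; rewrite {1}dE ltcR.
apply/nbhs_ballP; exists (complex.Re d) => //= y xy.
rewrite -ltcR; apply: (le_lt_trans (f_lip _ _)); apply: dP.
rewrite /ball /= dE -rmorphB normc_def /= expr0n addr0 sqrtr_sqr ltcR.
exact: xy.
Qed.

End ComplexTestFunctions.

Lemma leb4_symbol_domain {R : realType} : leb4 (symbol_domain (R := R)) = (4 * pi ^+ 2)%:E.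
Proof.
rewrite /symbol_domain leb4_prod; [|exact: measurable_unit_square|]; last first.
  by apply: measurableX; exact: measurable_itv.
rewrite leb2_unit_square leb2_prod; try exact: measurable_itv.
rewrite !lebesgue_measure_itv /= lte_fin.
have -> : - pi < pi :> R by rewrite gtrN ?pi_gt0.
by rewrite -!EFinD -!EFinM; congr EFin; ring.
Qed.

Lemma measurable_symbol_domain {R : realType} :
  measurable (symbol_domain : set ((measurableTypeR R * measurableTypeR R) * (measurableTypeR R * measurableTypeR R))).
Proof.
apply: measurableX; first exact: measurable_unit_square.
by apply: measurableX; exact: measurable_itv.
Qed.

(** A Borel function on all of the domain but a null set is measurable for the
    completed measure. *)
Lemma completion_measurable_good {R : realType}
    (N : set (measurableTypeR R * measurableTypeR R)) (g : (R * R) * (R * R) -> R) :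
  measurable N -> leb2 N = 0 -> measurable_fun (good_domain N) g ->
  completion_measurable leb4 symbol_domain g.
Proof.
move=> mN N0 mg B mB; have [Z [mZ Z0 DZ]] := symbol_domain_cover mN N0.
exists (good_domain N `&` g @^-1` B); first exact: (mg (measurable_good_domain mN)).
exists ((symbol_domain `&` g @^-1` B) `\` (good_domain N `&` g @^-1` B)).
  exists Z; split => // t [[Dt Bt] nGt].
  by have [Gt|//] := DZ t Dt; case: nGt.
rewrite setDUK//; move=> t [Gt Bt]; split => //; exact: good_domain_sub Gt.
Qed.

Section Distribution.
Context {R : realType}.
Variables (mu : R * R -> R) (M : R) (N : set (measurableTypeR R * measurableTypeR R)).
Hypotheses (mN : measurable N) (N0 : leb2 N = 0).
Hypothesis muM : forall p, unit_square p -> `|mu p| <= M.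
Hypothesis mu_cont : forall p, unit_square p -> ~ N p ->
  forall eta, 0 < eta -> small_oscillation mu p eta.

Lemma complex_spectral_mean_cvg (Phi : R[i] -> R[i]) :
  continuous (Phi : R[i]^o -> R[i]^o) ->
  (fun n => spectral_mean Phi (complex_stiffness mu n) : R[i]^o) @ \oo -->
  ((fine (leb4 (symbol_domain (R := R))))^-1%:C *
   complex_integral leb4 symbol_domain (fun t => spectral_mean Phi (symbol mu t)) : R[i]^o).
Proof.
move=> Phic; rewrite leb4_symbol_domain /= /complex_integral.
have symE t := spectral_meanE Phi (symbol_hermitian mu t).
have -> : (fun t => complex.Re (spectral_mean Phi (symbol mu t))) =
    (fun t => 8^-1 * spectral_sum (fun x => complex.Re (Phi x%:C)) (symbol mu t)).
  by apply/funext => t; rewrite symE.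
have -> : (fun t => complex.Im (spectral_mean Phi (symbol mu t))) =
    (fun t => 8^-1 * spectral_sum (fun x => complex.Im (Phi x%:C)) (symbol mu t)).
  by apply/funext => t; rewrite symE.
under eq_fun do rewrite (spectral_meanE Phi (complex_stiffness_hermitian mu (n := _))).
set I1 := \int[_]_(_ in _) _; set I2 := \int[_]_(_ in _) _.
have -> : (4 * pi ^+ 2)^-1%:C * (I1 +i* I2) =
  ((4 * pi ^+ 2)^-1 * I1) +i* ((4 * pi ^+ 2)^-1 * I2) by simpc.
apply: cvg_complex; apply: (spectral_mean_cvg mN N0 muM mu_cont); apply: continuous_on_reals => //.
  move=> z w; apply: le_trans (normc_ge_Re (z - w)).
  by case: z w => a b [c d].
move=> z w; apply: le_trans (norm_Im_le (z - w)).
by case: z w => a b [c d].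
Qed.

Lemma dofs_cvg_oo : dofs R @ \oo --> \oo.
Proof.
apply/cvgnyPge => A.
have /cvgrPdist_lt/(_ (1 / 2)) := dofs_cvg mN N0 muM mu_cont.
move=> /(_ ltac:(by rewrite divr_gt0)) half.
near=> n; have n0 : (0 < n)%N by near: n; exists 1%N.
have An : (A <= n)%N by near: n; exists A.
apply: (leq_trans An); rewrite -(ler_nat R).
have : `|1 - 8^-1 * (n%:R ^- 2 * (dofs R n)%:R)| < 1 / 2 :> R by near: n.
have x1 : 1 <= n%:R :> R by rewrite ler1n.
move: (n%:R : R) ((dofs R n)%:R : R) x1 => x y x1.
rewrite ltr_norml => /andP[_]; rewrite ltrBlDr -ltrBlDl => h.
have : 1 - 1 / 2 < 8^-1 * (x ^- 2 * y) by [].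
have x2 : 0 < x ^+ 2 by rewrite exprn_gt0//; lra.
rewrite [x ^- 2 * y]mulrC mulrA ltr_pdivlMr// => h'.
nra.
Unshelve. all: by end_near. Qed.

End Distribution.

Theorem mainTheorem1 (R : realType) (mu : R * R -> R)
  (mu_int : riemann_integrable mu)
  (mu_gt0 : forall p, unit_square p -> 0 < mu p)
  (phi : forall n : nat, 'I_(dofs R n) -> R * R -> R)
  (phi_basis : forall n : nat, (0 < n)%N -> nodal_basis (phi n)) :
  let Ax n : 'M[R[i]]_(dofs R n) := map_mx (real_complex R) (stiffness mu (phi n)) in
  let A n : 'M[R[i]]_(dofs R n + dofs R n) := block_mx (Ax n) 0 0 (Ax n) in
  let f := symbol mu in
  let F t : 'M[R[i]]_(8 + 8) := block_mx (f t) 0 0 (f t) in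
  eig_distribution leb4 symbol_domain Ax f /\
  eig_distribution leb4 symbol_domain A F.
Proof.
move=> Ax A f F; have [[M muM] lower_upper] := mu_int.
have [N [mN N0 mu_cont]] := riemann_ae_continuous muM lower_upper.
have dom_fin : (0 < leb4 (symbol_domain (R := R)) < +oo)%E.
  by rewrite leb4_symbol_domain lte_fin ltry andbT mulr_gt0// exprn_gt0// pi_gt0.
have f_meas : measurable_mx leb4 symbol_domain f.
  move=> r r'; have [mRe mIm] := measurable_symbol_entry mN N0 muM mu_cont r r'.
  by split; apply: completion_measurable_good mN N0 _.
have F_meas : measurable_mx leb4 symbol_domain F.
  have meas0 : completion_measurable leb4 symbol_domain (fun=> (0 : R)).
    by apply: (completion_measurable_good mN N0); exact: measurable_cst.
  have ul a b : (fun t => F t (lshift 8 a) (lshift 8 b)) = (fun t => f t a b).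
    by apply/funext => t; rewrite /F block_mxEul.
  have dr a b : (fun t => F t (rshift 8 a) (rshift 8 b)) = (fun t => f t a b).
    by apply/funext => t; rewrite /F block_mxEdr.
  have ur a b : (fun t => F t (lshift 8 a) (rshift 8 b)) = (fun=> 0).
    by apply/funext => t; rewrite /F block_mxEur mxE.
  have dl a b : (fun t => F t (rshift 8 a) (lshift 8 b)) = (fun=> 0).
    by apply/funext => t; rewrite /F block_mxEdl mxE.
  have part (g : R[i] -> R) (u v : (R * R) * (R * R) -> R[i]) : u = v ->
      completion_measurable leb4 symbol_domain (fun t => g (v t)) ->
      completion_measurable leb4 symbol_domain (fun t => g (u t)) by move=> ->.
  move=> r r'; rewrite -(fintype.splitK r) -(fintype.splitK r').
  case: (fintype.split r) => a; case: (fintype.split r') => b.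
  - by split; apply: (part _ _ _ (ul a b)); have [] := f_meas a b.
  - by split; apply: (part _ _ _ (ur a b)).
  - by split; apply: (part _ _ _ (dl a b)).
  - by split; apply: (part _ _ _ (dr a b)); have [] := f_meas a b.
have AxE n : Ax n.+1 = complex_stiffness mu n.+1.
  by rewrite /Ax /complex_stiffness (stiffness_assemble mu (ltn0Sn n) (phi_basis n.+1 (ltn0Sn n))).
have Ax_lim (Phi : R[i] -> R[i]) : continuous (Phi : R[i]^o -> R[i]^o) ->
    (fun n => spectral_mean Phi (Ax n) : R[i]^o) @ \oo -->
    ((fine (leb4 (symbol_domain (R := R))))^-1%:C *
     complex_integral leb4 symbol_domain (fun t => spectral_mean Phi (f t)) : R[i]^o).
  move=> Phic; rewrite -(cvg_shiftS (fun n => spectral_mean Phi (Ax n) : R[i]^o)).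
  under eq_fun do rewrite AxE.
  have := complex_spectral_mean_cvg mN N0 muM mu_cont Phic.
  by rewrite -(cvg_shiftS (fun n => spectral_mean Phi (complex_stiffness mu n) : R[i]^o)).
have dim_oo := dofs_cvg_oo mN N0 muM mu_cont.
split; split => //; first exact: measurable_symbol_domain.
- by move=> Phi [Phic _]; exact: Ax_lim.
- exact: measurable_symbol_domain.
- apply/cvgnyPge => m; move/cvgnyPge/(_ m) : dim_oo; apply: filterS => n /leq_trans; apply.
  exact: leq_addr.
move=> Phi [Phic _].
have FE : (fun t => spectral_mean Phi (F t)) = (fun t => spectral_mean Phi (f t)).
  by apply/funext => t; exact: spectral_mean_block_diag.
by rewrite FE; under eq_fun do rewrite spectral_mean_block_diag; exact: Ax_lim.
Qed.
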